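(* Let $G=(V,E)$ be a locally finite connected weighted graph with measure $\mu\ge\mu_0>0$, let $p\ge 2$, $q\ge 2$, $h_1,h_2:V\to\mathbb{R}$, $F:V\times\mathbb{R}^2\to\mathbb{R}$, $e_1\in L^{\frac{p}{p-1}}(V)$, $e_2\in L^{\frac{q}{q-1}}(V)$ with $e_1\not\equiv0$, $e_2\not\equiv 0$. Assume: (H1) there is a constant $h_0>0$ such that $h_i(x)\ge h_0$ for all $x\in V$, $i=1,2$; (H2') for every constant $B>0$, $\sum_{x\in A_i}\mu(x)<\infty$, where $A_i=\{x\in V: h_i(x)\le B\}$, $i=1,2$; (F0) $F(x,s,t)$ is continuously differentiable in $(s,t)\in\mathbb{R}^2$ for all $x\in V$, and there are a continuous function $a:[0,\infty)\to[0,\infty)$ and a function $b:V\to[0,\infty)$ with $b\in L^1(V)$ such that $|F_s(x,s,t)|\le a(|(s,t)|)b(x)$, $|F_t(x,s,t)|\le a(|(s,t)|)b(x)$ and $|F(x,s,t)|\le a(|(s,t)|)b(x)$ for all $x\in V$, $(s,t)\in\mathbb{R}^2$; (C1) $F(x,0,0)=0$ for all $x\in V$, and there is $l_0>0$ such that $$|F_s(x,s,t)|\le\frac{h_0}{q+1}\left(|s|^{p-1}+|t|^{\frac{pq-q}{p}}\right),\qquad |F_t(x,s,t)|\le\frac{h_0}{q+1}\left(|s|^p+|t|^{q-1}\right)$$ for all $x\in V$ and all $(s,t)\in\mathbb{R}^2$ with $|(s,t)|<l_0$; (C2) there are $l_1>0$, some $x_3\in\{x\in V: e_1(x)+e_2(x)>0\}$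 and a constant $M$ such that $F(x_3,s,s)\ge M(s^p+s^q)$ for all $s>l_1$, where $$M>\max\left\{\frac{D_1+\mu(x_3)h_1(x_3)}{p\mu(x_3)},\frac{D_2+\mu(x_3)h_2(x_3)}{q\mu(x_3)}\right\},$$ $$D_1=\left(\tfrac{\deg(x_3)}{2}\right)^{\frac p2}\left(\sum_{x\sim x_3}\left(\tfrac{1}{\mu(x)}\right)^{\frac p2-1}+\tfrac{1}{\mu(x_3)^{\frac p2-1}}\right),\quad D_2=\left(\tfrac{\deg(x_3)}{2}\right)^{\frac q2}\left(\sum_{x\sim x_3}\left(\tfrac{1}{\mu(x)}\right)^{\frac q2-1}+\tfrac{1}{\mu(x_3)^{\frac q2-1}}\right);$$ (C3) there are $\nu>\max\{p,q\}$ and $0\le A<\min\left\{\frac{\nu}{p}-1,\frac{\nu}{q}-1\right\}h_0$ such that $\nu F(x,s,t)-F_s(x,s,t)s-F_t(x,s,t)t\le A(|s|^p+|t|^q)$ for all $x\in V$ and all $(s,t)\in\mathbb{R}^2$. Put $\Lambda_0=\min\left\{\frac{l_0}{2}\min\left\{h_0^{\frac1p}\mu_0^{\frac1p},h_0^{\frac1q}\mu_0^{\frac1q}\right\},1\right\}$ and $$\lambda_0=\frac{\min\{1,q-1\}}{2^{\max\{p,q\}-1}(pq+p)\max\left\{h_0^{-\frac1p}\|e_1\|_{L^{\frac{p}{p-1}}(V)},h_0^{-\frac1q}\|e_2\|_{L^{\frac{q}{q-1}}(V)}\right\}}\cdot\Lambda_0^{\max\{p,q\}-1}.$$ Then for each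 $\lambda\in(0,\lambda_0)$ the system $$\begin{cases}-\Delta_p u+h_1(x)|u|^{p-2}u=F_u(x,u,v)+\lambda e_1(x),& x\in V,\\ -\Delta_q v+h_2(x)|v|^{q-2}v=F_v(x,u,v)+\lambda e_2(x),& x\in V,\end{cases}$$ has a nontrivial solution $(u_{\star,1},v_{\star,1})$ of positive energy. Furthermore, if in addition (C4) there are $l_2>0$, $\beta_3>1$, $K_3:V\to\mathbb{R}$ and some $x_4\in\{x\in V:e_1(x)+e_2(x)>0\}$ with $K_3(x_4)>0$ such that $F(x_4,s,s)\ge -K_3(x_4)|s|^{\beta_3}$ for all $s$ with $0<s<l_2$, then for each $\lambda\in(0,\lambda_0)$ the system has another nontrivial solution $(u_{\star,2},v_{\star,2})$ of negative energy.
   Context: Graph setting: $G=(V,E)$ is locally finite (each vertex lies on finitely many edges) and connected; each edge $xy\in E$ has a weight $\omega_{xy}=\omega_{yx}>0$; $y\sim x$ means $xy\in E$; $\deg(x)=\sum_{y\sim x}\omega_{xy}$; $\mu:V\to(0,\infty)$ satisfies $\mu(x)\ge\mu_0>0$ for all $x$. Write $\int_V u\,d\mu=\sum_{x\in V}u(x)\mu(x)$, $\|u\|_{L^r(V)}=(\int_V|u|^rd\mu)^{1/r}$. For $u,v:V\to\mathbb{R}$: $\Gamma(u,v)(x)=\frac{1}{2\mu(x)}\sum_{y\sim x}\omega_{xy}(u(y)-u(x))(v(y)-v(x))$, $|\nabla u|(x)=\sqrt{\Gamma(u,u)(x)}$, and for $p\ge2$ (with $|\cdot|^0=1$ if $p=2$)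 $$\Delta_pu(x)=\frac{1}{2\mu(x)}\sum_{y\sim x}\left(|\nabla u|^{p-2}(y)+|\nabla u|^{p-2}(x)\right)\omega_{xy}(u(y)-u(x)).$$ $C_c(V)$ is the set of finitely supported functions $V\to\mathbb{R}$. $W^{1,s}(V)$ is the completion of $C_c(V)$ under $\|u\|_{W^{1,s}(V)}=(\int_V|\nabla u|^s+|u|^s\,d\mu)^{1/s}$ (a space of functions on $V$). For $h\ge h_0>0$, $W_h^{1,s}(V)=\{u\in W^{1,s}(V):\int_Vh|u|^sd\mu<\infty\}$ with norm $\|u\|_{W_h^{1,s}(V)}=(\int_V|\nabla u|^s+h|u|^sd\mu)^{1/s}$. Let $W=W_{h_1}^{1,p}(V)\times W_{h_2}^{1,q}(V)$. A solution of the system is a pair $(u,v)\in W$ satisfying both equations at every $x\in V$; it is nontrivial if $(u,v)\ne(0,0)$. The energy of $(u,v)\in W$ is $$\varphi_\lambda(u,v)=\frac1p\int_V(|\nabla u|^p+h_1|u|^p)d\mu+\frac1q\int_V(|\nabla v|^q+h_2|v|^q)d\mu-\int_VF(x,u,v)d\mu-\lambda\int_Ve_1u\,d\mu-\lambda\int_Ve_2v\,d\mu.$$ $F_u,F_v$ (also $F_s,F_t$) are the partial derivatives of $F$ in its second and third variables; $|(s,t)|$ is the Euclidean norm. *)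

(* Defs.v *)
From HB Require Import structures.
From mathcomp Require Import all_boot all_order all_algebra.
From mathcomp Require Import all_classical all_reals all_analysis.

Set Implicit Arguments.
Unset Strict Implicit.
Unset Printing Implicit Defensive.

Import Order.TTheory GRing.Theory Num.Theory.
Import numFieldNormedType.Exports.

Local Open Scope classical_set_scope.
Local Open Scope ring_scope.

(* Loops are not excluded: they do not contribute to the differences below. *)
Record weighted_graph (R : realType) (V : choiceType) := WeightedGraph {
  adj : rel V;
  weight : V -> V -> R;
  adj_sym : forall x y, adj x y = adj y x;
  weight_sym : forall x y, adj x y -> weight x y = weight y x;
  weight_gt0 : forall x y, adj x y -> 0 < weight x y;
  locally_finite : forall x, finite_set [set y | adj x y];
  graph_connected : forall x y, exists2 s : seq V, path adj x s & last x s = y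
}.

Section Defs.
Context {R : realType} {V : choiceType}.
Variables (G : weighted_graph R V) (mu : V -> R).
Implicit Types (u v f h : V -> R) (x : V) (r s p : R).

Definition nbrs x : set V := [set y | adj G x y].

Definition deg x : R := \sum_(y \in nbrs x) weight G x y.

(* Unordered sum of u(x)mu(x) over V: as for the Lebesgue integral, the sum of
   the positive parts minus the sum of the negative parts. *)
Definition vint f : \bar R :=
  ((\esum_(x in [set: V]) ((fun x => (f x * mu x)%:E)^\+)%E x)
   - (\esum_(x in [set: V]) ((fun x => (f x * mu x)%:E)^\-)%E x))%E.

Definition Lr_norm r f : \bar R :=
  (vint (fun x => `|f x| `^ r)%R `^ r^-1)%E.

Definition in_Lr r f : Prop := (Lr_norm r f < +oo)%E.

Definition Gamma u v x : R :=
  (2 * mu x)^-1 *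
  \sum_(y \in nbrs x) weight G x y * (u y - u x) * (v y - v x).

Definition grad_norm u x : R := Num.sqrt (Gamma u u x).

(* 0 `^ 0 = 1, so the factors grad_norm `^ (p - 2) are 1 when p = 2. *)
Definition pLaplacian p u x : R :=
  (2 * mu x)^-1 *
  \sum_(y \in nbrs x)
    (grad_norm u y `^ (p - 2) + grad_norm u x `^ (p - 2)) *
    weight G x y * (u y - u x).

Definition Cc u : Prop := finite_set [set x | u x != 0].

Definition W1_norm s u : \bar R :=
  (vint (fun x => grad_norm u x `^ s + `|u x| `^ s)%R `^ s^-1)%E.

(* The completion of Cc realized as a space of functions: the functions that are
   limits, in the W^{1,s} norm, of sequences in Cc. Since mu is bounded below,
   convergence in norm implies pointwise convergence, and a Cauchy sequence of
   Cc converges in norm to its pointwise limit. *)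
Definition in_W1 s u : Prop :=
  exists2 phi : nat -> V -> R, (forall n, Cc (phi n)) &
    (fun n => W1_norm s (fun x => u x - phi n x)) @ \oo --> 0%E.

Definition in_W1h h s u : Prop :=
  in_W1 s u /\ (vint (fun x => h x * `|u x| `^ s)%R < +oo)%E.

End Defs.

Section System.
Context {R : realType} {V : choiceType}.
Variables (G : weighted_graph R V) (mu : V -> R) (p q : R) (h1 h2 : V -> R).
Variables (F : V -> R -> R -> R) (e1 e2 : V -> R) (lambda : R).

Definition euclid (s t : R) : R := Num.sqrt (s ^+ 2 + t ^+ 2).

Definition partial_s x (s t : R) : R := derive1 (fun s' : R => F x s' t) s.
Definition partial_t x (s t : R) : R := derive1 (fun t' : R => F x s t') t.

Definition C1_in_st : Prop := forall x : V,
  [/\ forall z : R * R, differentiable (fun w : R * R => F x w.1 w.2) z,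
      continuous (fun z : R * R => partial_s x z.1 z.2) &
      continuous (fun z : R * R => partial_t x z.1 z.2)].

Definition is_solution (u v : V -> R) : Prop :=
  [/\ in_W1h G mu h1 p u, in_W1h G mu h2 q v &
      forall x : V,
        - pLaplacian G mu p u x + h1 x * (`|u x| `^ (p - 2) * u x)
          = partial_s x (u x) (v x) + lambda * e1 x /\
        - pLaplacian G mu q v x + h2 x * (`|v x| `^ (q - 2) * v x)
          = partial_t x (u x) (v x) + lambda * e2 x].

Definition nontrivial (u v : V -> R) : Prop := (u, v) <> (cst 0, cst 0).

Definition energy (u v : V -> R) : R :=
  p^-1 * fine (vint mu (fun x => grad_norm G mu u x `^ p + h1 x * `|u x| `^ p))
  + q^-1 * fine (vint mu (fun x => grad_norm G mu v x `^ q + h2 x * `|v x| `^ q))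
  - fine (vint mu (fun x => F x (u x) (v x)))
  - lambda * fine (vint mu (fun x => e1 x * u x))
  - lambda * fine (vint mu (fun x => e2 x * v x)).

End System.

(* The constants D_1 (r = p) and D_2 (r = q) at the vertex x. *)
Definition Dconst {R : realType} {V : choiceType} (G : weighted_graph R V)
    (mu : V -> R) (r : R) (x : V) : R :=
  (deg G x / 2) `^ (r / 2) *
  (\sum_(y \in nbrs G x) (mu y)^-1 `^ (r / 2 - 1) + (mu x `^ (r / 2 - 1))^-1).

Definition Lambda0 {R : realType} (p q h0 mu0 l0 : R) : R :=
  Num.min
    (l0 / 2 * Num.min (h0 `^ p^-1 * mu0 `^ p^-1) (h0 `^ q^-1 * mu0 `^ q^-1)) 1.

Definition lambda0 {R : realType} {V : choiceType} (mu : V -> R)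
    (p q h0 mu0 l0 : R) (e1 e2 : V -> R) : R :=
  Num.min 1 (q - 1) /
  (2 `^ (Num.max p q - 1) * (p * q + p) *
   Num.max (h0 `^ (- p^-1) * fine (Lr_norm mu (p / (p - 1)) e1))
           (h0 `^ (- q^-1) * fine (Lr_norm mu (q / (q - 1)) e2)))
  * Lambda0 p q h0 mu0 l0 `^ (Num.max p q - 1).

(* Main.v *)
Require Import Defs.
From HB Require Import structures.
From mathcomp Require Import all_boot all_order all_algebra.
From mathcomp Require Import all_classical all_reals all_analysis.
From mathcomp Require Import ring lra finmap.
Import Order.TTheory GRing.Theory Num.Theory.
Import numFieldNormedType.Exports.
Local Open Scope classical_set_scope.
Local Open Scope ring_scope.

(* The problem is solved on the spaces of functions supported in a finite set
   [K], where the energy is a C^1 function of finitely many variables.  Since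
   [lambda < lambda0], it is bounded below by a positive constant on the sphere
   of radius [Lambda0]: the mountain pass geometry (the far point is a multiple
   of the indicator of [x3]) gives a critical point at a positive level and,
   under (C4), the minimum over the ball is a critical point at a negative
   level.  All bounds are independent of [K]; along an ultrafilter of finite
   sets the critical points converge pointwise to some [(u, v)].

   The convergence is strong.  For [K <= K'] the equation at [K'] may be tested
   with the difference of the two critical points, so uniform convexity bounds
   their distance by the gap of the convex part of the energy plus a
   lower-order integral; the former goes to 0 because the convex parts converge
   along the ultrafilter, the latter because of the integrable bounds in (F0).
   Hence [(u, v)] belongs to the completion of [Cc], and the energies
   converge. *)

(** * Critical points of functions of finitely many variables *)

(** In finite dimension bounded closed sets are compact, so the only obstacle to a minimax argument
    is at infinity. There (C3), in the form of an Ambrosetti-Rabinowitz inequality, makes the energy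
    fall along rays once it is below a given level. The same inequality bounds every critical point
    of bounded energy, and the level is controlled by the energy on one fixed ray, hence
    independently of [K]. Since the energy is merely C^1, no gradient flow is used: deformations are
    a radial stretch followed by one cut-off step of steepest descent. For the limit, the lower
    bounds on the measure and on the potentials turn norm bounds into sup bounds. Then the factor
    [a] in (F0) is bounded by a constant and [b] controls all tails at once, while the tails of the
    linear terms are uniform by duality; this is the source of compactness. Signs survive because
    levels are kept as closed conditions with constants independent of [K], and a nonzero energy
    excludes the zero pair. *)

Section MountainPass.
Context {R : realType} {X : normedModType R} {n : nat}.
Variables (ee : 'I_n -> X) (coord : X -> 'I_n -> R).
Hypothesis coordE : forall w, w = \sum_(i < n) coord w i *: ee i.
Hypothesis proper : forall A : set X, bounded_set A -> closed A -> compact A.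
Variables (phi : X -> R) (D : X -> X -> R).
Hypothesis phi_cont : continuous phi.
Hypothesis D_lin : forall u a w w', D u (a *: w + w') = a * D u w + D u w'.
Hypothesis D_cont : forall w, continuous (D^~ w).
Hypothesis phi_der : forall u w (s : R),
  is_derive s 1 (fun r : R => phi (u + r *: w)) (D (u + s *: w) w).

(** The gradient of [phi] relative to the family [ee]. The derivative at [u] in this direction is a
    sum of squares, so it is positive unless [u] is critical. *)
Definition steepest (u : X) : X := \sum_(i < n) D u (ee i) *: ee i.

Lemma dderiv0 u : D u 0 = 0.
Proof.
by have := D_lin u 1 0 0; rewrite scale1r addr0 => h; lra.
Qed.

Lemma dderiv_sum u (I : Type) (s : seq I) (a : I -> R) (w : I -> X) :
  D u (\sum_(i <- s) a i *: w i) = \sum_(i <- s) a i * D u (w i).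
Proof.
elim: s => [|i s IH]; first by rewrite !big_nil dderiv0.
by rewrite !big_cons D_lin IH.
Qed.

Lemma dderiv_coord u w : D u w = \sum_(i < n) coord w i * D u (ee i).
Proof. by rewrite -dderiv_sum -coordE. Qed.

Lemma dderiv_steepest v u :
  D v (steepest u) = \sum_(i < n) D u (ee i) * D v (ee i).
Proof. exact: dderiv_sum. Qed.

Lemma dderiv_steepest_eq0 u : D u (steepest u) = 0 -> forall w, D u w = 0.
Proof.
rewrite dderiv_steepest => h w; rewrite dderiv_coord big1 // => i _.
have /eqP := h; rewrite psumr_eq0; last by move=> j _; rewrite -expr2 sqr_ge0.
by move=> /allP /(_ i); rewrite mem_index_enum mulf_eq0 orbb => /(_ isT)/eqP->; rewrite mulr0.
Qed.

Lemma dderiv_steepest_ge0 u : 0 <= D u (steepest u).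
Proof. by rewrite dderiv_steepest sumr_ge0 // => i _; rewrite -expr2 sqr_ge0. Qed.

Lemma continuous_sumf (T : topologicalType) (V : normedModType R) (I : Type)
    (s : seq I) (f : I -> T -> V) :
  (forall i, continuous (f i)) -> continuous (fun u => \sum_(i <- s) f i u).
Proof.
move=> fc u; elim: s => [|i s IH].
  under eq_fun do rewrite big_nil; exact: cvg_cst.
under eq_fun do rewrite big_cons.
apply: cvgD; [exact: fc|exact: IH].
Qed.

Lemma steepest_cont : continuous steepest.
Proof.
by apply: continuous_sumf => i u; apply: cvgZr_tmp; exact: D_cont.
Qed.

Lemma steepest_slope_cont : continuous (fun z : X * R =>
  D (z.1 - z.2 *: steepest z.1) (steepest z.1)).
Proof.
under eq_fun do rewrite dderiv_steepest.
apply: continuous_sumf => i z.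
apply: cvgM.
  apply: (@continuous_comp _ _ _ fst (D^~ (ee i))); first exact: cvg_fst.
  exact: D_cont.
apply: (@continuous_comp _ _ _ (fun z : X * R => z.1 - z.2 *: steepest z.1) (D^~ (ee i))); last exact: D_cont.
apply: cvgB; first exact: cvg_fst.
apply: cvgZ; first exact: cvg_snd.
apply: (@continuous_comp _ _ _ fst steepest); first exact: cvg_fst.
exact: steepest_cont.
Qed.

Lemma line_cont u w : continuous (fun r : R => phi (u + r *: w)).
Proof.
move=> s; apply: differentiable_continuous; apply/derivable1_diffP.
by have [] := phi_der u w s.
Qed.

(** The slope along [steepest u] is jointly continuous in the base point and the step, so it stays
    above [m / 2] near each [(u, 0)]. Compactness makes the admissible step uniform, and the mean
    value theorem turns slope into decrease. *)
Lemma steepest_descent (Q : set X) (m : R) : compact Q -> 0 < m ->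
  (forall u, Q u -> m <= D u (steepest u)) ->
  exists2 s0 : R, 0 < s0 & forall u, Q u -> forall s, 0 <= s <= s0 ->
    phi (u - s *: steepest u) <= phi u - s * (m / 2).
Proof.
move=> /compact_near_coveringP cQ m0 Qm.
have : \forall s \near (0 : R), Q `<=` (fun u => m / 2 < D (u - s *: steepest u) (steepest u)).
  apply: (cQ R (nbhs (0 : R)) (fun s u => m / 2 < D (u - s *: steepest u) (steepest u))) => u Qu.
  have := @steepest_slope_cont (u, 0) => /=.
  move=> /cvgrPdist_lt /(_ (m / 2)).
  have m20 : 0 < m / 2 by lra.
  move=> /(_ m20).
  apply: filterS => -[u' s] /=; rewrite scale0r subr0 => h.
  have := Qm u Qu; move: h; rewrite ltr_norml => /andP[_ h1] h2; lra.
case/nbhs_ballP => e /= e0 he.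
exists (e / 2); first lra.
move=> u Qu s /andP[s0 se].
have [c] := @MVT_segment R (fun r => phi (u + r *: - steepest u))
   (fun r => D (u + r *: - steepest u) (- steepest u)) 0 s s0
   (fun x _ => phi_der u (- steepest u) x)
   (continuous_subspaceT (@line_cont u (- steepest u))).
rewrite in_itv /= => /andP[c0 cs].
rewrite scale0r addr0 !scalerN subr0.
have -> : D (u - c *: steepest u) (- steepest u) = - D (u - c *: steepest u) (steepest u).
  by have := D_lin (u - c *: steepest u) (-1) (steepest u) 0; rewrite dderiv0 !addr0 scaleN1r mulN1r.
have : m / 2 < D (u - c *: steepest u) (steepest u).
  apply: (he c _ u Qu); rewrite /ball/= sub0r normrN ger0_norm //; lra.
move=> h1 h2; have : s * (m / 2) <= s * D (u - c *: steepest u) (steepest u).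
  by apply: ler_wpM2l => //; apply: ltW.
lra.
Qed.

(** * Descent along rays, deformation and the mountain pass theorem *)

Section Radial.
Variables (T L nu : R).
Hypotheses (T0 : 0 < T) (nu1 : 1 <= nu).
Hypothesis rad : forall u, T <= `|u| -> D u u <= nu * (phi u - L).

(** By [rad], r^(-nu) (phi(r u) - L) has nonpositive derivative for r >= 1, so phi(t u) - L <= t^nu
    (phi(u) - L). As phi(u) - L <= -1 and t <= t^nu, the drop is at least t - 1. *)
Lemma radial_descent u (t : R) : T <= `|u| -> phi u <= L - 1 -> 1 <= t ->
  phi (t *: u) <= phi u - (t - 1).
Proof.
move=> Tu phiu t1.
pose k (r : R) := (phi (0 + r *: u) - L) * r `^ (- nu).
pose dk (r : R) := (phi (0 + r *: u) - L) *: ((- nu) * r `^ (- nu - 1)) + r `^ (- nu) *: (D (0 + r *: u) u - 0).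
have kd (r : R) : 0 < r -> is_derive r 1 k (dk r).
  move=> r0; have ? := phi_der 0 u r; have ? := @is_derive1_powR R (- nu) r r0.
  exact: is_deriveM.
have dk0 (r : R) : 1 <= r -> dk r <= 0.
  move=> r1; rewrite /dk subr0 add0r.
  have r0 : 0 < r by lra.
  have -> : r `^ (- nu) = r * r `^ (- nu - 1).
    rewrite {1}(_ : - nu = 1 + (- nu - 1)); last by ring.
    by rewrite powRD ?(gt_eqF r0) ?implybT // powRr1 // ltW.
  have := rad (r *: u); rewrite normrZ gtr0_norm //.
  have -> : T <= r * `|u| by apply: (le_trans Tu); rewrite ler_peMl.
  move=> /(_ isT).
  have -> : D (r *: u) (r *: u) = r * D (r *: u) u.
    by have := D_lin (r *: u) r u 0; rewrite dderiv0 !addr0.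
  move=> h.
  have P := powR_ge0 r (- nu - 1).
  have := ler_wpM2r P h; rewrite /GRing.scale /=; lra.
have kc : {within `[1, t], continuous k}.
  apply: derivable_within_continuous => r; rewrite in_itv /= => /andP[r1 _].
  by have [] := kd r (lt_le_trans ltr01 r1).
have [c] := @MVT_segment R k dk 1 t t1 (fun x hx => kd x (lt_trans ltr01 (andP hx).1)) kc.
rewrite in_itv /= => /andP[c1 _] h.
have : k t <= k 1.
  rewrite -subr_le0 h; apply: mulr_le0_ge0; [exact: dk0|lra].
rewrite /k powR1 mulr1 !add0r scale1r powRN ler_pdivrMr; last by apply: powR_gt0; lra.
have tnu : t <= t `^ nu by apply: le1r_powR.
move=> h2.
have : (phi u - L) * t `^ nu <= (phi u - L) * t by apply: ler_wnM2l => //; lra.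
have : 0 <= (t - 1) * (L - 1 - phi u) by apply: mulr_ge0; lra.
lra.
Qed.

Definition clamp (r : R) : R := Num.max 0 (Num.min 1 r).

Lemma clamp_ge0 r : 0 <= clamp r. Proof. by rewrite le_max lexx. Qed.
Lemma clamp_le1 r : clamp r <= 1.
Proof. by rewrite ge_max ler01 ge_min lexx. Qed.
Lemma clamp_eq0 r : r <= 0 -> clamp r = 0.
Proof. by move=> r0; rewrite /clamp min_r ?max_l //; lra. Qed.
Lemma clamp_eq1 r : 1 <= r -> clamp r = 1.
Proof. by move=> r0; rewrite /clamp min_l ?max_r //; lra. Qed.
Lemma clamp_cont (U : topologicalType) (f : U -> R) : continuous f ->
  continuous (fun x => clamp (f x)).
Proof.
move=> fc x; apply: (@continuous_max R U (fun=> 0) (fun x => Num.min 1 (f x))); first exact: cvg_cst.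
by apply: (@continuous_min R U (fun=> 1)); [exact: cvg_cst|exact: fc].
Qed.

(** Two moves in succession: [eta1] stretches far points, where [radial_descent] applies; [eta2]
    takes a step of steepest descent in a ball, where compactness and the absence of critical points
    at level [c] bound the slope below. The cut-offs switch both off where [phi <= 0]. *)
Lemma deformation (al c : R) : 0 < al -> al <= c -> c <= L - 2 ->
  (forall u, phi u = c -> ~ (forall w, D u w = 0)) ->
  exists2 eps : R, 0 < eps & exists eta : X -> X,
    [/\ continuous eta, forall u, phi u <= 0 -> eta u = u &
        forall u, phi u <= c + eps -> phi (eta u) <= c - eps].
Proof.
move=> al0 alc cL nocrit.
(* The stretch at most doubles the norm, so points of norm below [T + 1] land in norm at most
   [2 * T + 2]. The extra unit is room for the cut-off in [k2]. *)
pose Q := [set u : X | `|u| <= 2 * T + 3].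
have normc : continuous (fun u : X => `|u|) by move=> u; exact: norm_continuous.
have cQ : compact Q.
  apply: proper.
    by exists (2 * T + 3); split; [exact: num_real|move=> x hx u /le_trans; apply; exact: ltW].
  apply: (@preimage_closed _ _ (fun u : X => `|u|) [set x | x <= 2 * T + 3]) => //; exact: closed_le.
have dec : continuous (fun u => D u (steepest u)).
  under eq_fun do rewrite dderiv_steepest.
  by apply: continuous_sumf => i u; apply: cvgM; exact: D_cont.
have phic : continuous (fun u => `|phi u - c|).
  move=> u; apply: cvg_norm; apply: cvgB; [exact: phi_cont|exact: cvg_cst].
(* Slope and distance to the level [c] vanish together only at a critical point of level [c], so the
   minimum [m] of their sum is positive. Within [m / 2] of that level the slope is then at least
   [m / 2]. *)
have [u0 Qu0 minu0] : exists2 u0, u0 \in Q & forall u, u \in Q ->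
    D u0 (steepest u0) + `|phi u0 - c| <= D u (steepest u) + `|phi u - c|.
  apply: (@compact_EVT_min X R (fun u => D u (steepest u) + `|phi u - c|)) => //.
    have h : 0 <= 2 * T + 3 by rewrite addr_ge0 // mulr_ge0 // ltW.
    by exists 0; rewrite /Q /= normr0.
  apply: continuous_subspaceT => u; apply: cvgD; [exact: dec|exact: phic].
pose m := D u0 (steepest u0) + `|phi u0 - c|.
have m0 : 0 < m.
  rewrite lt_neqAle addr_ge0 ?dderiv_steepest_ge0 // andbT eq_sym.
  rewrite paddr_eq0 ?dderiv_steepest_ge0 // normr_eq0 subr_eq0.
  by apply/negP => /andP[/eqP h1 /eqP h2]; apply: (nocrit u0 h2); exact: dderiv_steepest_eq0.
pose e0 := Num.min (m / 2) (al / 2).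
have e00 : 0 < e0 by rewrite lt_min; apply/andP; split; lra.
have e0m : e0 <= m / 2 by rewrite ge_min lexx.
have e0al : e0 <= al / 2 by rewrite ge_min lexx orbT.
pose Q' := Q `&` [set u | `|phi u - c| <= e0].
have cQ' : compact Q'.
  apply: compact_closedI => //.
  apply: (@preimage_closed _ _ (fun u : X => `|phi u - c|) [set x | x <= e0]) => //; exact: closed_le.
have [s0 s00 desc] : exists2 s0 : R, 0 < s0 & forall u, Q' u -> forall s, 0 <= s <= s0 ->
    phi (u - s *: steepest u) <= phi u - s * (m / 2 / 2).
  apply: steepest_descent => //; first lra.
  move=> u [Qu /= hu]; have := minu0 u (mem_set Qu); rewrite -/m; lra.
pose k1 u := clamp (`|u| - T) * clamp (2 * phi u / al).
pose eta1 u : X := (1 + k1 u) *: u.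
pose k2 u := clamp (2 * T + 3 - `|u|) * clamp (2 - 2 * `|phi u - c| / e0).
pose eta2 u : X := u - (s0 * k2 u) *: steepest u.
have k10 u : 0 <= k1 u by rewrite mulr_ge0 ?clamp_ge0.
have k11 u : k1 u <= 1 by rewrite mulr_ile1 ?clamp_ge0 ?clamp_le1.
have k20 u : 0 <= k2 u by rewrite mulr_ge0 ?clamp_ge0.
have k21 u : k2 u <= 1 by rewrite mulr_ile1 ?clamp_ge0 ?clamp_le1.
have H1 u : phi u <= L - 1 -> phi (eta1 u) <= phi u - k1 u.
  move=> hu; rewrite /eta1; have [Tu|uT] := leP T `|u|.
    have := @radial_descent u (1 + k1 u) Tu hu; rewrite lerDl => /(_ (k10 u)); lra.
  have -> : k1 u = 0 by rewrite /k1 clamp_eq0 ?mul0r //; lra.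
  by rewrite addr0 scale1r subr0.
have H2 u : phi (eta2 u) <= phi u - s0 * k2 u * (m / 2 / 2).
  rewrite /eta2.
  have [Qu|nQ] := pselect (Q' u).
    apply: desc => //; apply/andP; split; first by rewrite mulr_ge0 // ltW.
    by rewrite ler_piMr // ltW.
  suff -> : k2 u = 0 by rewrite mulr0 scale0r mul0r !subr0.
  rewrite /k2; have [hQ|hQ] := leP `|u| (2 * T + 3); last by rewrite clamp_eq0 ?mul0r //; lra.
  have [hp|hp] := leP `|phi u - c| e0; first by case: nQ.
  rewrite [X in _ * X]clamp_eq0 ?mulr0 // subr_le0 ler_pdivlMr //; lra.
(* The entries make [2 * eps] at most the drop 1 of a full stretch and the drop [s0 * m / 4] of a
   full descent step, and keep [k2] equal to 1 on the band of levels in question. *)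
pose eps := Num.min (1 / 2) (Num.min (e0 / 2) (s0 * (m / 8))).
have eps0 : 0 < eps.
  rewrite !lt_min; apply/and3P; split; [lra|lra|]; apply: mulr_gt0; lra.
have eps1 : eps <= 1 / 2 by rewrite ge_min lexx.
have eps2 : eps <= e0 / 2 by rewrite !ge_min lexx orbT.
have eps3 : eps <= s0 * (m / 8) by rewrite !ge_min lexx !orbT.
exists eps => //; exists (fun u => eta2 (eta1 u)); split.
- have k1c : continuous k1.
    move=> u; apply: cvgM.
      apply: (clamp_cont _ (fun u : X => `|u| - T)) => {}u.
      by apply: cvgB; [exact: norm_continuous|exact: cvg_cst].
    apply: (clamp_cont _ (fun u : X => 2 * phi u / al)) => {}u.
    by apply: cvgMr_tmp; apply: cvgMl_tmp; exact: phi_cont.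
  have k2c : continuous k2.
    move=> u; apply: cvgM.
      apply: (clamp_cont _ (fun u : X => 2 * T + 3 - `|u|)) => {}u.
      by apply: cvgB; [exact: cvg_cst|exact: norm_continuous].
    apply: (clamp_cont _ (fun u : X => 2 - 2 * `|phi u - c| / e0)) => {}u.
    apply: cvgB; first exact: cvg_cst.
    by apply: cvgMr_tmp; apply: cvgMl_tmp; exact: phic.
  have eta1c : continuous eta1.
    move=> u; apply: cvgZ; last exact: cvg_id.
    by apply: cvgD; [exact: cvg_cst|exact: k1c].
  have eta2c : continuous eta2.
    move=> u; apply: cvgB; first exact: cvg_id.
    apply: cvgZ; last exact: steepest_cont.
    by apply: cvgMl_tmp; exact: k2c.
  by move=> u; apply: continuous_comp; [exact: eta1c|exact: eta2c].
- move=> u pu0.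
  have -> : eta1 u = u.
    rewrite /eta1 /k1 [X in _ * X]clamp_eq0 ?mulr0 ?addr0 ?scale1r //.
    rewrite ler_pdivrMr // mul0r; lra.
  rewrite /eta2 /k2 [X in s0 * (_ * X)]clamp_eq0 ?mulr0 ?scale0r ?subr0 //.
  have -> : `|phi u - c| = c - phi u by rewrite distrC ger0_norm //; lra.
  rewrite subr_le0 ler_pdivlMr //; lra.
- move=> u hu.
  have phiu : phi u <= L - 1 by lra.
  have h1 := H1 u phiu; have h2 := H2 (eta1 u).
  have hk1 := k10 u.
  have k2e : 0 <= s0 * k2 (eta1 u) * (m / 2 / 2).
    apply: mulr_ge0; first by apply: mulr_ge0 => //; exact: ltW.
    by apply: ltW; rewrite !divr_gt0.
  have [hle|hgt] := leP (phi (eta1 u)) (c - eps); first lra.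
  have ual : 1 <= 2 * phi u / al by rewrite ler_pdivlMr //; lra.
  (* From norm [T + 1] on the stretch is complete and lowers [phi] by [1 >= 2 * eps], which
     contradicts that [eta1 u] is still above [c - eps]. Only the ball remains. *)
  have [Tu|uT] := leP (T + 1) `|u|.
    have : k1 u = 1 by rewrite /k1 !clamp_eq1 ?mulr1 //; lra.
    lra.
  have n1 : `|eta1 u| <= 2 * T + 2.
    have -> : 2 * T + 2 = 2 * (T + 1) by ring.
    rewrite /eta1 normrZ ger0_norm; last by have := k10 u; lra.
    apply: ler_pM => //; [by have := k10 u; lra|by have := k11 u; lra|exact: ltW].
  have n2 : `|phi (eta1 u) - c| <= e0 / 2 by rewrite ler_norml; apply/andP; split; lra.
  have k2eq : k2 (eta1 u) = 1.
    rewrite /k2 !clamp_eq1 ?mulr1 //; last lra.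
    suff : 2 * `|phi (eta1 u) - c| / e0 <= 1 by lra.
    rewrite ler_pdivrMr //; lra.
  rewrite k2eq in h2; lra.
Qed.

(* The class of paths is replaced by the connected sets containing [0] and
   [e], which only requires images of connected sets to be connected. *)
Theorem mountain_pass (N : X -> R) (e : X) (rho al L0 : R) :
  continuous N -> N 0 < rho -> rho < N e -> 0 < al ->
  (forall u, N u = rho -> al <= phi u) ->
  phi 0 <= 0 -> phi e <= 0 -> L0 <= L - 2 ->
  (forall t, 0 <= t <= 1 -> phi (t *: e) <= L0) ->
  exists u, [/\ forall w, D u w = 0, al <= phi u & phi u <= L0].
Proof.
move=> Nc N0 Ne al0 barr phi0 phie L0L seg.
pose S := [set d : R | exists C : set X,
  [/\ connected C, C 0, C e & forall u, C u -> phi u <= d]].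
have Sal d : S d -> al <= d.
  move=> [C [cC C0 Ce Cd]].
  (* The image under [N] is an interval reaching from below [rho] to above it, so every competing
     set meets the barrier. *)
  have : connected (N @` C).
    by apply: connected_continuous_connected => //; exact: continuous_subspaceT.
  move=> /connected_intervalP /(_ (N 0) (N e)) h.
  have [|||u Cu Nu] := h _ _ rho; [by exists 0|by exists e|by rewrite !ltW|].
  by apply: (le_trans (barr u Nu)); exact: Cd.
have SL0 : S L0.
  exists ((fun t : R => t *: e) @` `[0, 1]); split.
  - apply: connected_continuous_connected; first exact: segment_connected.
    apply: continuous_subspaceT => t; exact: cvgZr_tmp.
  - by exists 0; rewrite ?scale0r //= in_itv /= lexx ler01.
  - by exists 1; rewrite ?scale1r //= in_itv /= lexx ler01.
  - by move=> _ [t /= + <-]; rewrite in_itv /=; exact: seg.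
have Sinf : has_inf S by split; [exists L0|exists al => d /Sal].
have alinf : al <= inf S by apply: lb_le_inf => //; exists L0.
have infL0 : inf S <= L0 by apply: ge_inf => //; exists al => d /Sal.
apply: contrapT => nex.
have [|eps eps0 [eta [etac eta0 etad]]] := deformation _ _ al0 alinf (le_trans infL0 L0L).
  by move=> u pu cu; apply: nex; exists u; split => //; rewrite pu.
(* A nearly optimal competitor, once deformed, is still a competitor, since [0] and [e] have level
   at most 0 and are fixed; yet it beats the infimum. *)
have [d [C [cC C0 Ce Cd]] hd] := inf_adherent eps0 Sinf.
have : inf S <= inf S - eps.
  apply: ge_inf; first by exists al => d' /Sal.
  exists (eta @` C); split.
  - by apply: connected_continuous_connected => //; exact: continuous_subspaceT.
  - by exists 0 => //; exact: eta0.
  - by exists e => //; exact: eta0.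
  - by move=> _ [u Cu <-]; apply: etad; apply: (le_trans (Cd u Cu)); exact: ltW.
lra.
Qed.

End Radial.

(** The minimum over the compact set [N <= rho] is negative while [phi] is positive on its boundary
    [N = rho]. So the minimiser is interior, every line through it stays in the set for short times,
    and all derivatives vanish. *)
Lemma constrained_min (N : X -> R) (e : X) (rho B : R) :
  continuous N -> N 0 <= rho -> N e <= rho -> (forall u, N u <= rho -> `|u| <= B) ->
  (forall u, N u = rho -> 0 < phi u) -> phi e < 0 ->
  exists u, [/\ forall w, D u w = 0, N u <= rho & phi u <= phi e].
Proof.
move=> Nc N0 Ne NB barr phie.
pose Q := [set u : X | N u <= rho].
have cQ : compact Q.
  apply: proper.
    by exists B; split; [exact: num_real|move=> x hx u /NB/le_trans; apply; exact: ltW].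
  apply: (@preimage_closed _ _ N [set x | x <= rho]) => //; exact: closed_le.
have [u /set_mem Qu minu] : exists2 u0, u0 \in Q & forall u, u \in Q -> phi u0 <= phi u.
  by apply: compact_EVT_min => //; [exists e|exact: continuous_subspaceT].
have ue : phi u <= phi e by apply: minu; exact: mem_set.
exists u; split => // w.
have Nu : N u < rho.
  rewrite lt_neqAle Qu andbT; apply/eqP => /barr; lra.
have Nlc : continuous (fun r : R => N (u + r *: w)).
  move=> r; apply: (@continuous_comp _ _ _ (fun r : R => u + r *: w) N); last exact: Nc.
  apply: cvgD; [exact: cvg_cst|exact: cvgZr_tmp].
have /cvgrPdist_lt /(_ (rho - N u)) := Nlc 0.
rewrite scale0r addr0 subr_gt0 => /(_ Nu) /nbhs_ballP[d /= d0 hd].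
have H := @derive1_at_min R (fun r => phi (u + r *: w)) (- d) d 0.
have := phi_der u w 0; rewrite scale0r addr0 => h1.
have : is_derive (0 : R) 1 (fun r => phi (u + r *: w)) 0.
  apply: H.
  - by have : 0 < d := d0; lra.
  - by move=> t _; have [] := phi_der u w t.
  - by rewrite in_itv /= oppr_lt0 d0.
  - move=> t; rewrite in_itv /= => /andP[t1 t2]; rewrite scale0r addr0.
    apply: minu; apply: mem_set; rewrite /Q /=.
    have : ball 0 d t by rewrite /ball /= sub0r normrN ltr_norml t1 t2.
    by move=> /hd; rewrite ltr_norml => /andP[]; lra.
by move=> h2; rewrite -(@derive_val _ _ _ _ _ _ _ h1) (@derive_val _ _ _ _ _ _ _ h2).
Qed.

End MountainPass.


(** * Powers and energy densities *)

Section PowerInequalities.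
Context {R : realType}.
Implicit Types a b c r s : R.

(** Young's inequality for a^(r-1) b with exponents r/(r-1) and r. The case r = 1 is apart because
    the first exponent is then infinite. *)
Lemma tangent_powR r a b : 1 <= r -> 0 <= a -> 0 <= b ->
  a `^ r + r * (a `^ (r - 1) * (b - a)) <= b `^ r.
Proof.
move=> r1 a0 b0.
have aE : a `^ (r - 1) * a = a `^ r by rewrite mulrC mulr_powRB1 //; lra.
rewrite mulrBr aE.
have [->|rn1] := eqVneq r 1.
  by rewrite subrr !powRr0 !powRr1 // !mul1r; lra.
have rgt1 : 1 < r by rewrite lt_neqAle eq_sym rn1.
have q0 : 0 < r / (r - 1) by rewrite divr_gt0 //; lra.
have := @conjugate_powR R (a `^ (r - 1)) b (r / (r - 1)) r (powR_ge0 _ _) b0 q0.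
have r0 : 0 < r by lra.
move=> /(_ r0); rewrite invf_div.
have -> : (r - 1) / r + r^-1 = 1 by field; lra.
move=> /(_ erefl); rewrite -powRrM.
have -> : (r - 1) * (r / (r - 1)) = r by field; lra.
move=> /(ler_wpM2l (ltW r0)).
rewrite mulrDr [r * (b `^ r / r)](_ : _ = b `^ r); last by field; lra.
rewrite [r * (a `^ r * _)](_ : _ = (r - 1) * a `^ r); last by field; lra.
lra.
Qed.

(** Each term on the left has the form s s^(r-1) <= s (s + t)^(r-1). *)
Lemma powR_superadd r s t : 1 <= r -> 0 <= s -> 0 <= t ->
  s `^ r + t `^ r <= (s + t) `^ r.
Proof.
move=> r1 s0 t0; have r0 : 0 < r by lra.
rewrite -!(@mulr_powRB1 R _ r) ?addr_ge0 // mulrDl.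
have rB : 0 <= r - 1 by lra.
by apply: lerD; apply: ler_wpM2l => //; apply: ge0_ler_powR => //;
  rewrite ?nnegrE ?addr_ge0 // ?lerDl ?lerDr.
Qed.

Lemma powR_midpoint r a b : 1 <= r -> 0 <= a -> 0 <= b ->
  ((a + b) / 2) `^ r <= (a `^ r + b `^ r) / 2.
Proof.
move=> r1 a0 b0.
have m0 : 0 <= (a + b) / 2 by rewrite divr_ge0 // addr_ge0.
have h1 := tangent_powR r _ a r1 m0 a0; have h2 := tangent_powR r _ b r1 m0 b0.
move: h1 h2.
have -> : a - (a + b) / 2 = (a - b) / 2 by field.
have -> : b - (a + b) / 2 = - ((a - b) / 2) by field.
rewrite !mulrN; lra.
Qed.

(* With [a = |x|^2], [b = |y|^2] and [c = <x, y>] this is Clarkson's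
   inequality for the exponent [2r]. *)
Lemma clarkson_powR r a b c : 1 <= r -> 0 <= a -> 0 <= b ->
  0 <= a + 2 * c + b -> 0 <= a - 2 * c + b ->
  ((a + 2 * c + b) / 4) `^ r + ((a - 2 * c + b) / 4) `^ r <= (a `^ r + b `^ r) / 2.
Proof.
move=> r1 a0 b0 h1 h2.
apply: le_trans (powR_midpoint _ _ _ r1 a0 b0).
apply: le_trans (powR_superadd _ _ _ r1 _ _) _; rewrite ?divr_ge0 //.
by rewrite le_eqVlt; apply/orP; left; apply/eqP; congr (_ `^ _); field.
Qed.

(** With a = |x|^2, b = |y|^2 and c = <x, y> this is the tangent inequality for the function
    |x|^(2r). It follows from the scalar one because |x - y|^2 >= 0 reads 2c - 2a <= b - a. *)
Lemma tangent_powR_inner r a b c : 1 <= r -> 0 <= a -> 0 <= b ->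
  0 <= a - 2 * c + b ->
  a `^ r + 2 * r * (a `^ (r - 1) * (c - a)) <= b `^ r.
Proof.
move=> r1 a0 b0 h.
apply: le_trans (tangent_powR _ _ _ r1 a0 b0).
rewrite lerD2l.
have -> : 2 * r * (a `^ (r - 1) * (c - a)) = r * (a `^ (r - 1) * (2 * c - 2 * a)) by ring.
apply: ler_wpM2l; first lra.
apply: ler_wpM2l; first exact: powR_ge0.
lra.
Qed.

Lemma inv_powR (z s : R) : 0 <= z -> z^-1 `^ s = (z `^ s)^-1.
Proof. by move=> z0; rewrite -powR_inv1 // -powRrM mulN1r powRN. Qed.

Lemma is_derive_quadratic_error (f : R -> R) (x d C : R) :
  (forall h, `|h| <= 1 -> `|f (h + x) - f x - d * h| <= C * h ^+ 2) ->
  is_derive x 1 f d.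
Proof.
move=> hf.
have C0 : 0 <= C.
  have := hf 1; rewrite normr1 expr1n !mulr1 => /(_ (lexx _)) hh.
  exact: (le_trans (normr_ge0 _) hh).
have lim : (fun h : R => h^-1 *: ((f \o shift x) (h *: (1 : R)) - f x)) @ 0^' --> d.
  apply/cvgrPdist_le => e e0.
  have d1 : 0 < Num.min 1 (e / (C + 1)).
    by rewrite lt_min ltr01 divr_gt0 //; lra.
  exists (Num.min 1 (e / (C + 1))) => //= h.
  rewrite /ball_ /= sub0r normrN lt_min => /andP[h1 h2] h0.
  rewrite [h *: 1]mulr1.
  have := hf h (ltW h1); rewrite -(ger0_norm (sqr_ge0 h)) => hh.
  have -> : d - h^-1 *: (f (h + x) - f x) = - ((f (h + x) - f x - d * h) / h).
    by rewrite /GRing.scale /=; field.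
  rewrite normrN normf_div ler_pdivrMr ?normr_gt0 //.
  apply: (le_trans hh); rewrite normrX expr2 mulrA ler_wpM2r //.
  move: h2; rewrite ltr_pdivlMr; last lra.
  have := normr_ge0 h; lra.
split; first by apply: (cvgP d).
exact: (cvg_lim _ lim).
Qed.

(** The chain rule works unless a = 0, where the power need not be differentiable. There
    nonnegativity of the quadratic forces b = 0, and what is left, (s^2 c)^r, is O(s^2). *)
Lemma is_derive_powR_quadratic r a b c : 1 <= r ->
  (forall s, 0 <= a + 2 * s * b + s ^+ 2 * c) ->
  is_derive (0 : R) 1 (fun s => (a + 2 * s * b + s ^+ 2 * c) `^ r)
    (2 * r * (a `^ (r - 1) * b)).
Proof.
move=> r1 q0.
have a0 : 0 <= a by have := q0 0; rewrite mulr0 mul0r expr0n mul0r !addr0.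
have c0 : 0 <= c.
  rewrite leNgt; apply/negP => cn.
  (* If c < 0, the values at these two opposite points add up to at most 2c. *)
  have h1 := q0 (1 + a / - c); have h2 := q0 (- (1 + a / - c)).
  have e : (- (1 + a / - c)) ^+ 2 = (1 + a / - c) ^+ 2 by rewrite sqrrN.
  rewrite e in h2.
  have k : 0 <= a / - c by rewrite divr_ge0 // oppr_ge0 ltW.
  have k2 : (1 + a / - c) ^+ 2 * c <= (1 + a / - c) * c.
    rewrite expr2 -mulrA; rewrite ler_neMl //; last lra.
    rewrite nmulr_lle0 //; lra.
  have k3 : (1 + a / - c) * c = c - a by field; rewrite lt_eqF.
  lra.
have [an0|ap] := eqVneq a 0; last first.
  have ap' : 0 < a by rewrite lt_neqAle eq_sym ap.
  have dq : is_derive (0 : R) 1 (fun s : R => a + 2 * s * b + s ^+ 2 * c) (2 * b).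
    apply: (is_derive_quadratic_error _ _ _ c) => h _.
    rewrite addr0 expr0n /= mul0r mulr0 mul0r !addr0.
    rewrite (_ : _ - _ = h ^+ 2 * c); last by ring.
    by rewrite mulrC ger0_norm // mulr_ge0 // sqr_ge0.
  have dp : is_derive ((fun s : R => a + 2 * s * b + s ^+ 2 * c) 0) 1 (@powR R ^~ r) (r * a `^ (r - 1)).
    rewrite expr0n /= mul0r mulr0 mul0r !addr0; exact: is_derive1_powR.
  have hh : is_derive (0 : R) 1 (fun s => (a + 2 * s * b + s ^+ 2 * c) `^ r)
      (r * a `^ (r - 1) * (2 * b)) :=
      @is_derive1_comp R (@powR R ^~ r) (fun s => a + 2 * s * b + s ^+ 2 * c) 0 _ _ dp dq.
  by apply: (is_derive_eq hh); ring.
have b00 : b = 0.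
  apply/eqP; rewrite -normr_le0 -(@pmulr_rle0 _ 2) //.
  have [|bn] := leP `|b| 0; first by move=> ?; rewrite pmulr_rle0.
  (* On the side where the linear term is negative, it outweighs s^2 c at this distance. *)
  pose s := `|b| / (c + 1).
  have s0 : 0 < s by rewrite divr_gt0 //; lra.
  have sc : s * c < `|b|.
    by rewrite /s -mulrA gtr_pMr // mulrC ltr_pdivrMr ?mul1r; lra.
  have k : s ^+ 2 * c < s * `|b| by rewrite expr2 -mulrA ltr_pM2l.
  have [b0|b0] := leP 0 b.
    have := q0 (- s); rewrite an0 add0r sqrrN; rewrite ger0_norm // in k; 
    rewrite !mulrN mulNr => h; have : 0 <= s * b by rewrite mulr_ge0 // ltW.
    rewrite -mulrA in h; lra.
  have := q0 s; rewrite an0 add0r; rewrite ltr0_norm // in k => h.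
  have : 0 <= s * - b by rewrite mulr_ge0 // ?oppr_ge0 ltW.
  rewrite -mulrA in h; rewrite mulrN in k *; lra.
rewrite b00 !mulr0.
apply: (is_derive_quadratic_error _ _ _ (c * c `^ (r - 1))) => h h1.
have r0 : 0 < r by lra.
rewrite an0 !mulr0 addr0 expr0n /= mul0r !addr0 powR0 ?gt_eqF // mul0r !subr0 add0r.
have hc0 : 0 <= h ^+ 2 * c by apply: mulr_ge0; first exact: sqr_ge0.
rewrite ger0_norm ?powR_ge0 // -(@mulr_powRB1 R _ r hc0 r0).
have -> : c * c `^ (r - 1) * h ^+ 2 = (h ^+ 2 * c) * c `^ (r - 1) by ring.
apply: ler_wpM2l => //; apply: ge0_ler_powR => //; first by rewrite subr_ge0.
apply: ler_piMl => //; rewrite -(ger0_norm (sqr_ge0 h)) normrX.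
by apply: exprn_ile1.
Qed.

(** Differentiability of the power settles positive limits. At limit 0 the estimate is made by hand,
    and for r = 0 the convention 0^0 = 1 makes the power constant. *)
Lemma cvg_powR (I : Type) (U : set_system I) (f : I -> R) (l r : R) :
  Filter U -> 0 <= r -> (forall i, 0 <= f i) -> 0 <= l -> f @ U --> l ->
  (fun i => f i `^ r) @ U --> l `^ r.
Proof.
move=> FU; rewrite le_eqVlt => /predU1P[<- _ _ _|r0 f0 l0 fl].
  by under eq_fun do rewrite powRr0; rewrite powRr0; exact: cvg_cst.
have [le0|ln0] := eqVneq l 0; last first.
  have lp : 0 < l by rewrite lt_neqAle eq_sym ln0.
  apply: (@continuous_cvg _ _ _ U _ f (@powR R ^~ r) l _ fl).
  apply: differentiable_continuous; apply/derivable1_diffP.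
  by have [] := @is_derive1_powR R r l lp.
rewrite le0 powR0 ?gt_eqF //; apply/cvgrPdist_lt => e e0.
have := fl; rewrite le0 => /cvgrPdist_lt /(_ (e `^ r^-1)).
rewrite powR_gt0 // => /(_ isT); apply: filterS => i.
rewrite !sub0r !normrN !ger0_norm ?powR_ge0 // => h.
have -> : e = (e `^ r^-1) `^ r by rewrite -powRrM mulVf ?gt_eqF // powRr1 // ltW.
by apply: gt0_ltr_powR => //; rewrite nnegrE // powR_ge0.
Qed.

End PowerInequalities.

(** * The densities |grad u|^p + h |u|^p: convexity, derivatives, pointwise limits *)

Section Densities.
Context {R : realType} {V : choiceType}.
Variables (G : weighted_graph R V) (mu : V -> R).
Hypothesis mu_gt0 : forall x, 0 < mu x.
Implicit Types (u v w : V -> R) (x y : V).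

Definition nbr x : {fset V} := fset_set (nbrs G x).

Lemma in_nbr x y : (y \in nbr x) = adj G x y.
Proof.
rewrite in_fset_set; last exact: locally_finite.
by apply/idP/idP => [/set_mem|h]; [|apply: mem_set].
Qed.

Lemma nbr_sym x y : (y \in nbr x) = (x \in nbr y).
Proof. by rewrite !in_nbr adj_sym. Qed.

Lemma GammaE u v x : Gamma G mu u v x =
  (2 * mu x)^-1 * \sum_(y <- nbr x) weight G x y * (u y - u x) * (v y - v x).
Proof. by rewrite /Gamma fsbig_finite //; exact: locally_finite. Qed.

Lemma pLaplacianE p u x : pLaplacian G mu p u x = (2 * mu x)^-1 *
  \sum_(y <- nbr x) (grad_norm G mu u y `^ (p - 2) + grad_norm G mu u x `^ (p - 2)) *
    weight G x y * (u y - u x).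
Proof. by rewrite /pLaplacian fsbig_finite //; exact: locally_finite. Qed.

Lemma Gamma_lin u v w (a : R) x : Gamma G mu u (fun y => a * v y + w y) x =
  a * Gamma G mu u v x + Gamma G mu u w x.
Proof.
rewrite !GammaE mulrCA -mulrDr; congr (_ * _).
by rewrite mulr_sumr -big_split; apply: eq_bigr => y _ /=; ring.
Qed.

Lemma Gamma_ge0 u x : 0 <= Gamma G mu u u x.
Proof.
rewrite GammaE; apply: mulr_ge0; first by rewrite invr_ge0 mulr_ge0 // ltW.
rewrite big_seq; apply: sumr_ge0 => y; rewrite in_nbr => xy.
by rewrite -mulrA -expr2 mulr_ge0 ?sqr_ge0 // ltW // weight_gt0.
Qed.

Lemma Gamma_line u w (s : R) x :
  Gamma G mu (fun y => u y + s * w y) (fun y => u y + s * w y) x =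
  Gamma G mu u u x + 2 * s * Gamma G mu u w x + s ^+ 2 * Gamma G mu w w x.
Proof.
rewrite !GammaE ![_ * ((2 * mu x)^-1 * _)]mulrCA -!mulrDr; congr (_ * _).
by rewrite !mulr_sumr -!big_split; apply: eq_bigr => y _ /=; ring.
Qed.

Lemma grad_powR p u x : grad_norm G mu u x `^ p = Gamma G mu u u x `^ (p / 2).
Proof. by rewrite /grad_norm -powR12_sqrt ?Gamma_ge0 // -powRrM mulrC. Qed.

Lemma norm_powR_sqr p (a : R) : `|a| `^ p = (a ^+ 2) `^ (p / 2).
Proof.
by rewrite -sqrtr_sqr -powR12_sqrt ?sqr_ge0 // -powRrM mulrC.
Qed.

Section Exponent.
Variables (p : R) (h : V -> R).
Hypotheses (p2 : 2 <= p) (h_ge0 : forall x, 0 <= h x).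

Definition dens u x : R := grad_norm G mu u x `^ p + h x * `|u x| `^ p.

(* The derivative of [dens / p] at [u] in the direction [w]. *)
Definition ddens u w x : R :=
  grad_norm G mu u x `^ (p - 2) * Gamma G mu u w x
  + h x * (`|u x| `^ (p - 2) * u x * w x).

Let r1 : 1 <= p / 2. Proof. by rewrite ler_pdivlMr // mul1r. Qed.
Let rB : (p - 2) / 2 = p / 2 - 1. Proof. by field. Qed.

Lemma densE u x : dens u x =
  Gamma G mu u u x `^ (p / 2) + h x * (u x ^+ 2) `^ (p / 2).
Proof. by rewrite /dens grad_powR norm_powR_sqr. Qed.

Lemma ddensE u w x : ddens u w x =
  Gamma G mu u u x `^ (p / 2 - 1) * Gamma G mu u w x
  + h x * ((u x ^+ 2) `^ (p / 2 - 1) * (u x * w x)).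
Proof. by rewrite /ddens grad_powR norm_powR_sqr rB !mulrA. Qed.

Lemma dens_ge0 u x : 0 <= dens u x.
Proof. by rewrite addr_ge0 ?mulr_ge0 ?powR_ge0. Qed.

Lemma dens_ge u x (h0 : R) : h0 <= h x -> h0 * `|u x| `^ p <= dens u x.
Proof.
move=> hx; apply: (@le_trans _ _ (h x * `|u x| `^ p)).
  by rewrite ler_wpM2r ?powR_ge0.
by rewrite lerDr powR_ge0.
Qed.

Lemma ddens_lin u (a : R) w w' x :
  ddens u (fun y => a * w y + w' y) x = a * ddens u w x + ddens u w' x.
Proof. by rewrite /ddens Gamma_lin; ring. Qed.

Lemma ddens_diag u x : ddens u u x = dens u x.
Proof.
have r0 : 0 < p / 2 by have := r1; lra.
rewrite ddensE densE -expr2.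
by rewrite ![_ `^ (p / 2 - 1) * _]mulrC !mulr_powRB1 ?Gamma_ge0 ?sqr_ge0.
Qed.

Lemma dens_scale (a : R) u x : dens (fun y => a * u y) x = `|a| `^ p * dens u x.
Proof.
have e : (fun y => a * u y) = (fun y => 0 + a * u y) by apply/funext => y; rewrite add0r.
have Gz w : Gamma G mu (fun=> 0) w x = 0.
  by rewrite GammaE big1 ?mulr0 // => y _; rewrite subrr mulr0 mul0r.
rewrite !densE {1 2}e (Gamma_line (fun=> 0)) !Gz mulr0 !add0r.
rewrite exprMn (@powRM R _ _ _ (sqr_ge0 a) (Gamma_ge0 u x)).
by rewrite (@powRM R _ _ _ (sqr_ge0 a) (sqr_ge0 (u x))) (norm_powR_sqr p a); ring.
Qed.

(** The scalar Clarkson inequality is applied twice, with Gamma(u, v)(x) and with u(x) v(x) as the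
    inner product; nonnegativity of Gamma and of squares supplies its hypotheses. *)
Lemma dens_clarkson u v x :
  dens (fun y => (u y + v y) / 2) x + dens (fun y => (u y - v y) / 2) x
  <= (dens u x + dens v x) / 2.
Proof.
have half (s : R) : (fun y => (u y + s * v y) / 2) = (fun y => 0 + 2^-1 * (u y + s * v y)).
  by apply/funext => y; rewrite add0r mulrC.
have Gz w : Gamma G mu (fun=> 0) w x = 0.
  by rewrite GammaE big1 ?mulr0 // => y _; rewrite subrr mulr0 mul0r.
have GE s : Gamma G mu (fun y => (u y + s * v y) / 2) (fun y => (u y + s * v y) / 2) x
   = (Gamma G mu u u x + 2 * s * Gamma G mu u v x + s ^+ 2 * Gamma G mu v v x) / 4.
  by rewrite half (Gamma_line (fun=> 0)) !Gz mulr0 !add0r Gamma_line; field.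
have e1 : (fun y => (u y + v y) / 2) = (fun y => (u y + 1 * v y) / 2).
  by apply/funext => y; rewrite mul1r.
have e2 : (fun y => (u y - v y) / 2) = (fun y => (u y + -1 * v y) / 2).
  by apply/funext => y; rewrite mulN1r.
rewrite !densE e1 e2 !GE.
set a := Gamma _ _ u u x; set b := Gamma _ _ v v x; set c := Gamma _ _ u v x.
have a0 : 0 <= a by exact: Gamma_ge0.
have b0 : 0 <= b by exact: Gamma_ge0.
have E1 : a + 2 * 1 * c + 1 ^+ 2 * b = a + 2 * c + b by ring.
have E2 : a + 2 * -1 * c + (-1) ^+ 2 * b = a - 2 * c + b by ring.
have P1 : 0 <= a + 2 * c + b.
  by rewrite -E1 -Gamma_line Gamma_ge0.
have P2 : 0 <= a - 2 * c + b.
  by rewrite -E2 -Gamma_line Gamma_ge0.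
rewrite E1 E2.
have A := clarkson_powR _ _ _ _ r1 a0 b0 P1 P2.
have Q1 : ((u x + v x) / 2) ^+ 2 = (u x ^+ 2 + 2 * (u x * v x) + v x ^+ 2) / 4 by field.
have Q2 : ((u x - v x) / 2) ^+ 2 = (u x ^+ 2 - 2 * (u x * v x) + v x ^+ 2) / 4 by field.
rewrite Q1 Q2.
have S1 : 0 <= u x ^+ 2 + 2 * (u x * v x) + v x ^+ 2.
  by rewrite (_ : _ + _ = (u x + v x) ^+ 2) ?sqr_ge0 //; ring.
have S2 : 0 <= u x ^+ 2 - 2 * (u x * v x) + v x ^+ 2.
  by rewrite (_ : _ + _ = (u x - v x) ^+ 2) ?sqr_ge0 //; ring.
have B := clarkson_powR _ _ _ _ r1 (sqr_ge0 (u x)) (sqr_ge0 (v x)) S1 S2.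
have := ler_wpM2l (h_ge0 x) B; lra.
Qed.

Lemma dens_tangent u v x : dens u x + p * ddens u (fun y => v y - u y) x <= dens v x.
Proof.
have e : (fun y => v y - u y) = (fun y => -1 * u y + v y).
  by apply/funext => y; rewrite mulN1r addrC.
rewrite e ddens_lin.
have -> : -1 * ddens u u x + ddens u v x = ddens u v x - dens u x.
  by rewrite ddens_diag; ring.
rewrite -ddens_diag !ddensE densE.
set a := Gamma _ _ u u x; set b := Gamma _ _ v v x; set c := Gamma _ _ u v x.
have a0 : 0 <= a by exact: Gamma_ge0.
have b0 : 0 <= b by exact: Gamma_ge0.
have P2 : 0 <= a - 2 * c + b.
  have -> : a - 2 * c + b = a + 2 * -1 * c + (-1) ^+ 2 * b by ring.
  by rewrite -Gamma_line Gamma_ge0.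
have S2 : 0 <= u x ^+ 2 - 2 * (u x * v x) + v x ^+ 2.
  by rewrite (_ : _ + _ = (u x - v x) ^+ 2) ?sqr_ge0 //; ring.
have r0 : 0 < p / 2 by have := r1; lra.
have A := tangent_powR_inner _ _ _ _ r1 a0 b0 P2.
have B := ler_wpM2l (h_ge0 x) (tangent_powR_inner _ _ _ _ r1 (sqr_ge0 (u x)) (sqr_ge0 (v x)) S2).
have aE : a `^ (p / 2 - 1) * a = a `^ (p / 2) by rewrite mulrC mulr_powRB1.
have uE : (u x ^+ 2) `^ (p / 2 - 1) * u x ^+ 2 = (u x ^+ 2) `^ (p / 2).
  by rewrite mulrC mulr_powRB1 ?sqr_ge0.
rewrite -!expr2 aE uE.
have p22 : 2 * (p / 2) = p by field.
rewrite p22 !mulrBr aE uE in A B *.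
lra.
Qed.

(** Quantitative convexity: Clarkson bounds the half difference by the mean of the two densities
    minus the density of the midpoint, and the tangent at [v] bounds the midpoint from below. *)
Lemma dens_convex_gap u v x :
  dens (fun y => (u y - v y) / 2) x <=
  (dens u x - dens v x) / 2 - p / 2 * ddens v (fun y => u y - v y) x.
Proof.
have A := dens_clarkson u v x.
have B := dens_tangent v (fun y => (u y + v y) / 2) x.
have e : (fun y => (u y + v y) / 2 - v y) = (fun y => 2^-1 * (u y - v y) + 0).
  by apply/funext => y; field.
have z : ddens v (fun=> 0) x = 0.
  by rewrite /ddens GammaE big1 ?mulr0 ?addr0 // => y _; rewrite subrr mulr0.
rewrite e (ddens_lin v _ (fun y => u y - v y) (fun=> 0)) z in B.
lra.
Qed.

Lemma densD_le u v x :
  dens (fun y => u y + v y) x <= 2 `^ p * (dens u x + dens v x).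
Proof.
have e : (fun y => u y + v y) = (fun y => 2 * ((u y + v y) / 2)).
  by apply/funext => y; field.
rewrite e dens_scale ger0_norm //; apply: ler_wpM2l; first exact: powR_ge0.
have := dens_clarkson u v x.
have := dens_ge0 (fun y => (u y - v y) / 2) x.
have := dens_ge0 u x; have := dens_ge0 v x; lra.
Qed.

Lemma dens_derive u w x :
  is_derive (0 : R) 1 (fun s : R => dens (fun y => u y + s * w y) x) (p * ddens u w x).
Proof.
under eq_fun do rewrite densE Gamma_line.
have q (s : R) : (u x + s * w x) ^+ 2 = u x ^+ 2 + 2 * s * (u x * w x) + s ^+ 2 * w x ^+ 2.
  ring.
under eq_fun do rewrite q.
have p22 : 2 * (p / 2) = p by field.
have A := is_derive_powR_quadratic (p / 2) (Gamma G mu u u x) (Gamma G mu u w x) (Gamma G mu w w x) r1.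
have {}A := A (fun s => ltac:(rewrite -Gamma_line; exact: Gamma_ge0)).
have B := is_derive_powR_quadratic (p / 2) (u x ^+ 2) (u x * w x) (w x ^+ 2) r1.
have {}B := B (fun s => ltac:(rewrite -q; exact: sqr_ge0)).
have C := is_deriveD A (is_deriveZ (h x) B).
apply: is_derive_eq C _.
rewrite ddensE p22 /GRing.scale /=; ring.
Qed.

Lemma dens_supp u x : u x = 0 -> (forall y, y \in nbr x -> u y = 0) -> dens u x = 0.
Proof.
move=> ux uy; have p0 : p / 2 != 0 by rewrite gt_eqF //; have := r1; lra.
rewrite densE ux expr0n /= powR0 // mulr0 addr0 GammaE big1_seq ?mulr0 ?powR0 //.
by move=> y /= yx; rewrite ux (uy y yx) subrr mulr0.
Qed.

Section Limits.
Context {I : Type} (U : set_system I) {FU : Filter U}.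
Variables (f : I -> V -> R) (u : V -> R).
Hypothesis fu : forall x, (fun i => f i x) @ U --> u x.

Lemma Gamma_cvg (g : I -> V -> R) w x : (forall x, (fun i => g i x) @ U --> w x) ->
  (fun i => Gamma G mu (f i) (g i) x) @ U --> Gamma G mu u w x.
Proof.
move=> gw; under eq_fun do rewrite GammaE; rewrite GammaE.
apply: cvgMl_tmp.
elim: (enum_fset (nbr x)) => [|y s IH].
  by under eq_fun do rewrite big_nil; rewrite big_nil; exact: cvg_cst.
under eq_fun do rewrite big_cons; rewrite big_cons; apply: cvgD => //.
apply: cvgM; last by apply: cvgB; exact: gw.
by apply: cvgMl_tmp; apply: cvgB; exact: fu.
Qed.

Lemma grad_powR_cvg (s : R) x : 0 <= s ->
  (fun i => grad_norm G mu (f i) x `^ s) @ U --> grad_norm G mu u x `^ s.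
Proof.
move=> s0; under eq_fun do rewrite grad_powR; rewrite grad_powR.
apply: cvg_powR; rewrite ?divr_ge0 ?Gamma_ge0 //.
  by move=> i; exact: Gamma_ge0.
by apply: Gamma_cvg.
Qed.

Lemma norm_powR_cvg (s : R) x : 0 <= s ->
  (fun i => `|f i x| `^ s) @ U --> `|u x| `^ s.
Proof. by move=> s0; apply: cvg_powR => //; apply: cvg_norm; exact: fu. Qed.

Lemma dens_cvg x : (fun i => dens (f i) x) @ U --> dens u x.
Proof.
have p0 : 0 <= p by have := p2; lra.
apply: cvgD; first exact: grad_powR_cvg.
by apply: cvgMl_tmp; exact: norm_powR_cvg.
Qed.

Lemma ddens_cvg w x : (fun i => ddens (f i) w x) @ U --> ddens u w x.
Proof.
have p0 : 0 <= p - 2 by have := p2; lra.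
apply: cvgD.
  apply: cvgM; first exact: grad_powR_cvg.
  by apply: (Gamma_cvg (fun=> w)) => y; exact: cvg_cst.
apply: cvgMl_tmp; apply: cvgMr_tmp; apply: cvgM; last exact: fu.
exact: norm_powR_cvg.
Qed.

Lemma pLaplacian_cvg x :
  (fun i => pLaplacian G mu p (f i) x) @ U --> pLaplacian G mu p u x.
Proof.
have p0 : 0 <= p - 2 by have := p2; lra.
under eq_fun do rewrite pLaplacianE; rewrite pLaplacianE; apply: cvgMl_tmp.
elim: (enum_fset (nbr x)) => [|y s IH].
  by under eq_fun do rewrite big_nil; rewrite big_nil; exact: cvg_cst.
under eq_fun do rewrite big_cons; rewrite big_cons; apply: cvgD => //.
apply: cvgM; last by apply: cvgB; exact: fu.
by apply: cvgMr_tmp; apply: cvgD; exact: grad_powR_cvg.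
Qed.

End Limits.

Definition single (x0 : V) (x : V) : R := (x == x0)%:R.

(* Integration by parts against the indicator of a vertex. *)
Lemma ddens_single u x0 (D : {fset V}) : x0 \in D -> (nbr x0 `<=` D)%fset ->
  \sum_(x <- D) ddens u (single x0) x * mu x =
  mu x0 * (- pLaplacian G mu p u x0 + h x0 * (`|u x0| `^ (p - 2) * u x0)).
Proof.
move=> x0D nD.
have split_ x : ddens u (single x0) x * mu x =
    grad_norm G mu u x `^ (p - 2) * Gamma G mu u (single x0) x * mu x +
    h x * (`|u x| `^ (p - 2) * u x * single x0 x) * mu x.
  by rewrite /ddens mulrDl.
under eq_bigr do rewrite split_; rewrite big_split /= mulrDr; congr (_ + _); last first.
  rewrite (big_fsetD1 x0) //= big1_seq ?addr0; first by rewrite /single eqxx mulr1; ring.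
  by move=> y /=; rewrite !inE => /andP[/negPf yx _]; rewrite /single yx !mulr0 mul0r.
have mn x : mu x != 0 by rewrite gt_eqF.
pose g x := grad_norm G mu u x `^ (p - 2).
(* Away from [x0] the inner sum sees the indicator only through the edge back to [x0]. *)
have off x : x != x0 -> g x * Gamma G mu u (single x0) x * mu x =
    if x \in nbr x0 then - 2^-1 * (g x * weight G x0 x * (u x - u x0)) else 0.
  move=> xx0; rewrite GammaE.
  case: ifPn => xn.
    rewrite (big_fsetD1 x0) /=; last by rewrite nbr_sym.
    rewrite big1_seq ?addr0; last first.
      move=> y /=; rewrite !inE => /andP[/negPf yx _].
      by rewrite /single yx (negPf xx0) subrr mulr0.
    rewrite /single eqxx (negPf xx0) subr0 mulr1.
    rewrite (@weight_sym _ _ G x x0) -?in_nbr 1?nbr_sym //.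
    by field; rewrite mn.
  rewrite big1_seq ?mulr0 ?mul0r // => y /= yx.
  have yx0 : y != x0 by apply: contraNneq xn => <-; rewrite nbr_sym.
  by rewrite /single (negPf yx0) (negPf xx0) subrr mulr0.
rewrite (big_fsetD1 x0) //=.
have -> : \sum_(x <- (D `\ x0)%fset) grad_norm G mu u x `^ (p - 2) * Gamma G mu u (single x0) x * mu x
   = \sum_(x <- nbr x0) - 2^-1 * (g x * weight G x0 x * (u x - u x0)).
  transitivity (\sum_(x <- (D `\ x0)%fset) if x \in (nbr x0 `\ x0)%fset then - 2^-1 * (g x * weight G x0 x * (u x - u x0)) else 0).
    apply: eq_big_seq => x; rewrite !inE => /andP[xx0 _].
    by rewrite off // xx0.
  rewrite -big_mkcond /= big_fset_condE /=.
  have -> : [fset i in (D `\ x0) | i \in (nbr x0 `\ x0)]%fset = (nbr x0 `\ x0)%fset.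
    apply/fsetP => x; rewrite !inE; case: eqP => //= _.
    by case: (boolP (x \in nbr x0)) => [/(fsubsetP nD)->|]; rewrite ?andbF.
  (* A loop at [x0] contributes nothing, as its term carries u(x0) - u(x0). *)
  apply: big_fset_incl => [|x xn]; first exact: fsubD1set.
  rewrite !inE negb_and negbK => /orP[/eqP ->|]; first by rewrite subrr !mulr0.
  by rewrite xn.
rewrite GammaE pLaplacianE /g.
rewrite [\sum_(y <- nbr x0) weight G x0 y * _ * _](_ : _ = \sum_(y <- nbr x0) - (weight G x0 y * (u y - u x0))); last first.
  apply: eq_bigr => y _; rewrite /single eqxx; case: eqP => [->|_].
    by rewrite !subrr !mulr0 oppr0.
  by rewrite sub0r mulrN1.
rewrite !mulr_sumr mulr_suml -sumrN mulr_sumr -big_split /=.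
by apply: eq_bigr => y _; field; rewrite mn.
Qed.

End Exponent.
End Densities.


(** * Sums over the vertices *)

Lemma cvg_le_bound (R : realType) (I : Type) (U : set_system I) (f : I -> R) (l b : R) :
  ProperFilter U -> f @ U --> l -> (\forall i \near U, f i <= b) -> l <= b.
Proof.
move=> PU fl fb.
exact: (@closed_cvg _ _ _ PU f (fun y => y <= b) (@closed_le R b) fb l fl).
Qed.

Lemma cvg_seq_sum (R : realType) (I : Type) (U : set_system I) (J : Type) (s : seq J)
    (f : J -> I -> R) (l : J -> R) :
  Filter U -> (forall j, f j @ U --> l j) ->
  (fun i => \sum_(j <- s) f j i) @ U --> \sum_(j <- s) l j.
Proof.
move=> FU fl; elim: s => [|j s IH].
  by under eq_fun do rewrite big_nil; rewrite big_nil; exact: cvg_cst.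
by under eq_fun do rewrite big_cons; rewrite big_cons; apply: cvgD.
Qed.

Section VertexSums.
Context {R : realType} {V : choiceType} (mu : V -> R).
Hypothesis mu_ge0 : forall x, 0 <= mu x.

Implicit Types (A B : {fset V}) (f g : V -> R).

Definition msum A f : R := \sum_(x <- A) f x * mu x.

Lemma msum_le A f g : (forall x, f x <= g x) -> msum A f <= msum A g.
Proof. by move=> fg; apply: ler_sum => x _; rewrite ler_wpM2r. Qed.

Lemma msum_ge0 A f : (forall x, 0 <= f x) -> 0 <= msum A f.
Proof. by move=> f0; apply: sumr_ge0 => x _; rewrite mulr_ge0. Qed.

Lemma msumD A f g : msum A (fun x => f x + g x) = msum A f + msum A g.
Proof. by rewrite -big_split; apply: eq_bigr => x _; rewrite mulrDl. Qed.

Lemma msumZ A c f : msum A (fun x => c * f x) = c * msum A f.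
Proof. by rewrite /msum mulr_sumr; apply: eq_bigr => x _; rewrite mulrA. Qed.

Lemma msumB A f g : msum A (fun x => f x - g x) = msum A f - msum A g.
Proof. by rewrite /msum -sumrB; apply: eq_bigr => x _; rewrite mulrBl. Qed.

Lemma msum_eq A f g : (forall x, f x = g x) -> msum A f = msum A g.
Proof. by move=> fg; apply: eq_bigr => x _; rewrite fg. Qed.

Lemma msum_norm A f : `|msum A f| <= msum A (fun x => `|f x|).
Proof.
apply: (le_trans (ler_norm_sum _ _ _)); apply: ler_sum => x _.
by rewrite normrM (ger0_norm (mu_ge0 x)).
Qed.

Lemma msum_subset A B f : (forall x, 0 <= f x) -> (A `<=` B)%fset ->
  msum A f <= msum B f.
Proof.
move=> f0 AB; rewrite /msum (big_fsetID _ (mem A) B) /=.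
have -> : [fset x in B | x \in A]%fset = A.
  by apply/fsetP => x; rewrite !inE; case: (boolP (x \in A)) => [/(fsubsetP AB)->|]; rewrite ?andbF.
by rewrite lerDl sumr_ge0 // => x _; rewrite mulr_ge0.
Qed.

Lemma msum_split A B f :
  msum B f = msum [fset x in B | x \in A]%fset f + msum [fset x in B | x \notin A]%fset f.
Proof. exact: big_fsetID. Qed.

Lemma msum_supp A B f : (forall x, x \notin A -> f x = 0) -> (A `<=` B)%fset ->
  msum B f = msum A f.
Proof.
move=> f0 AB; apply/esym/big_fset_incl => // x _ xA; by rewrite f0 // mul0r.
Qed.

Lemma msum_supp0 B f : (forall x, x \in B -> f x = 0) -> msum B f = 0.
Proof. by move=> f0; apply: big1_seq => x /= xB; rewrite f0 // mul0r. Qed.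

(** A tail bound phrased with finite sums only, so that it passes to pointwise limits. A family that
    admits a common [A] for every [e] is uniformly summable. *)
Definition small_off A f (e : R) : Prop :=
  forall B, (forall x, x \in B -> x \notin A) -> msum B (fun x => `|f x|) <= e.

Lemma msum_small_off A B f e : small_off A f e -> (forall x, 0 <= f x) ->
  msum B f <= msum A f + e.
Proof.
move=> h f0; rewrite (msum_split A B); apply: lerD.
  apply: msum_subset => //; by apply/fsubsetP => x; rewrite !inE => /andP[].
apply: le_trans (h [fset x in B | x \notin A]%fset _).
  by apply: msum_le => x; rewrite ger0_norm.
by move=> x; rewrite !inE => /andP[].
Qed.

Lemma small_off_le A f g e : (forall x, `|f x| <= `|g x|) ->
  small_off A g e -> small_off A f e.
Proof.
by move=> fg h B hB; apply: (le_trans _ (h B hB)); apply: msum_le.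
Qed.

Lemma small_offD A A' f g e e' : small_off A f e -> small_off A' g e' ->
  small_off (A `|` A')%fset (fun x => f x + g x) (e + e').
Proof.
move=> h h' B hB.
apply: (@le_trans _ _ (msum B (fun x => `|f x| + `|g x|))).
  by apply: msum_le => x; exact: ler_normD.
rewrite msumD; apply: lerD; [apply: h|apply: h'] => x /hB;
  by rewrite inE negb_or => /andP[].
Qed.

Lemma small_offZ A f e (c : R) : small_off A f e ->
  small_off A (fun x => c * f x) (`|c| * e).
Proof.
move=> h B hB; rewrite (@msum_eq _ _ (fun x => `|c| * `|f x|)); last first.
  by move=> x; rewrite normrM.
by rewrite msumZ ler_wpM2l //; exact: h.
Qed.

Lemma small_off_supp A f : (forall x, x \notin A -> f x = 0) -> small_off A f 0.
Proof.
by move=> f0 B hB; rewrite msum_supp0 // => x /hB/f0 ->; rewrite normr0.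
Qed.

Let pe f : V -> \bar R := fun x => (f x * mu x)%:E.

Lemma msum_fsbig A f : (\sum_(x \in [set` A]) pe f x)%E = (msum A f)%:E.
Proof. by rewrite /pe -fsbig_seq ?fset_uniq // sumEFin. Qed.

Lemma esum_ge_msum A f : ((msum A f)%:E <= \esum_(x in [set: V]) pe f x)%E.
Proof.
apply: esum_ge; exists [set` A]; last by rewrite msum_fsbig.
by split => //; exact: finite_fset.
Qed.

Lemma esum_le_msum f (M : R) : (forall B, msum B f <= M) ->
  (\esum_(x in [set: V]) pe f x <= M%:E)%E.
Proof.
move=> h; apply: ge_ereal_sup => _ [X [finX _] <-].
by rewrite -(fset_setK finX) msum_fsbig lee_fin.
Qed.

(** A finite set whose sum is within [e] of the supremum leaves at most [e] for any set disjoint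
    from it. *)
Lemma esum_tail f : (forall x, 0 <= f x) -> (\esum_(x in [set: V]) pe f x < +oo)%E ->
  forall e : R, 0 < e -> exists A, small_off A f e.
Proof.
move=> f0 fin e e0.
have fn : \esum_(x in [set: V]) pe f x \is a fin_num.
  rewrite ge0_fin_numE //; apply: esum_ge0 => x _.
  by rewrite lee_fin mulr_ge0.
have [_ [X [finX _] <-]] := ub_ereal_sup_adherent e0 fn.
rewrite -(fset_setK finX) msum_fsbig => h.
set A := fset_set X in h; exists A => B hB.
have := esum_ge_msum (A `|` B)%fset f.
rewrite -/(esum _ _) in h; move: h; rewrite -(fineK fn) -EFinB lte_fin lee_fin.
have -> : msum (A `|` B)%fset f = msum A f + msum B f.
  rewrite (msum_split A); congr (_ + _); congr msum; apply/fsetP => x; rewrite !inE.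
    by case: (boolP (x \in A)); rewrite ?andbF.
  by case: (boolP (x \in B)) => [/hB ->|]; rewrite ?orbT ?orbF ?andbN.
have -> : msum B (fun x => `|f x|) = msum B f.
  by apply: msum_eq => x; rewrite ger0_norm.
lra.
Qed.

Lemma vint_nonneg f : (forall x, 0 <= f x) ->
  vint mu f = (\esum_(x in [set: V]) pe f x)%E.
Proof.
move=> f0; rewrite /vint [X in (_ - X)%E]esum1 ?sube0.
  apply: eq_esum => x _; rewrite funeposE /maxe /pe.
  by rewrite lte_fin ltNge mulr_ge0.
move=> x _; rewrite funenegE -EFinN -EFin_max max_r //.
by rewrite oppr_le0 mulr_ge0.
Qed.

(** The positive and the negative part each lie within [e] of their sum over [A]; hence the crude
    factor 2, and hence finiteness of both parts. *)
Lemma vint_approx A f e : small_off A f e ->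
  vint mu f \is a fin_num /\ `|fine (vint mu f) - msum A f| <= 2 * e.
Proof.
move=> h.
pose fp x := Num.max (f x) 0; pose fm x := Num.max (- f x) 0.
have fp0 x : 0 <= fp x by rewrite le_max lexx orbT.
have fm0 x : 0 <= fm x by rewrite le_max lexx orbT.
have fE x : f x = fp x - fm x by rewrite /fp /fm; case: (ltrgt0P (f x)); case: (ltrgt0P (- f x)); lra.
have lep x : `|fp x| <= `|f x|.
  by rewrite ger0_norm // ge_max normr_ge0 ler_norm.
have lem x : `|fm x| <= `|f x|.
  by rewrite ger0_norm // ge_max normr_ge0 -normrN ler_norm.
have mx (r : R) x : (maxe (r * mu x)%:E 0 = (Num.max r 0 * mu x)%:E)%E.
  by rewrite -EFin_max maxr_pMl // mul0r.
have posE : (\esum_(x in [set: V]) (pe f)^\+%E x = \esum_(x in [set: V]) pe fp x)%E.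
  by apply: eq_esum => x _; rewrite funeposE mx.
have negE : (\esum_(x in [set: V]) (pe f)^\-%E x = \esum_(x in [set: V]) pe fm x)%E.
  by apply: eq_esum => x _; rewrite funenegE -EFinN -mulNr mx.
have aux g : (forall x, 0 <= g x) -> small_off A g e ->
    exists2 r : R, (\esum_(x in [set: V]) pe g x)%E = r%:E & msum A g <= r <= msum A g + e.
  move=> g0 hg.
  have ub : (\esum_(x in [set: V]) pe g x <= (msum A g + e)%:E)%E.
    by apply: esum_le_msum => B; exact: msum_small_off.
  have lb := esum_ge_msum A g.
  have fn : (\esum_(x in [set: V]) pe g x)%E \is a fin_num.
    rewrite ge0_fin_numE; first exact: (le_lt_trans ub (ltry _)).
    by apply: (le_trans _ lb); rewrite lee_fin msum_ge0.
  exists (fine (\esum_(x in [set: V]) pe g x)%E); first by rewrite fineK.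
  by rewrite -!lee_fin fineK // lb ub.
have [a aE ab] := aux fp fp0 (small_off_le _ _ _ _ lep h).
have [b bE bb] := aux fm fm0 (small_off_le _ _ _ _ lem h).
rewrite /vint posE negE aE bE -EFinB; split => //=.
rewrite (msum_eq A f _ fE) msumB ler_norml; apply/andP; split; lra.
Qed.

Lemma vint_finite A f : (forall x, x \notin A -> f x = 0) ->
  vint mu f = (msum A f)%:E.
Proof.
move=> f0; have [fn] := vint_approx A f 0 (small_off_supp A f f0).
rewrite mulr0 normr_le0 subr_eq0 => /eqP <-; by rewrite fineK.
Qed.

(** * Limits of sums along a filter *)

Section Vitali.
Context {I : Type} (U : set_system I) {PU : ProperFilter U}.

Lemma msum_cvg A (f : I -> V -> R) g : (forall x, (fun i => f i x) @ U --> g x) ->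
  (fun i => msum A (f i)) @ U --> msum A g.
Proof. by move=> fg; apply: cvg_seq_sum => x; apply: cvgMr_tmp; exact: fg. Qed.

Lemma small_off_lim A (f : I -> V -> R) g e :
  (forall x, (fun i => f i x) @ U --> g x) ->
  (\forall i \near U, small_off A (f i) e) -> small_off A g e.
Proof.
move=> fg h B hB.
apply: (@cvg_le_bound _ _ U (fun i => msum B (fun x => `|f i x|))).
  by apply: (msum_cvg B (fun i x => `|f i x|)) => x; apply: cvg_norm; exact: fg.
by apply: filterS h => i; exact.
Qed.

(* Vitali: pointwise convergence of uniformly summable functions. *)
Lemma vint_cvg (f : I -> V -> R) g :
  (forall x, (fun i => f i x) @ U --> g x) ->
  (forall e : R, 0 < e -> exists A, \forall i \near U, small_off A (f i) e) ->
  (fun i => fine (vint mu (f i))) @ U --> fine (vint mu g).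
Proof.
move=> fg h; apply/cvgrPdist_le => e e0.
have [A hA] := h (e / 8) ltac:(lra).
have [_ gA] := vint_approx A g _ (small_off_lim A f g _ fg hA).
have /cvgrPdist_le /(_ (e / 8)) := msum_cvg A f g fg.
move=> /(_ ltac:(lra)) cA.
apply: filterS2 hA cA => i /vint_approx[_ fA].
move: fA gA; rewrite !ler_norml => /andP[? ?] /andP[? ?] /andP[? ?].
by apply/andP; split; lra.
Qed.

End Vitali.

(** * The pairing of conjugate exponents *)

Section Duality.
Variables (p r : R).
Hypotheses (p1 : 0 < p) (r1 : 0 < r) (pr : p^-1 + r^-1 = 1).

Lemma Lr_vint (e : V -> R) (s : R) : 0 < s -> in_Lr mu s e ->
  vint mu (fun x => `|e x| `^ s) \is a fin_num.
Proof.
move=> s0; rewrite /in_Lr /Lr_norm => h.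
have v0 : (0 <= vint mu (fun x => `|e x| `^ s)%R)%E.
  rewrite vint_nonneg => [|x]; last exact: powR_ge0.
  by apply: esum_ge0 => x _; rewrite lee_fin mulr_ge0 ?powR_ge0.
rewrite ge0_fin_numE // ltNge leye_eq; apply/negP => /eqP ve.
by move: h; rewrite ve poweRyr ?ltxx // invr_eq0 gt_eqF.
Qed.

Lemma Lr_tail (e : V -> R) (s : R) : 0 < s -> in_Lr mu s e ->
  forall d : R, 0 < d -> exists A, small_off A (fun x => `|e x| `^ s) d.
Proof.
move=> s0 /(Lr_vint _ _ s0); rewrite vint_nonneg => [fn|x]; last exact: powR_ge0.
apply: esum_tail => [x|]; first exact: powR_ge0.
by rewrite ltey_eq fn.
Qed.

(** Weighted Young: |e u| <= t^p |u|^p + t^(-r) |e|^r. First [t] is chosen so that the first sum is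
    small on the whole L^p ball; then [A] comes from the tail of |e|^r alone, small enough to absorb
    t^(-r). *)
Lemma Lr_tail_mul (e : V -> R) : in_Lr mu r e -> forall M d : R, 0 <= M -> 0 < d ->
  exists A, forall u : V -> R, (forall B, msum B (fun x => `|u x| `^ p) <= M) ->
    small_off A (fun x => e x * u x) d.
Proof.
move=> eL M d M0 d0.
pose c := d / (2 * (M + 1)).
have c0 : 0 < c by rewrite divr_gt0 //; lra.
pose t := c `^ p^-1.
have t0 : 0 < t by rewrite powR_gt0.
have tp : t `^ p = c by rewrite -powRrM mulVf ?gt_eqF // powRr1 // ltW.
have tr0 : 0 < t `^ r by rewrite powR_gt0.
have [A hA] := Lr_tail e r r1 eL (d / 2 * t `^ r) ltac:(apply: mulr_gt0 => //; lra).
exists A => u hu B hB.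
have ip : p^-1 <= 1 by rewrite -pr lerDl invr_ge0 ltW.
have ir : r^-1 <= 1 by rewrite -pr lerDr invr_ge0 ltW.
apply: (@le_trans _ _ (msum B (fun x => t `^ p * `|u x| `^ p + (t `^ r)^-1 * `| `|e x| `^ r|))).
  apply: msum_le => x.
  have := @conjugate_powR R (t * `|u x|) (`|e x| / t) p r.
  have tu : 0 <= t * `|u x| by rewrite mulr_ge0 // ltW.
  have et : 0 <= `|e x| / t by apply: divr_ge0; [exact: normr_ge0|exact: ltW].
  move=> /(_ tu et p1 r1 pr).
  rewrite normrM [X in X <= _](_ : _ = `|e x| * `|u x|); last by field; rewrite gt_eqF.
  move=> /le_trans; apply; rewrite (ger0_norm (powR_ge0 _ _)).
  apply: lerD.
    rewrite powRM ?(ltW t0) //; apply: ler_piMr => //; by rewrite mulr_ge0 ?powR_ge0.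
  rewrite powRM ?invr_ge0 ?(ltW t0) //.
  rewrite (inv_powR _ _ (ltW t0)).
  rewrite [X in _ <= X]mulrC; apply: ler_piMr => //.
  by rewrite mulr_ge0 ?powR_ge0 ?invr_ge0 ?powR_ge0.
rewrite msumD !msumZ tp.
have h1 : c * msum B (fun x => `|u x| `^ p) <= d / 2.
  have -> : d / 2 = c * (M + 1) by rewrite /c; field; lra.
  by apply: ler_wpM2l; [exact: ltW|apply: (le_trans (hu B)); lra].
have h2 : (t `^ r)^-1 * msum B (fun x => `| `|e x| `^ r|) <= d / 2.
  by rewrite mulrC ler_pdivrMr //; exact: hA.
lra.
Qed.

(** Hoelder's inequality, from Young's inequality for the normalised functions |u| / b^(1/p) and |e|
    / a^(1/r); if a or b is 0, all products vanish on [A]. *)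
Lemma holder_msum (e u : V -> R) A : in_Lr mu r e ->
  msum A (fun x => `|e x * u x|) <=
  fine (Lr_norm mu r e) * (msum A (fun x => `|u x| `^ p)) `^ p^-1.
Proof.
move=> eL.
have fn := Lr_vint e r r1 eL.
set a := msum A (fun x => `|e x| `^ r); set b := msum A (fun x => `|u x| `^ p).
have a0 : 0 <= a by apply: msum_ge0 => x; exact: powR_ge0.
have b0 : 0 <= b by apply: msum_ge0 => x; exact: powR_ge0.
have aE : a `^ r^-1 <= fine (Lr_norm mu r e).
  rewrite /Lr_norm -(fineK fn) poweR_EFin /=.
  apply: ge0_ler_powR; rewrite ?invr_ge0 ?nnegrE ?(ltW r1) //.
    by rewrite -lee_fin fineK // (le_trans _ (_ : (a%:E <= _)%E)) // vint_nonneg ?esum_ge_msum // => x; exact: powR_ge0.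
  by rewrite -lee_fin fineK // vint_nonneg ?esum_ge_msum // => x; exact: powR_ge0.
apply: (@le_trans _ _ (a `^ r^-1 * b `^ p^-1)); last by rewrite ler_wpM2r ?powR_ge0.
have zero (g : V -> R) s : 0 < s -> msum A (fun x => `|g x| `^ s) = 0 ->
    forall x, x \in A -> g x * mu x = 0.
  move=> s0 /eqP; rewrite psumr_eq0 => [/allP h x /h|x _]; last by rewrite mulr_ge0 ?powR_ge0.
  by rewrite mulf_eq0 powR_eq0 normr_eq0 => /orP[/andP[/eqP ->]|/eqP ->]; rewrite ?mul0r ?mulr0.
have [a00|an0] := eqVneq a 0.
  rewrite [X in X <= _](_ : _ = 0) ?mulr_ge0 ?powR_ge0 //.
  apply: big1_seq => x /= xA; have /eqP := zero e r r1 a00 x xA.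
  by rewrite mulf_eq0 => /orP[] /eqP ->; rewrite ?mulr0 // mul0r normr0 mul0r.
have [b00|bn0] := eqVneq b 0.
  rewrite [X in X <= _](_ : _ = 0) ?mulr_ge0 ?powR_ge0 //.
  apply: big1_seq => x /= xA; have /eqP := zero u p p1 b00 x xA.
  by rewrite mulf_eq0 => /orP[] /eqP ->; rewrite ?mulr0 // normr0 mul0r.
have ap : 0 < a by rewrite lt_neqAle eq_sym an0.
have bp : 0 < b by rewrite lt_neqAle eq_sym bn0.
pose al := a `^ r^-1; pose be := b `^ p^-1.
have al0 : 0 < al by rewrite powR_gt0.
have be0 : 0 < be by rewrite powR_gt0.
have alr : al `^ r = a by rewrite -powRrM mulVf ?gt_eqF // powRr1.
have bep : be `^ p = b by rewrite -powRrM mulVf ?gt_eqF // powRr1.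
rewrite -/al -/be.
clearbody al be.
apply: (@le_trans _ _ (msum A (fun x => al * be * ((p^-1 * b^-1) * `|u x| `^ p + (r^-1 * a^-1) * `|e x| `^ r)))).
  apply: msum_le => x.
  have := @conjugate_powR R (`|u x| / be) (`|e x| / al) p r.
  have tu : 0 <= `|u x| / be by apply: divr_ge0; [exact: normr_ge0|exact: ltW].
  have et : 0 <= `|e x| / al by apply: divr_ge0; [exact: normr_ge0|exact: ltW].
  move=> /(_ tu et p1 r1 pr).
  rewrite !powRM ?invr_ge0 ?(ltW al0) ?(ltW be0) // !inv_powR ?(ltW al0) ?(ltW be0) // alr bep => h.
  have abe : 0 < al * be by rewrite mulr_gt0.
  have := ler_wpM2l (ltW abe) h.
  rewrite normrM [X in X <= _ -> _](_ : _ = `|e x| * `|u x|); last by field; rewrite !gt_eqF.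
  move=> /le_trans; apply; rewrite le_eqVlt; apply/orP; left; apply/eqP.
  by field; rewrite !gt_eqF.
rewrite msumZ msumD !msumZ -/a -/b.
rewrite [X in X <= _](_ : _ = al * be) //.
transitivity (al * be * (p^-1 + r^-1)); last by rewrite pr mulr1.
by field; rewrite !gt_eqF.
Qed.

End Duality.
End VertexSums.


(** * The energy on finite sets *)

Lemma is_derive_translate (R : realType) (f : R -> R) (s d : R) :
  is_derive (0 : R) 1 (fun h => f (s + h)) d -> is_derive s 1 f d.
Proof.
move=> hf.
have dg : is_derive s 1 (fun r : R => r - s) 1.
  by apply: (is_derive_quadratic_error _ _ _ 0) => h _; rewrite mul0r (_ : _ - _ = 0) ?normr0 //; ring.
rewrite -(subrr s) in hf.
have := @is_derive1_comp R (fun h => f (s + h)) (fun r => r - s) s _ _ hf dg.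
rewrite mulr1; congr (is_derive _ _ _ _).
by apply/funext => r /=; rewrite subrKC.
Qed.

(* [r >= 2] makes the primitive of [|x|^(r-1)] differentiable at [0]. *)
Lemma primitive_bound (R : realType) (f df : R -> R) (A B r T : R) : 2 <= r ->
  (forall x : R, is_derive x 1 f (df x)) ->
  (forall x : R, `|x| <= `|T| -> `|df x| <= A + B * `|x| `^ (r - 1)) ->
  `|f T - f 0| <= A * `|T| + B * (`|T| `^ r / r).
Proof.
move=> r2.
have r12 : 1 <= r / 2 by rewrite ler_pdivlMr ?mul1r.
have dpow (x : R) : is_derive x 1 (fun y : R => (y ^+ 2) `^ (r / 2)) (r * ((x ^+ 2) `^ (r / 2 - 1) * x)).
  apply: is_derive_translate.
  have := is_derive_powR_quadratic (r / 2) (x ^+ 2) x 1 r12.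
  have e s : x ^+ 2 + 2 * s * x + s ^+ 2 * 1 = (x + s) ^+ 2 by ring.
  under eq_fun do rewrite e.
  have -> : 2 * (r / 2) = r by field.
  by apply => s; rewrite e sqr_ge0.
have pos : forall (f df : R -> R) (T : R), 0 <= T ->
  (forall x : R, is_derive x 1 f (df x)) ->
  (forall x : R, `|x| <= `|T| -> `|df x| <= A + B * `|x| `^ (r - 1)) ->
  f T - f 0 <= A * T + B * (T `^ r / r).
  move=> {}f {}df {}T T0 hf hd.
  (* This subtracts the primitive of the bound on the derivative, so [k] is nonincreasing on [0, T].
     Writing |x|^r as (x^2)^(r/2) keeps it differentiable at 0. *)
  pose k (x : R) := f x - (A * x + B / r * (x ^+ 2) `^ (r / 2)).
  pose dk (x : R) := df x - (A + B / r * (r * ((x ^+ 2) `^ (r / 2 - 1) * x))).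
  have hk (x : R) : is_derive x 1 k (dk x).
    have h1 : is_derive x 1 (fun y : R => A * y) A.
      by apply: (is_derive_quadratic_error _ _ _ 0) => h _; rewrite mul0r (_ : _ - _ = 0) ?normr0 //; ring.
    exact: (is_deriveB (hf x) (is_deriveD h1 (is_deriveZ (B / r) (dpow x)))).
  have kc : {within `[0, T], continuous k}.
    by apply: derivable_within_continuous => x _; have [] := hk x.
  have [c] := @MVT_segment R k dk 0 T T0 (fun x _ => hk x) kc.
  rewrite in_itv /= => /andP[c0 cT] e.
  have : dk c * (T - 0) <= 0.
    apply: mulr_le0_ge0; last by rewrite subr0.
    have := hd c; rewrite (ger0_norm c0) (ger0_norm T0) => /(_ cT) /(le_trans (ler_norm _)) h.
    rewrite /dk -(ger0_norm c0) -{1}(ger0_norm c0).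
    have rB : r / 2 - 1 = (r - 2) / 2 by field.
    rewrite rB -norm_powR_sqr normr_id (ger0_norm c0).
    have -> : B / r * (r * (c `^ (r - 2) * c)) = B * (c * c `^ (r - 2)).
      by field; lra.
    have [c00|cn0] := eqVneq c 0.
      move: h; rewrite c00 mul0r mulr0 powR0 ?mulr0; last by apply/eqP; lra.
      by rewrite subr_le0.
    have -> : c * c `^ (r - 2) = c `^ (r - 1).
      have -> : r - 1 = 1 + (r - 2) by ring.
      by rewrite [in RHS]powRD ?cn0 ?implybT // powRr1.
    by rewrite subr_le0.
  rewrite -e /k expr0n /= powR0; last by rewrite gt_eqF //; lra.
  rewrite -norm_powR_sqr (ger0_norm T0); lra.
have both : forall (f df : R -> R) (T : R), 0 <= T ->
  (forall x : R, is_derive x 1 f (df x)) ->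
  (forall x : R, `|x| <= `|T| -> `|df x| <= A + B * `|x| `^ (r - 1)) ->
  `|f T - f 0| <= A * T + B * (T `^ r / r).
  move=> {}f {}df {}T T0 hf hd; rewrite ler_norml; apply/andP; split; last exact: (pos f df).
  have := pos (fun x => - f x) (fun x => - df x) T T0 (fun x => is_deriveN (hf x)).
  by move=> /(_ (fun x hx => eq_ind_r (fun z => z <= _) (hd x hx) (normrN _))); lra.
move=> hf hd; have [T0|T0] := leP 0 T.
  by rewrite (ger0_norm T0); apply: (both f df).
rewrite (ltr0_norm T0).
have NT : 0 <= - T by lra.
have := both (fun x => f (- x)) (fun x => - df (- x)) (- T) NT.
rewrite opprK oppr0; apply.
  move=> x; have h1 : is_derive x 1 (fun y : R => - y) (-1).
    by apply: (is_derive_quadratic_error _ _ _ 0) => h _; rewrite mul0r (_ : _ - _ = 0) ?normr0 //; ring.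
  have := @is_derive1_comp R f (fun y => - y) x _ _ (hf (- x)) h1.
  by rewrite mulrN1.
by move=> x; rewrite !normrN -(normrN x); exact: hd.
Qed.

(** * Derivatives and limits of the nonlinearity *)

Section TwoVariables.
Context {R : realType} {V : choiceType} (F : V -> R -> R -> R).
Hypothesis F_C1 : C1_in_st F.

(** The partial derivatives are the directional derivatives along (1, 0) and (0, 1), and full
    differentiability makes the derivative along (b, d) linear in (b, d). *)
Lemma is_derive_line x (a b c d : R) :
  is_derive (0 : R) 1 (fun s : R => F x (a + s * b) (c + s * d))
    (partial_s F x a c * b + partial_t F x a c * d).
Proof.
have [dF _ _] := F_C1 x.
pose f (w : R * R) := F x w.1 w.2.
have df : differentiable f (a, c) by exact: dF.
have E1 : (fun h : R => h^-1 *: (F x (h + a) c - F x a c)) =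
    (fun h : R => h^-1 *: ((f \o shift (a, c)) (h *: ((1 : R), (0 : R))) - f (a, c))).
  apply/funext => h; rewrite /f /=; congr (_ *: (F x _ _ - _));
    by rewrite /GRing.scale /= ?mulr1 ?mulr0 ?add0r.
have E2 : (fun h : R => h^-1 *: (F x a (h + c) - F x a c)) =
    (fun h : R => h^-1 *: ((f \o shift (a, c)) (h *: ((0 : R), (1 : R))) - f (a, c))).
  apply/funext => h; rewrite /f /=; congr (_ *: (F x _ _ - _));
    by rewrite /GRing.scale /= ?mulr1 ?mulr0 ?add0r.
have psE : partial_s F x a c = 'D_(1, 0) f (a, c).
  by rewrite /partial_s /derive1 /derive -E1.
have ptE : partial_t F x a c = 'D_(0, 1) f (a, c).
  by rewrite /partial_t /derive1 /derive -E2.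
have dE : 'D_(b, d) f (a, c) = partial_s F x a c * b + partial_t F x a c * d.
  rewrite psE ptE !deriveE //.
  have -> : (b, d) = b *: ((1 : R), (0 : R)) + d *: ((0 : R), (1 : R)).
    apply: injective_projections.
    by rewrite /= -[b *: 1]/(b * 1) -[d *: 0]/(d * 0); ring.
  by rewrite /= -[d *: 1]/(d * 1) -[b *: 0]/(b * 0); ring.
  by rewrite linearD !linearZ; congr (_ + _); exact: mulrC.
have q : (fun h : R => h^-1 *: (((fun s : R => F x (a + s * b) (c + s * d)) \o shift 0) (h *: (1 : R)) - F x (a + 0 * b) (c + 0 * d)))
   = (fun h : R => h^-1 *: ((f \o shift (a, c)) (h *: (b, d)) - f (a, c))).
  apply/funext => h; rewrite /f /= !mul0r !addr0 [h *: 1]mulr1.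
  by congr (_ *: (F x _ _ - _)); rewrite addrC.
split; first by rewrite /derivable q; exact: diff_derivable.
by rewrite /derive q -dE.
Qed.

Lemma is_derive_s x (s t : R) : is_derive s 1 (fun s' => F x s' t) (partial_s F x s t).
Proof.
apply: is_derive_translate.
have := is_derive_line x s 1 t 0; rewrite mulr1 mulr0 addr0.
by under eq_fun do rewrite mulr1 mulr0 addr0.
Qed.

Lemma is_derive_t x (s t : R) : is_derive t 1 (fun t' => F x s t') (partial_t F x s t).
Proof.
apply: is_derive_translate.
have := is_derive_line x s 0 t 1; rewrite mulr1 mulr0 add0r.
by under eq_fun do rewrite mulr1 mulr0 addr0.
Qed.

Context {I : Type} (U : set_system I) {FU : Filter U}.
Variables (f g : I -> R) (a b : R).
Hypotheses (fa : f @ U --> a) (gb : g @ U --> b).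

Let cvg2 (k : R -> R -> R) : {for (a, b), continuous (fun z : R * R => k z.1 z.2)} ->
  (fun i => k (f i) (g i)) @ U --> k a b.
Proof.
move=> kc.
apply: (@continuous_cvg _ _ _ U FU (fun i => (f i, g i)) (fun z : R * R => k z.1 z.2) (a, b) kc).
exact: (cvg_pair fa gb).
Qed.

Lemma F_cvg x : (fun i => F x (f i) (g i)) @ U --> F x a b.
Proof.
apply: cvg2; have [dF _ _] := F_C1 x.
exact: differentiable_continuous.
Qed.

Lemma partial_s_cvg x : (fun i => partial_s F x (f i) (g i)) @ U --> partial_s F x a b.
Proof. by apply: cvg2; have [_ c _] := F_C1 x; exact: c. Qed.

Lemma partial_t_cvg x : (fun i => partial_t F x (f i) (g i)) @ U --> partial_t F x a b.
Proof. by apply: cvg2; have [_ _ c] := F_C1 x; exact: c. Qed.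

End TwoVariables.

(** * The energy summed over a finite vertex set, and its derivative *)

Section FiniteEnergy.
Context {R : realType} {V : choiceType}.
Variables (G : weighted_graph R V) (mu : V -> R) (p q : R) (h1 h2 : V -> R).
Variables (F : V -> R -> R -> R) (e1 e2 : V -> R) (lambda : R).
Hypothesis mu_gt0 : forall x, 0 < mu x.
Hypotheses (p2 : 2 <= p) (q2 : 2 <= q).
Hypothesis F_C1 : C1_in_st F.
Implicit Types (D : {fset V}) (u v w z : V -> R).

Definition Phi D u v : R :=
  p^-1 * msum mu D (dens G mu p h1 u) + q^-1 * msum mu D (dens G mu q h2 v)
  - msum mu D (fun x => F x (u x) (v x))
  - lambda * msum mu D (fun x => e1 x * u x) - lambda * msum mu D (fun x => e2 x * v x).

Definition dPhi D u v w z : R :=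
  msum mu D (ddens G mu p h1 u w) + msum mu D (ddens G mu q h2 v z)
  - msum mu D (fun x => partial_s F x (u x) (v x) * w x + partial_t F x (u x) (v x) * z x)
  - lambda * msum mu D (fun x => e1 x * w x) - lambda * msum mu D (fun x => e2 x * z x).

Lemma dPhi_lin D u v (a : R) w z w' z' :
  dPhi D u v (fun x => a * w x + w' x) (fun x => a * z x + z' x) =
  a * dPhi D u v w z + dPhi D u v w' z'.
Proof.
have L r h f g : msum mu D (ddens G mu r h f (fun x => a * g x + w' x)) =
    a * msum mu D (ddens G mu r h f g) + msum mu D (ddens G mu r h f w').
  by rewrite -msumZ -msumD; apply: msum_eq => x; rewrite ddens_lin.
have L' r h f g : msum mu D (ddens G mu r h f (fun x => a * g x + z' x)) =
    a * msum mu D (ddens G mu r h f g) + msum mu D (ddens G mu r h f z').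
  by rewrite -msumZ -msumD; apply: msum_eq => x; rewrite ddens_lin.
have E (e g g' : V -> R) : msum mu D (fun x => e x * (a * g x + g' x)) =
    a * msum mu D (fun x => e x * g x) + msum mu D (fun x => e x * g' x).
  by rewrite -msumZ -msumD; apply: msum_eq => x; ring.
rewrite /dPhi L L' !E.
have -> : msum mu D (fun x => partial_s F x (u x) (v x) * (a * w x + w' x) +
      partial_t F x (u x) (v x) * (a * z x + z' x)) =
    a * msum mu D (fun x => partial_s F x (u x) (v x) * w x + partial_t F x (u x) (v x) * z x)
    + msum mu D (fun x => partial_s F x (u x) (v x) * w' x + partial_t F x (u x) (v x) * z' x).
  by rewrite -msumZ -msumD; apply: msum_eq => x; ring.
ring.
Qed.

Lemma is_derive_msum D (f : V -> R -> R) (df : V -> R) (s : R) :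
  (forall x, is_derive s 1 (f x) (df x)) ->
  is_derive s 1 (fun r => msum mu D (fun x => f x r)) (msum mu D df).
Proof.
move=> h; rewrite /msum; elim: (enum_fset D) => [|x l IH].
  by under eq_fun do rewrite big_nil; rewrite big_nil; exact: is_derive_cst.
under eq_fun do rewrite big_cons; rewrite big_cons.
apply: is_deriveD => //.
have -> : (fun r => f x r * mu x) = (fun r => mu x *: f x r).
  by apply/funext => r; rewrite mulrC.
by rewrite mulrC; exact: is_deriveZ.
Qed.

Lemma Phi_derive D u v w z :
  is_derive (0 : R) 1 (fun s => Phi D (fun x => u x + s * w x) (fun x => v x + s * z x))
    (dPhi D u v w z).
Proof.
have E (e g g' : V -> R) : is_derive (0 : R) 1
    (fun s => lambda * msum mu D (fun x => e x * (g x + s * g' x)))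
    (lambda * msum mu D (fun x => e x * g' x)).
  apply: is_deriveZ; apply: is_derive_msum => x.
  apply: (is_derive_quadratic_error _ _ _ 0) => h _.
  by rewrite !mul0r !addr0 (_ : _ - _ = 0) ?normr0 //; ring.
have P r h f g : 2 <= r -> is_derive (0 : R) 1
    (fun s => r^-1 * msum mu D (dens G mu r h (fun x => f x + s * g x)))
    (msum mu D (ddens G mu r h f g)).
  move=> r2.
  have -> : msum mu D (ddens G mu r h f g) = r^-1 * msum mu D (fun x => r * ddens G mu r h f g x).
    by rewrite msumZ mulKf //; apply/eqP; lra.
  apply: is_deriveZ; apply: (is_derive_msum D (fun x s => dens G mu r h (fun y => f y + s * g y) x)) => x.
  exact: dens_derive.
have FF : is_derive (0 : R) 1 (fun s => msum mu D (fun x => F x (u x + s * w x) (v x + s * z x)))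
    (msum mu D (fun x => partial_s F x (u x) (v x) * w x + partial_t F x (u x) (v x) * z x)).
  by apply: is_derive_msum => x; exact: is_derive_line.
exact: (is_deriveB (is_deriveB (is_deriveB (is_deriveD (P p h1 u w p2) (P q h2 v z q2)) FF) (E e1 u w)) (E e2 v z)).
Qed.

Section Limit.
Context {I : Type} (U : set_system I) {FU : Filter U}.
Variables (f g : I -> V -> R) (u v : V -> R).
Hypotheses (fu : forall x, (fun i => f i x) @ U --> u x)
  (gv : forall x, (fun i => g i x) @ U --> v x).

Let msum_cvg' D (k : I -> V -> R) l : (forall x, (fun i => k i x) @ U --> l x) ->
  (fun i => msum mu D (k i)) @ U --> msum mu D l.
Proof. by move=> kl; apply: cvg_seq_sum => x; apply: cvgMr_tmp; exact: kl. Qed.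

Lemma Phi_cvg D : (fun i => Phi D (f i) (g i)) @ U --> Phi D u v.
Proof.
rewrite /Phi; apply: cvgB; last first.
  apply: cvgMl_tmp; apply: (msum_cvg' D (fun i x => e2 x * g i x)) => x.
  by apply: cvgMl_tmp; exact: gv.
apply: cvgB; last first.
  apply: cvgMl_tmp; apply: (msum_cvg' D (fun i x => e1 x * f i x)) => x.
  by apply: cvgMl_tmp; exact: fu.
apply: cvgB; last first.
  apply: (msum_cvg' D (fun i x => F x (f i x) (g i x))) => x.
  by apply: F_cvg.
apply: cvgD; apply: cvgMl_tmp.
  by apply: (msum_cvg' D (fun i => dens G mu p h1 (f i))) => x; apply: dens_cvg.
by apply: (msum_cvg' D (fun i => dens G mu q h2 (g i))) => x; apply: dens_cvg.
Qed.

Lemma dPhi_cvg D w z : (fun i => dPhi D (f i) (g i) w z) @ U --> dPhi D u v w z.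
Proof.
rewrite /dPhi; apply: cvgB; last exact: cvg_cst.
apply: cvgB; last exact: cvg_cst.
apply: cvgB; first (apply: cvgD).
- by apply: (msum_cvg' D (fun i => ddens G mu p h1 (f i) w)) => x; apply: ddens_cvg.
- by apply: (msum_cvg' D (fun i => ddens G mu q h2 (g i) z)) => x; apply: ddens_cvg.
- apply: (msum_cvg' D (fun i x => partial_s F x (f i x) (g i x) * w x + partial_t F x (f i x) (g i x) * z x)) => x.
  by apply: cvgD; apply: cvgMr_tmp; [apply: partial_s_cvg|apply: partial_t_cvg].
Qed.

End Limit.

(** Testing with the indicator of [x0] in one component isolates the equation at [x0], multiplied by
    its positive measure. [D] has to contain the neighbours because the gradient of the indicator
    lives there too. *)
Lemma dPhi_single D u v x0 : x0 \in D -> (nbr G x0 `<=` D)%fset ->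
  (dPhi D u v (single x0) (fun=> 0) = 0 ->
   - pLaplacian G mu p u x0 + h1 x0 * (`|u x0| `^ (p - 2) * u x0) =
     partial_s F x0 (u x0) (v x0) + lambda * e1 x0) /\
  (dPhi D u v (fun=> 0) (single x0) = 0 ->
   - pLaplacian G mu q v x0 + h2 x0 * (`|v x0| `^ (q - 2) * v x0) =
     partial_t F x0 (u x0) (v x0) + lambda * e2 x0).
Proof.
move=> xD nD.
have S (k : V -> R) : msum mu D (fun x => k x * single x0 x) = k x0 * mu x0.
  rewrite /msum (big_fsetD1 x0) //= big1_seq ?addr0; first by rewrite /single eqxx mulr1.
  by move=> y /=; rewrite !inE => /andP[/negPf yx _]; rewrite /single yx mulr0 mul0r.
have Z (k : V -> R) : msum mu D (fun x => k x * 0) = 0.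
  by apply: msum_supp0 => x _; rewrite mulr0.
have Zd r h f : msum mu D (ddens G mu r h f (fun=> 0)) = 0.
  apply: msum_supp0 => x _; rewrite /ddens mulr0 mulr0 addr0 GammaE big1 ?mulr0 //.
  by move=> y _; rewrite subrr mulr0.
have m0 : mu x0 != 0 by rewrite gt_eqF.
have P r h f : msum mu D (ddens G mu r h f (single x0)) =
    mu x0 * (- pLaplacian G mu r f x0 + h x0 * (`|f x0| `^ (r - 2) * f x0)).
  exact: ddens_single.
split; rewrite /dPhi P Zd !S !Z.
- rewrite (msum_eq _ _ _ (fun x => partial_s F x (u x) (v x) * single x0 x)); last by move=> x; rewrite mulr0 addr0.
  rewrite S => h; apply: (mulfI m0).
  apply/eqP; rewrite -subr_eq0; apply/eqP; rewrite -[RHS]h; ring.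
- rewrite (msum_eq _ _ _ (fun x => partial_t F x (u x) (v x) * single x0 x)); last by move=> x; rewrite mulr0 add0r.
  rewrite S => h; apply: (mulfI m0).
  apply/eqP; rewrite -subr_eq0; apply/eqP; rewrite -[RHS]h; ring.
Qed.

End FiniteEnergy.


(** * Geometry of the energy *)

Section SingleNorm.
Context {R : realType} {V : choiceType}.
Variables (G : weighted_graph R V) (mu : V -> R) (mu0 : R).
Hypotheses (mu0_gt0 : 0 < mu0) (mu_ge : forall x, mu0 <= mu x).
Variables (r h0 : R) (h : V -> R).
Hypotheses (r2 : 2 <= r) (h0_gt0 : 0 < h0) (h_ge : forall x, h0 <= h x).
Implicit Types (D : {fset V}) (u v : V -> R).

Lemma mu_pos x : 0 < mu x. Proof. exact: (lt_le_trans mu0_gt0). Qed.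
Let muge0 x : 0 <= mu x. Proof. by rewrite ltW // mu_pos. Qed.
Let hge0 x : 0 <= h x. Proof. by rewrite (le_trans _ (h_ge x)) // ltW. Qed.

Let dd := dens G mu r h.

Lemma msum_dens_ge0 D u : 0 <= msum mu D (dd u).
Proof. by apply: msum_ge0 => // x; exact: dens_ge0. Qed.

Lemma dens_sup D u x : x \in D -> h0 * mu0 * `|u x| `^ r <= msum mu D (dd u).
Proof.
move=> xD; apply: (@le_trans _ _ (msum mu [fset x]%fset (dd u))).
  rewrite /msum big_seq_fset1 mulrAC.
  apply: ler_pM => //; [by rewrite mulr_ge0 ?powR_ge0 ?ltW|exact: ltW|].
  exact: dens_ge.
apply: msum_subset => // [y|]; first exact: dens_ge0.
by rewrite fsub1set.
Qed.

Lemma dens_Lr D u : h0 * msum mu D (fun x => `|u x| `^ r) <= msum mu D (dd u).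
Proof. by rewrite -msumZ; apply: msum_le => // x; apply: dens_ge. Qed.

Lemma dual_bound D u (e : V -> R) : in_Lr mu (r / (r - 1)) e ->
  `|msum mu D (fun x => e x * u x)| <=
  h0 `^ (- r^-1) * fine (Lr_norm mu (r / (r - 1)) e) * msum mu D (dd u) `^ r^-1.
Proof.
have rr := r2.
have r0 : 0 < r by lra.
have r1 : 0 < r / (r - 1) by rewrite divr_gt0 //; lra.
have rr1 : r^-1 + (r / (r - 1))^-1 = 1 by field; lra.
move=> eL; apply: (le_trans (msum_norm _ _ _ _)) => //.
have H := holder_msum mu muge0 r (r / (r - 1)) r0 r1 rr1 e u D eL.
apply: (le_trans H).
rewrite [_ `^ (- _) * _]mulrC -mulrA; apply: ler_wpM2l.
  by rewrite fine_ge0 // /Lr_norm poweR_ge0.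
have m0 : 0 <= msum mu D (fun x => `|u x| `^ r) by apply: msum_ge0 => // x; exact: powR_ge0.
have e1 : msum mu D (fun x => `|u x| `^ r) = h0^-1 * (h0 * msum mu D (fun x => `|u x| `^ r)).
  by rewrite mulKf // gt_eqF.
rewrite e1 powRM ?invr_ge0 ?mulr_ge0 ?(ltW h0_gt0) //.
have -> : h0^-1 `^ r^-1 = h0 `^ (- r^-1).
  by rewrite inv_powR ?(ltW h0_gt0) // powRN.
apply: ler_wpM2l; first exact: powR_ge0.
apply: ge0_ler_powR; rewrite ?invr_ge0 ?nnegrE ?mulr_ge0 ?(ltW h0_gt0) ?(ltW r0) //.
  exact: msum_dens_ge0.
exact: dens_Lr.
Qed.

Lemma root_powR (a : R) : 0 <= a -> (a `^ r^-1) `^ r = a.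
Proof.
by move=> a0; rewrite -powRrM mulVf ?powRr1 //; have := r2 => rr; apply/eqP; lra.
Qed.

Lemma sup_le_root D u x : x \in D ->
  h0 `^ r^-1 * mu0 `^ r^-1 * `|u x| <= msum mu D (dd u) `^ r^-1.
Proof.
move=> xD; have rr := r2; have r0 : 0 < r by lra.
have -> : `|u x| = (`|u x| `^ r) `^ r^-1.
  by rewrite -powRrM mulfV ?powRr1 // gt_eqF.
rewrite -!powRM ?mulr_ge0 ?powR_ge0 ?(ltW h0_gt0) ?(ltW mu0_gt0) //.
apply: ge0_ler_powR; rewrite ?invr_ge0 ?nnegrE ?mulr_ge0 ?powR_ge0 ?(ltW h0_gt0) ?(ltW mu0_gt0) ?(ltW r0) //.
  exact: msum_dens_ge0.
exact: dens_sup.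
Qed.

(** A device for absorbing linear terms into r-th powers. For a <= K the left side is nonpositive;
    for a > K >= 1, a^r >= a^2 >= K a. *)
Lemma powR_superlinear (K a : R) : 1 <= K -> 0 <= a -> K * a - K ^+ 2 <= a `^ r.
Proof.
move=> K1 a0; have rr := r2.
have [aK|Ka] := leP a K.
  have : K * a <= K ^+ 2 by rewrite expr2 ler_wpM2l //; lra.
  by have := powR_ge0 a r; lra.
have a1 : 1 <= a by lra.
have : a ^+ 2 <= a `^ r by rewrite -powR_mulrn //; apply: ler_powR.
have : K * a <= a ^+ 2 by rewrite expr2 ler_wpM2r // ltW.
have := sqr_ge0 K; lra.
Qed.

End SingleNorm.

Section Geometry.
Context {R : realType} {V : choiceType}.
Variables (G : weighted_graph R V) (mu : V -> R) (mu0 : R).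
Hypotheses (mu0_gt0 : 0 < mu0) (mu_ge : forall x, mu0 <= mu x).
Variables (p q : R) (h1 h2 : V -> R) (F : V -> R -> R -> R) (e1 e2 : V -> R) (lambda : R).
Hypotheses (p2 : 2 <= p) (q2 : 2 <= q).
Hypotheses (e1L : in_Lr mu (p / (p - 1)) e1) (e2L : in_Lr mu (q / (q - 1)) e2).
Variable h0 : R.
Hypotheses (h0_gt0 : 0 < h0) (H1 : forall x, h0 <= h1 x /\ h0 <= h2 x).
Hypothesis F_C1 : C1_in_st F.
Hypothesis F00 : forall x, F x 0 0 = 0.
Hypothesis lambda_ge0 : 0 <= lambda.
Implicit Types (D : {fset V}) (u v : V -> R).

Let muge0 x : 0 <= mu x. Proof. exact/ltW/(mu_pos mu mu0). Qed.
Let h1_ge x : h0 <= h1 x. Proof. exact: (H1 x).1. Qed.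
Let h2_ge x : h0 <= h2 x. Proof. exact: (H1 x).2. Qed.

Let du := dens G mu p h1.
Let dv := dens G mu q h2.
Let PHI := Phi G mu p q h1 h2 F e1 e2 lambda.
Let DPHI := dPhi G mu p q h1 h2 F e1 e2 lambda.

(** The maximum in the denominator of [lambda0]; it bounds the linear part relative to [Nsum]. *)
Definition enorm : R := Num.max (h0 `^ (- p^-1) * fine (Lr_norm mu (p / (p - 1)) e1))
           (h0 `^ (- q^-1) * fine (Lr_norm mu (q / (q - 1)) e2)).

Lemma enorm_ge0 : 0 <= enorm.
Proof.
by rewrite le_max mulr_ge0 ?powR_ge0 // fine_ge0 // /Lr_norm poweR_ge0.
Qed.

(** The norm of the product space computed on [D]; the barrier is its sphere of radius [Lambda0]. *)
Definition Nsum D u v : R := msum mu D (du u) `^ p^-1 + msum mu D (dv v) `^ q^-1.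

Lemma linear_bound D u v :
  `|msum mu D (fun x => e1 x * u x)| + `|msum mu D (fun x => e2 x * v x)|
  <= enorm * Nsum D u v.
Proof.
rewrite /Nsum mulrDr; apply: lerD.
  apply: (le_trans (dual_bound G mu mu0 mu0_gt0 mu_ge p h0 h1 p2 h0_gt0 h1_ge D u e1 e1L)).
  by apply: ler_wpM2r; rewrite ?powR_ge0 // le_max lexx.
apply: (le_trans (dual_bound G mu mu0 mu0_gt0 mu_ge q h0 h2 q2 h0_gt0 h2_ge D v e2 e2L)).
by apply: ler_wpM2r; rewrite ?powR_ge0 // le_max lexx orbT.
Qed.

(** * The barrier on the sphere of radius [Lambda0] *)

Section SmallNorm.
Variable l0 : R.
Hypothesis l0_gt0 : 0 < l0.
Hypothesis C1 : forall x (s t : R), euclid s t < l0 ->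
  `|partial_s F x s t|
    <= h0 / (q + 1) * (`|s| `^ (p - 1) + `|t| `^ ((p * q - q) / p)) /\
  `|partial_t F x s t|
    <= h0 / (q + 1) * (`|s| `^ p + `|t| `^ (q - 1)).

(** Integration from (0, 0) to (0, t) to (s, t), a path inside the disc where (C1) holds. Young's
    inequality with exponents p and p/(p-1) splits the mixed term |s| |t|^((pq-q)/p); this produces
    the second half of 2/p and the coefficient (p-1)/p. *)
Lemma F_bound x s t : euclid s t < l0 ->
  `|F x s t| <= h0 / (q + 1) *
    (2 / p * `|s| `^ p + ((p - 1) / p + q^-1) * `|t| `^ q).
Proof.
move=> st; have pp := p2; have qq := q2; have hh := h0_gt0.
have mono (a b a' b' : R) : `|a'| <= `|a| -> `|b'| <= `|b| -> euclid a' b' <= euclid a b.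
  move=> aa bb; rewrite /euclid ler_wsqrtr // lerD // -(real_normK (num_real _)) -[in leRHS](real_normK (num_real _));
    by rewrite ler_sqr ?nnegrE.
set c := h0 / (q + 1).
have c0 : 0 <= c by rewrite divr_ge0 //; lra.
have A1 := @primitive_bound R (fun s' => F x s' t) (fun s' => partial_s F x s' t)
  (c * `|t| `^ ((p * q - q) / p)) c p s p2 (fun s' => is_derive_s F F_C1 x s' t).
have {}A1 := A1 (fun y hy => le_trans (C1 x y t (le_lt_trans (mono s t y t hy (lexx _)) st)).1
   (eq_ind_r (fun z => z <= _) (lexx _) (_ : _ = c * `|t| `^ ((p * q - q) / p) + c * `|y| `^ (p - 1)))).
have {}A1 := A1 ltac:(by move=> y; rewrite -/c mulrDr addrC).
have A2 := @primitive_bound R (fun t' => F x 0 t') (fun t' => partial_t F x 0 t')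
  0 c q t q2 (fun t' => is_derive_t F F_C1 x 0 t').
have A2h (y : R) : `|y| <= `|t| -> `|partial_t F x 0 y| <= 0 + c * `|y| `^ (q - 1).
  move=> hy; have [_] := C1 x 0 y (le_lt_trans (mono s t 0 y ltac:(by rewrite normr0) hy) st).
  by rewrite normr0 powR0 ?add0r //; apply/eqP; lra.
have {}A2 := A2 A2h.
rewrite F00 subr0 mul0r add0r in A2.
have Y : `|s| * `|t| `^ ((p * q - q) / p) <= `|s| `^ p / p + (p - 1) / p * `|t| `^ q.
  have := @conjugate_powR R `|s| (`|t| `^ ((p * q - q) / p)) p (p / (p - 1)) (normr_ge0 _) (powR_ge0 _ _).
  have i1 : 0 < p by lra.
  have i2 : 0 < p / (p - 1) by rewrite divr_gt0 //; lra.
  have i3 : p^-1 + (p / (p - 1))^-1 = 1 by field; lra.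
  move=> /(_ i1 i2 i3); rewrite -powRrM.
  have -> : (p * q - q) / p * (p / (p - 1)) = q by field; lra.
  by rewrite invf_div [_ * ((p - 1) / p)]mulrC.
have Z : `|F x s t| <= `|F x s t - F x 0 t| + `|F x 0 t|.
  by rewrite -{1}(subrK (F x 0 t) (F x s t)) ler_normD.
have Y' := ler_wpM2l c0 Y.
apply: (le_trans Z); apply: (le_trans (lerD A1 A2)).
have -> : c * (2 / p * `|s| `^ p + ((p - 1) / p + q^-1) * `|t| `^ q) =
  c * (`|s| `^ p / p + (p - 1) / p * `|t| `^ q) + c * (`|s| `^ p / p) + c * (`|t| `^ q / q).
  by field; lra.
lra.
Qed.

Lemma euclid_lt (s t : R) : `|s| <= l0 / 2 -> `|t| <= l0 / 2 -> euclid s t < l0.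
Proof.
move=> hs ht; have ll := l0_gt0.
rewrite /euclid -[X in _ < X](ger0_norm (ltW l0_gt0)) -sqrtr_sqr ltr_sqrt; last by rewrite exprn_gt0.
have : s ^+ 2 <= (l0 / 2) ^+ 2.
  by rewrite -(real_normK (num_real s)) ler_sqr ?nnegrE //; lra.
have : t ^+ 2 <= (l0 / 2) ^+ 2.
  by rewrite -(real_normK (num_real t)) ler_sqr ?nnegrE //; lra.
have : 0 < l0 ^+ 2 by rewrite exprn_gt0.
have -> : (l0 / 2) ^+ 2 = l0 ^+ 2 / 4 by field.
lra.
Qed.

Let rho := Lambda0 p q h0 mu0 l0.

Lemma rho_gt0 : 0 < rho.
Proof.
by rewrite /rho /Lambda0 lt_min ltr01 andbT mulr_gt0 ?divr_gt0 // lt_min !mulr_gt0 ?powR_gt0.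
Qed.

Lemma rho_le1 : rho <= 1. Proof. by rewrite /rho /Lambda0 ge_min lexx orbT. Qed.

(** The purpose of the factor l0/2 in [Lambda0]: within the ball both values are small enough for
    (C1). *)
Lemma small_values D u v x : Nsum D u v <= rho -> x \in D ->
  `|u x| <= l0 / 2 /\ `|v x| <= l0 / 2.
Proof.
move=> N xD; have hp := powR_gt0 p^-1 h0_gt0; have hq := powR_gt0 q^-1 h0_gt0.
have mp := powR_gt0 p^-1 mu0_gt0; have mq := powR_gt0 q^-1 mu0_gt0.
have A := sup_le_root G mu mu0 mu0_gt0 mu_ge p h0 h1 p2 h0_gt0 h1_ge D u x xD.
have B := sup_le_root G mu mu0 mu0_gt0 mu_ge q h0 h2 q2 h0_gt0 h2_ge D v x xD.
have rl : rho <= l0 / 2 * Num.min (h0 `^ p^-1 * mu0 `^ p^-1) (h0 `^ q^-1 * mu0 `^ q^-1).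
  by rewrite /rho /Lambda0 ge_min lexx.
have ll : 0 < l0 / 2 by rewrite divr_gt0.
have ap := powR_ge0 (msum mu D (dens G mu p h1 u)) p^-1.
have bq := powR_ge0 (msum mu D (dens G mu q h2 v)) q^-1.
rewrite /Nsum /du /dv in N.
move: A B N ap bq rl.
move: (msum mu D (dens G mu p h1 u) `^ p^-1) (msum mu D (dens G mu q h2 v) `^ q^-1).
move=> a b A B N ap bq rl.
split.
- have kp : 0 < h0 `^ p^-1 * mu0 `^ p^-1 by rewrite mulr_gt0.
  rewrite -(ler_pM2l kp); apply: (le_trans A).
  apply: (le_trans (le_trans _ N)); first by rewrite lerDl.
  by apply: (le_trans rl); rewrite mulrC ler_wpM2r ?(ltW ll) // ge_min lexx.
- have kq : 0 < h0 `^ q^-1 * mu0 `^ q^-1 by rewrite mulr_gt0.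
  rewrite -(ler_pM2l kq); apply: (le_trans B).
  apply: (le_trans (le_trans _ N)); first by rewrite lerDr.
  by apply: (le_trans rl); rewrite mulrC ler_wpM2r ?(ltW ll) // ge_min lexx orbT.
Qed.

Lemma Phi_lower D u v : Nsum D u v <= rho ->
  (p * q + p)^-1 * (msum mu D (du u) + msum mu D (dv v)) - lambda * (enorm * Nsum D u v)
  <= PHI D u v.
Proof.
move=> N; have pp := p2; have qq := q2.
have hh := h0_gt0.
have FB : msum mu D (fun x => F x (u x) (v x)) <=
    (q + 1)^-1 * (2 / p * msum mu D (du u) + ((p - 1) / p + q^-1) * msum mu D (dv v)).
  apply: (@le_trans _ _ (msum mu D (fun x => (q + 1)^-1 * (2 / p * (h0 * `|u x| `^ p) + ((p - 1) / p + q^-1) * (h0 * `|v x| `^ q))))).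
    rewrite /msum big_seq [leRHS]big_seq; apply: ler_sum => x xD.
    apply: ler_wpM2r; first exact: muge0.
    have [hu hv] := small_values D u v x N xD.
    have := F_bound x _ _ (euclid_lt _ _ hu hv).
    move=> /(le_trans (ler_norm _)) /le_trans; apply.
    by rewrite le_eqVlt; apply/orP; left; apply/eqP; field; lra.
  rewrite msumZ; apply: ler_wpM2l; first by rewrite invr_ge0; lra.
  rewrite msumD !msumZ; apply: lerD; apply: ler_wpM2l.
  - by rewrite divr_ge0 //; lra.
  - exact: (dens_Lr G mu mu0 mu0_gt0 mu_ge p h0 h1 h1_ge D u).
  - by rewrite addr_ge0 ?divr_ge0 ?invr_ge0 //; lra.
  - exact: (dens_Lr G mu mu0 mu0_gt0 mu_ge q h0 h2 h2_ge D v).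
have LB := linear_bound D u v.
have LB' := ler_wpM2l lambda_ge0 LB.
have L1 : lambda * msum mu D (fun x => e1 x * u x) <= lambda * `|msum mu D (fun x => e1 x * u x)|.
  by apply: ler_wpM2l => //; exact: ler_norm.
have L2 : lambda * msum mu D (fun x => e2 x * v x) <= lambda * `|msum mu D (fun x => e2 x * v x)|.
  by apply: ler_wpM2l => //; exact: ler_norm.
rewrite mulrDr in LB'.
rewrite /PHI /Phi -/du -/dv.
set a := msum mu D (du u) in FB *; set b := msum mu D (dv v) in FB *.
have a0 : 0 <= a by apply: (msum_dens_ge0 G mu mu0 mu0_gt0 mu_ge p h0 h1).
have b0 : 0 <= b by apply: (msum_dens_ge0 G mu mu0 mu0_gt0 mu_ge q h0 h2).
have pq0 : 0 < p * q + p by rewrite addr_gt0 ?mulr_gt0 //; lra.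
(* The coefficients are 1/p - 2/(p(q+1)) = (q-1)/(pq+p) and 1/q - ((p-1)/p + 1/q)/(q+1) = 1/(pq+p);
   since q >= 2, the smaller one is 1/(pq+p). *)
have key : (p * q + p)^-1 * (a + b) <= p^-1 * a + q^-1 * b - (q + 1)^-1 * (2 / p * a + ((p - 1) / p + q^-1) * b).
  have -> : p^-1 * a + q^-1 * b - (q + 1)^-1 * (2 / p * a + ((p - 1) / p + q^-1) * b) =
    (p * q + p)^-1 * ((q - 1) * a + b) by field; rewrite !gt_eqF //; lra.
  apply: ler_wpM2l; first by rewrite invr_ge0 ltW.
  have : 0 <= (q - 2) * a by rewrite mulr_ge0 //; lra.
  lra.
lra.
Qed.

(** Since rho <= 1, both exponents may be raised to the larger one, whose midpoint convexity then
    applies. This explains the entry 1 in [Lambda0] and the power of 2 in [lambda0]. *)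
Lemma sum_powers_lower (a b : R) : 0 <= a -> 0 <= b -> a + b = rho ->
  2 `^ (1 - Num.max p q) * rho `^ Num.max p q <= a `^ p + b `^ q.
Proof.
move=> a0 b0 ab; have pp := p2; have qq := q2; set m := Num.max p q.
have m1 : 1 <= m by rewrite le_max; apply/orP; left; lra.
have r1 := rho_le1.
have le_ (z r : R) : 0 <= z -> z <= 1 -> 0 < r -> r <= m -> z `^ m <= z `^ r.
  move=> z0 z1 r0 rm; have [->|zn] := eqVneq z 0.
    by rewrite !powR0 ?gt_eqF //; lra.
  by apply: ger_powR; rewrite // z1 lt_neqAle eq_sym zn z0.
have ha : a `^ m <= a `^ p by apply: le_ => //; [lra|lra|rewrite le_max lexx].
have hb : b `^ m <= b `^ q by apply: le_ => //; [lra|lra|rewrite le_max lexx orbT].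
have := powR_midpoint _ _ _ m1 a0 b0; rewrite ab.
rewrite powRM ?invr_ge0 // -?ab ?addr_ge0 // ab.
rewrite inv_powR //.
rewrite powRB; last by rewrite pnatr_eq0 implybT.
rewrite powRr1 //; have := powR_gt0 m (ltr0Sn R 1).
set k := 2 `^ m => k0 h.
have -> : 2 / k * rho `^ m = 2 * (rho `^ m / k) by ring.
lra.
Qed.

Definition barrier_height : R :=
  rho * (2 `^ (1 - Num.max p q) * rho `^ (Num.max p q - 1) / (p * q + p) - lambda * enorm).

Lemma barrier D u v : Nsum D u v = rho -> barrier_height <= PHI D u v.
Proof.
move=> N; apply: le_trans (Phi_lower D u v _); last by rewrite N.
rewrite N /barrier_height mulrBr; have pp := p2; have qq := q2.
have pq0 : 0 < p * q + p by rewrite addr_gt0 ?mulr_gt0 //; lra.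
rewrite [X in _ - X]mulrCA; rewrite [rho * enorm]mulrC lerD2r.
rewrite [X in _ <= X]mulrC mulrA; apply: ler_wpM2r; first by rewrite invr_ge0 ltW.
have E : rho * (2 `^ (1 - Num.max p q) * rho `^ (Num.max p q - 1)) = 2 `^ (1 - Num.max p q) * rho `^ Num.max p q.
  rewrite mulrCA mulr_powRB1 //; first exact/ltW/rho_gt0.
  by rewrite lt_max; apply/orP; left; lra.
rewrite E.
have aE := root_powR p p2 _ (msum_dens_ge0 G mu mu0 mu0_gt0 mu_ge p h0 h1 h0_gt0 h1_ge D u).
have bE := root_powR q q2 _ (msum_dens_ge0 G mu mu0 mu0_gt0 mu_ge q h0 h2 h0_gt0 h2_ge D v).
rewrite -/du in aE; rewrite -/dv in bE; rewrite -aE -bE.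
by apply: sum_powers_lower; rewrite ?powR_ge0.
Qed.

(** For q >= 2 the minimum of 1 and q - 1 is 1, and then [lambda < lambda0] says exactly that the
    bracket in [barrier_height] is positive. *)
Lemma barrier_gt0 : 0 < lambda < lambda0 mu p q h0 mu0 l0 e1 e2 -> 0 < barrier_height.
Proof.
move=> /andP[lp]; rewrite /lambda0 -/rho -/enorm => ll; have pp := p2; have qq := q2.
have pq0 : 0 < p * q + p by rewrite addr_gt0 ?mulr_gt0 //; lra.
rewrite min_l in ll; last lra.
have rp := powR_gt0 (Num.max p q - 1) rho_gt0.
have k0 := powR_gt0 (Num.max p q - 1) (ltr0Sn R 1).
(* The inverse of 0 is 0, so [enorm = 0] would give [lambda0 = 0] and leave no [lambda]. *)
have E0 : 0 < enorm.
  rewrite lt_neqAle enorm_ge0 andbT; apply/eqP => e0.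
  by move: ll; rewrite -e0 mulr0 invr0 mulr0 mul0r; lra.
rewrite /barrier_height mulr_gt0 ?rho_gt0 // subr_gt0.
have -> : 2 `^ (1 - Num.max p q) = (2 `^ (Num.max p q - 1))^-1 :> R.
  by rewrite -powRN opprB.
rewrite -ltr_pdivlMr // (lt_le_trans ll) // le_eqVlt; apply/orP; left; apply/eqP.
by field; rewrite !gt_eqF.
Qed.

End SmallNorm.

(** * Coercivity from (C3) *)

Section Superquadratic.
Variables (nu A : R).
Hypotheses (nu_gt : Num.max p q < nu) (A_ge0 : 0 <= A)
  (A_lt : A < Num.min (nu / p - 1) (nu / q - 1) * h0).
Hypothesis C3 : forall x (s t : R),
  nu * F x s t - partial_s F x s t * s - partial_t F x s t * t
    <= A * (`|s| `^ p + `|t| `^ q).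

(** What remains of the coefficients nu/p - 1 and nu/q - 1 once the right side of (C3), at most A/h0
    times the densities, has been subtracted. *)
Definition kappa : R := Num.min (nu / p - 1) (nu / q - 1) - A / h0.

Lemma kappa_gt0 : 0 < kappa.
Proof. by rewrite /kappa subr_gt0 ltr_pdivrMr. Qed.

Lemma nu_ge2 : 2 <= nu.
Proof. by have := nu_gt; rewrite gt_max => /andP[]; have := p2; lra. Qed.

Lemma AR_bound D u v :
  kappa * (msum mu D (du u) + msum mu D (dv v)) - lambda * (nu - 1) * (enorm * Nsum D u v)
  <= nu * PHI D u v - DPHI D u v u v.
Proof.
have pp := p2; have qq := q2; have n2 := nu_ge2.
have EU : msum mu D (ddens G mu p h1 u u) = msum mu D (du u).
  by apply: msum_eq => x; rewrite ddens_diag // => y; exact: (mu_pos mu mu0).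
have EV : msum mu D (ddens G mu q h2 v v) = msum mu D (dv v).
  by apply: msum_eq => x; rewrite ddens_diag // => y; exact: (mu_pos mu mu0).
rewrite /PHI /DPHI /Phi /dPhi EU EV -/du -/dv.
set a := msum mu D (du u); set b := msum mu D (dv v).
set f := msum mu D (fun x => F x (u x) (v x)).
set df := msum mu D (fun x => partial_s F x (u x) (v x) * u x + partial_t F x (u x) (v x) * v x).
set eu := msum mu D (fun x => e1 x * u x); set ev := msum mu D (fun x => e2 x * v x).
have a0 : 0 <= a by apply: (msum_dens_ge0 G mu mu0 mu0_gt0 mu_ge p h0 h1).
have b0 : 0 <= b by apply: (msum_dens_ge0 G mu mu0 mu0_gt0 mu_ge q h0 h2).
have FB : nu * f - df <= A / h0 * (a + b).
  rewrite /f /df -msumZ -msumB.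
  apply: (@le_trans _ _ (msum mu D (fun x => A / h0 * (h0 * `|u x| `^ p + h0 * `|v x| `^ q)))).
    apply: msum_le => // x; have := C3 x (u x) (v x).
    have -> : A / h0 * (h0 * `|u x| `^ p + h0 * `|v x| `^ q) = A * (`|u x| `^ p + `|v x| `^ q).
      by field; rewrite gt_eqF.
    lra.
  rewrite msumZ msumD !msumZ; apply: ler_wpM2l; first by rewrite divr_ge0 // ltW.
  apply: lerD.
    exact: (dens_Lr G mu mu0 mu0_gt0 mu_ge p h0 h1 h1_ge D u).
  exact: (dens_Lr G mu mu0 mu0_gt0 mu_ge q h0 h2 h2_ge D v).
have LB := linear_bound D u v; rewrite -/eu -/ev in LB.
have ln0 : 0 <= lambda * (nu - 1) by rewrite mulr_ge0 //; lra.
have LB' := ler_wpM2l ln0 LB.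
have L1 : lambda * (nu - 1) * eu <= lambda * (nu - 1) * `|eu| by apply: ler_wpM2l => //; exact: ler_norm.
have L2 : lambda * (nu - 1) * ev <= lambda * (nu - 1) * `|ev| by apply: ler_wpM2l => //; exact: ler_norm.
have K1 : (kappa + A / h0) * a <= (nu / p - 1) * a.
  by apply: ler_wpM2r => //; rewrite /kappa subrK ge_min lexx.
have K2 : (kappa + A / h0) * b <= (nu / q - 1) * b.
  by apply: ler_wpM2r => //; rewrite /kappa subrK ge_min lexx orbT.
have -> : nu * (p^-1 * a + q^-1 * b - f - lambda * eu - lambda * ev) - (a + b - df - lambda * eu - lambda * ev)
   = (nu / p - 1) * a + (nu / q - 1) * b - (nu * f - df) - lambda * (nu - 1) * eu - lambda * (nu - 1) * ev by ring.
rewrite mulrDr in LB'.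
lra.
Qed.

Definition slack : R := let K := 1 + 2 * (lambda * (nu - 1) * enorm) / kappa in K ^+ 2.

(** Half of [kappa] pays for the linear term: with c its coefficient, [K] in [slack] satisfies 2c <=
    kappa K, so [powR_superlinear] gives c a <= (kappa/2)(a^r + K^2). The two components together
    leave [kappa * slack]. *)
Lemma AR_coercive D u v :
  kappa / 2 * (msum mu D (du u) + msum mu D (dv v)) - kappa * slack
  <= nu * PHI D u v - DPHI D u v u v.
Proof.
have n2 := nu_ge2; have k0 := kappa_gt0.
apply: le_trans (AR_bound D u v).
set c := lambda * (nu - 1) * enorm.
have c0 : 0 <= c.
  apply: mulr_ge0; last exact: enorm_ge0.
  by apply: mulr_ge0 => //; lra.
rewrite mulrA -/c /slack -/c.
set K := 1 + 2 * c / kappa.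
have K1 : 1 <= K.
  by rewrite lerDl; apply: divr_ge0; [exact: mulr_ge0|exact: ltW].
have kK : 2 * c <= kappa * K.
  have -> : kappa * K = kappa + 2 * c by rewrite /K; field; rewrite gt_eqF.
  lra.
have aE := root_powR p p2 _ (msum_dens_ge0 G mu mu0 mu0_gt0 mu_ge p h0 h1 h0_gt0 h1_ge D u).
have bE := root_powR q q2 _ (msum_dens_ge0 G mu mu0 mu0_gt0 mu_ge q h0 h2 h0_gt0 h2_ge D v).
rewrite /Nsum.
have sa := powR_superlinear p p2 K _ K1 (powR_ge0 (msum mu D (dens G mu p h1 u)) p^-1).
have sb := powR_superlinear q q2 K _ K1 (powR_ge0 (msum mu D (dens G mu q h2 v)) q^-1).
rewrite aE -/du in sa; rewrite bE -/dv in sb.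
have a0 := powR_ge0 (msum mu D (du u)) p^-1; have b0 := powR_ge0 (msum mu D (dv v)) q^-1.
set x := msum mu D (du u) `^ p^-1 in sa a0 *; set y := msum mu D (dv v) `^ q^-1 in sb b0 *.
clear aE bE; clearbody x y.
have k20 : 0 <= kappa / 2 by apply: divr_ge0; first exact: ltW.
have ta := ler_wpM2l k20 sa; have tb := ler_wpM2l k20 sb.
have ua : 2 * c * x <= kappa * K * x by apply: ler_wpM2r.
have ub : 2 * c * y <= kappa * K * y by apply: ler_wpM2r.
rewrite !mulrBr in ta tb.
lra.
Qed.

End Superquadratic.
End Geometry.


(** * Galerkin approximations *)

Lemma root_le1 (R : realType) (r z : R) : 2 <= r -> 0 <= z -> z `^ r^-1 <= 1 -> z <= 1.
Proof.
move=> r2 z0 zr; rewrite leNgt; apply/negP => z1.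
have ri : 0 < r^-1 by rewrite invr_gt0; lra.
have : (1 : R) `^ r^-1 < z `^ r^-1 by apply: gt0_ltr_powR; rewrite ?nnegrE.
by rewrite powR1 ltNge zr.
Qed.

(** * Coordinates on the pairs supported in a finite set *)

Section Embedding.
Context {R : realType} {V : choiceType} (K : {fset (bool * V)}).
Let n := size (enum_fset K).
Local Notation X := 'rV[R]_n.

(** A single finite set encodes both components: [(true, x)] is a coordinate of the first function,
    [(false, x)] of the second. *)
Definition emb (w : X) (b : bool) (x : V) : R :=
  if insub (index (b, x) (enum_fset K)) is Some i then w 0 i else 0.

Lemma emb_lin (a : R) (w w' : X) b x :
  emb (a *: w + w') b x = a * emb w b x + emb w' b x.
Proof. by rewrite /emb; case: insub => [i|]; rewrite ?mxE // mulr0 addr0. Qed.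

Lemma emb0 b x : emb 0 b x = 0.
Proof. by rewrite /emb; case: insub => [i|]; rewrite ?mxE. Qed.

Lemma emb_supp w b x : (b, x) \notin K -> emb w b x = 0.
Proof.
move=> bx; rewrite /emb insubN // -leqNgt.
by rewrite leqNgt index_mem.
Qed.

Lemma emb_surj (W : bool -> V -> R) : (forall b x, (b, x) \notin K -> W b x = 0) ->
  exists w : X, forall b x, emb w b x = W b x.
Proof.
move=> hW.
exists (\row_i (let k := tnth (in_tuple (enum_fset K)) i in W k.1 k.2)) => b x.
case: (boolP ((b, x) \in K)) => bx; last by rewrite emb_supp // hW.
have lt : (index (b, x) (enum_fset K) < n)%N by rewrite index_mem.
rewrite /emb (insubT (fun i => i < n)%N lt) mxE.
by rewrite (tnth_nth (b, x)) /= nth_index.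
Qed.

Lemma emb_norm_lt w (M : R) : 0 < M ->
  (forall b x, (b, x) \in K -> `|emb w b x| < M) -> `|w| < M.
Proof.
move=> M0 h; have -> : `|w| = mx_norm w by [].
rewrite mx_normrE; apply/bigmax_ltP; split => // -[i j] _ /=.
case E : (tnth (in_tuple (enum_fset K)) j) => [b x].
have bx : (b, x) \in K by rewrite -E; exact: mem_tnth.
have := h b x bx; rewrite /emb.
have -> : index (b, x) (enum_fset K) = j.
  by rewrite -E (tnth_nth (b, x)) /= index_uniq // fset_uniq.
by rewrite valK (ord1 i).
Qed.

Lemma emb_cont b x : continuous (fun w : X => emb w b x).
Proof.
rewrite /emb; case: insub => [i|] w; last exact: cst_continuous.
exact: coord_continuous.
Qed.

End Embedding.

Section Closure.
Context {R : realType} {V : choiceType} (G : weighted_graph R V).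

(** Gradients reach one edge beyond the support, so the densities of functions supported in [K]
    vanish outside this set. *)
Definition clos (K : {fset (bool * V)}) : {fset V} :=
  (\bigcup_(k <- K) (k.2 |` nbr G k.2))%fset.

Lemma clos_sub K b x : (b, x) \in K -> ((x |` nbr G x) `<=` clos K)%fset.
Proof. by move=> bx; exact: (bigfcup_sup (fun k : bool * V => (k.2 |` nbr G k.2)%fset) bx isT). Qed.

Lemma clos_mem K b x : (b, x) \in K -> x \in clos K.
Proof. by move=> /clos_sub/fsubsetP; apply; rewrite !inE eqxx. Qed.

Lemma clos_nbr K b x : (b, x) \in K -> (nbr G x `<=` clos K)%fset.
Proof.
move=> /clos_sub; apply: fsubset_trans; exact: fsubsetU1.
Qed.

Variables (mu : V -> R) (mu_gt0 : forall x, 0 < mu x).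

Lemma dens_clos (K : {fset (bool * V)}) (r : R) (h u : V -> R) b x : 2 <= r ->
  (forall x, (b, x) \notin K -> u x = 0) -> x \notin clos K -> dens G mu r h u x = 0.
Proof.
move=> r2 us xK; apply: dens_supp => //.
  by apply: us; apply: contra xK => /clos_mem.
move=> y yx; apply: us; apply: contra xK => /clos_nbr/fsubsetP; apply.
by rewrite nbr_sym.
Qed.

End Closure.

Section Galerkin.
Context {R : realType} {V : choiceType}.
Variables (G : weighted_graph R V) (mu : V -> R) (mu0 : R).
Hypotheses (mu0_gt0 : 0 < mu0) (mu_ge : forall x, mu0 <= mu x).
Variables (p q : R) (h1 h2 : V -> R) (F : V -> R -> R -> R) (e1 e2 : V -> R) (lambda : R).
Hypotheses (p2 : 2 <= p) (q2 : 2 <= q).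
Hypotheses (e1L : in_Lr mu (p / (p - 1)) e1) (e2L : in_Lr mu (q / (q - 1)) e2).
Variable h0 : R.
Hypotheses (h0_gt0 : 0 < h0) (H1 : forall x, h0 <= h1 x /\ h0 <= h2 x).
Hypothesis F_C1 : C1_in_st F.
Hypothesis F00 : forall x, F x 0 0 = 0.
Implicit Types (D : {fset V}) (u v : V -> R) (K : {fset (bool * V)}).

Let muge0 x : 0 <= mu x. Proof. exact/ltW/(mu_pos mu mu0). Qed.
Let mugt0 x : 0 < mu x. Proof. exact/(mu_pos mu mu0). Qed.
Let h1_ge x : h0 <= h1 x. Proof. exact: (H1 x).1. Qed.
Let h2_ge x : h0 <= h2 x. Proof. exact: (H1 x).2. Qed.
Let h1_ge0 x : 0 <= h1 x. Proof. exact: le_trans (ltW h0_gt0) (h1_ge x). Qed.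
Let h2_ge0 x : 0 <= h2 x. Proof. exact: le_trans (ltW h0_gt0) (h2_ge x). Qed.

Let du := dens G mu p h1.
Let dv := dens G mu q h2.
Let PHI := Phi G mu p q h1 h2 F e1 e2 lambda.
Let DPHI := dPhi G mu p q h1 h2 F e1 e2 lambda.
Let NS := Nsum G mu p q h1 h2.

Definition critical K u v : Prop :=
  [/\ forall x, (true, x) \notin K -> u x = 0,
      forall x, (false, x) \notin K -> v x = 0 &
      forall w z, (forall x, (true, x) \notin K -> w x = 0) ->
        (forall x, (false, x) \notin K -> z x = 0) -> DPHI (clos G K) u v w z = 0].

Lemma Phi_clos K D u v : (forall x, (true, x) \notin K -> u x = 0) ->
  (forall x, (false, x) \notin K -> v x = 0) -> (clos G K `<=` D)%fset ->
  PHI D u v = PHI (clos G K) u v.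
Proof.
move=> us vs KD.
have z b x : x \notin clos G K -> (b, x) \notin K by apply: contra => /clos_mem.
rewrite /PHI /Phi; congr (_ * _ + _ * _ - _ - _ * _ - _ * _); apply: msum_supp => // x xK.
- exact: (dens_clos G mu mugt0 K p h1 u true).
- exact: (dens_clos G mu mugt0 K q h2 v false).
- by rewrite us ?vs ?F00 // z.
- by rewrite us ?mulr0 // z.
- by rewrite vs ?mulr0 // z.
Qed.

(** * The energy along multiples of the indicator of a vertex *)

Section Dir.
Variable x0 : V.
Let D0 : {fset V} := (x0 |` nbr G x0)%fset.
Let ray (s : R) : V -> R := fun x => s * single x0 x.

Definition peak (r : R) (h : V -> R) : R := msum mu D0 (dens G mu r h (single x0)).

(** The origin of [Dconst]: at [x0] and at each neighbour x, Gamma of the indicator is at most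
    deg(x0) / (2 mu(x)), and raising this to the power r/2 and multiplying by mu(x) gives
    (deg(x0)/2)^(r/2) mu(x)^(1-r/2). *)
Lemma peak_le (r : R) (h : V -> R) : 2 <= r -> (forall x, 0 <= h x) ->
  peak r h <= Dconst G mu r x0 + mu x0 * h x0.
Proof.
move=> r2 hh; have r1 : 0 <= r / 2 by rewrite divr_ge0 //; lra.
have degE : deg G x0 = \sum_(y <- nbr G x0) weight G x0 y.
  by rewrite /deg fsbig_finite //; exact: locally_finite.
have wge0 x y : y \in nbr G x -> 0 <= weight G x y.
  by rewrite in_nbr => xy; exact/ltW/weight_gt0.
have deg0 : 0 <= deg G x0.
  by rewrite degE big_seq; apply: sumr_ge0 => y; exact: wge0.
have Gx0 : Gamma G mu (single x0) (single x0) x0 <= deg G x0 / 2 * (mu x0)^-1.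
  rewrite GammaE invfM mulrC mulrA; apply: ler_wpM2r; first by rewrite invr_ge0.
  apply: ler_wpM2r => //; rewrite degE big_seq [leRHS]big_seq; apply: ler_sum => y yx.
  rewrite /single eqxx; case: eqP => _; first by rewrite subrr mulr0 wge0.
  by rewrite sub0r mulrN1 mulrN1 opprK.
have Gx x : x \in nbr G x0 -> x != x0 ->
    Gamma G mu (single x0) (single x0) x <= deg G x0 / 2 * (mu x)^-1.
  move=> xn xx0; rewrite GammaE invfM mulrC mulrA; apply: ler_wpM2r; first by rewrite invr_ge0.
  apply: ler_wpM2r => //.
  rewrite (big_fsetD1 x0) /=; last by rewrite nbr_sym.
  rewrite big1_seq ?addr0; last first.
    move=> y /=; rewrite !inE => /andP[/negPf yx _].
    by rewrite /single yx (negPf xx0) subrr mulr0.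
  rewrite /single eqxx (negPf xx0) subr0 !mulr1 (@weight_sym _ _ G x x0) -?in_nbr 1?nbr_sym //.
  rewrite degE (big_fsetD1 x) //= lerDl big_seq; apply: sumr_ge0 => y.
  by rewrite !inE => /andP[_]; exact: wge0.
have d20 : 0 <= deg G x0 / 2 by rewrite divr_ge0.
have bnd x : Gamma G mu (single x0) (single x0) x <= deg G x0 / 2 * (mu x)^-1 ->
   grad_norm G mu (single x0) x `^ r * mu x <= (deg G x0 / 2) `^ (r / 2) * (mu x)^-1 `^ (r / 2 - 1).
  move=> hx; rewrite grad_powR //.
  apply: (@le_trans _ _ ((deg G x0 / 2 * (mu x)^-1) `^ (r / 2) * mu x)).
    apply: ler_wpM2r => //; apply: ge0_ler_powR => //; rewrite ?nnegrE ?Gamma_ge0 //.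
    by rewrite mulr_ge0 // invr_ge0.
  have m0 : 0 < (mu x)^-1 by rewrite invr_gt0.
  rewrite powRM ?(ltW m0) // -mulrA -(@mulr_powRB1 R (mu x)^-1 (r / 2)) ?(ltW m0) //; last first.
    by rewrite divr_gt0 //; lra.
  by rewrite mulrAC mulVf ?mul1r // gt_eqF.
rewrite /peak /D0 /msum.
have nE : (x0 |` nbr G x0)%fset = (x0 |` (nbr G x0 `\ x0))%fset.
  by apply/fsetP => x; rewrite !inE; case: eqP.
rewrite nE big_fsetU1 /=; last by rewrite !inE eqxx.
have r0 : r != 0 by apply/eqP; lra.
rewrite {1}/dens mulrDl.
have -> : h x0 * `|single x0 x0| `^ r * mu x0 = mu x0 * h x0.
  by rewrite /single eqxx normr1 powR1 mulr1 mulrC.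
rewrite /Dconst fsbig_finite; last exact: locally_finite.
rewrite -inv_powR //.
rewrite mulrDr addrAC lerD2r addrC; apply: lerD; last exact: bnd.
rewrite mulr_sumr.
apply: (@le_trans _ _ (\sum_(x <- (nbr G x0 `\ x0)%fset) (deg G x0 / 2) `^ (r / 2) * (mu x)^-1 `^ (r / 2 - 1))).
  rewrite big_seq [leRHS]big_seq; apply: ler_sum => x; rewrite !inE => /andP[xx0 xn].
  rewrite /dens [single x0 x]/single (negPf xx0) normr0 powR0 // mulr0 addr0.
  by apply: bnd; exact: Gx.
rewrite -/(nbr G x0).
(* A loop at [x0] only adds a nonnegative summand to [Dconst]. *)
case: (boolP (x0 \in nbr G x0)) => x0n.
  by rewrite [leRHS](big_fsetD1 x0) //= lerDr mulr_ge0 ?powR_ge0.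
rewrite [X in X <= _](_ : _ = \sum_(x <- nbr G x0) (deg G x0 / 2) `^ (r / 2) * (mu x)^-1 `^ (r / 2 - 1)) //.
apply: big_fset_incl; first exact: fsubD1set.
move=> x xn; rewrite !inE xn andbT negbK => /eqP xE; by rewrite xE (negPf x0n) in xn.
Qed.

Lemma msum_ray (f : V -> R) : (forall x, x != x0 -> f x = 0) ->
  msum mu D0 f = f x0 * mu x0.
Proof.
move=> hf; rewrite /msum (big_fsetD1 x0) /=; last by rewrite !inE eqxx.
rewrite big1_seq ?addr0 // => y /=; rewrite !inE => /andP[yx _].
by rewrite hf // mul0r.
Qed.

Lemma Phi_ray (s : R) : 0 <= s -> PHI D0 (ray s) (ray s) =
  p^-1 * (s `^ p * peak p h1) + q^-1 * (s `^ q * peak q h2)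
  - F x0 s s * mu x0 - lambda * (s * ((e1 x0 + e2 x0) * mu x0)).
Proof.
move=> s0; have sx : single x0 x0 = 1 by rewrite /single eqxx.
have sx' x : x != x0 -> single x0 x = 0 by rewrite /single => /negPf ->.
have P r h : 2 <= r -> msum mu D0 (dens G mu r h (ray s)) = s `^ r * peak r h.
  move=> r2; rewrite /peak -msumZ; apply: msum_eq => x.
  by rewrite dens_scale // ger0_norm.
rewrite /PHI /Phi !P // !msum_ray; last first.
- by move=> x /sx' e; rewrite /ray e mulr0 F00.
- by move=> x /sx' e; rewrite /ray e !mulr0.
- by move=> x /sx' e; rewrite /ray e !mulr0.
by rewrite /ray sx !mulr1; ring.
Qed.

Lemma Nsum_ray (s : R) : 0 <= s ->
  NS D0 (ray s) (ray s) = s * (peak p h1 `^ p^-1 + peak q h2 `^ q^-1).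
Proof.
move=> s0.
have P r h : 2 <= r -> (forall x, 0 <= h x) -> msum mu D0 (dens G mu r h (ray s)) `^ r^-1 = s * peak r h `^ r^-1.
  move=> r2 hh; have -> : msum mu D0 (dens G mu r h (ray s)) = s `^ r * peak r h.
    by rewrite /peak -msumZ; apply: msum_eq => x; rewrite dens_scale // ger0_norm.
  rewrite powRM ?powR_ge0 //; last by apply: msum_ge0 => // x; apply: dens_ge0.
  by rewrite -powRrM mulfV ?powRr1 //; apply/eqP; lra.
by rewrite /NS /Nsum !P // mulrDr.
Qed.

Lemma ray_supp K (s : R) b x : (true, x0) \in K -> (false, x0) \in K ->
  (b, x) \notin K -> ray s x = 0.
Proof.
move=> tK fK; rewrite /ray /single; case: eqP => [->|_ _]; last by rewrite mulr0.
by case: b; rewrite ?tK ?fK.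
Qed.

Lemma Phi_ray_clos K (s : R) : (true, x0) \in K -> (false, x0) \in K ->
  PHI (clos G K) (ray s) (ray s) = PHI D0 (ray s) (ray s).
Proof.
move=> tK fK; pose K0 : {fset (bool * V)} := [fset (true, x0); (false, x0)]%fset.
have s1 x : (true, x) \notin K0 -> ray s x = 0 by apply: ray_supp; rewrite !inE eqxx ?orbT.
have s2 x : (false, x) \notin K0 -> ray s x = 0 by apply: ray_supp; rewrite !inE eqxx ?orbT.
have c0 : clos G K0 = D0.
  apply/eqP; rewrite eqEfsubset; apply/andP; split; last first.
    by apply: (clos_sub G K0 true); rewrite !inE eqxx.
  by apply/bigfcupsP => -[b x]; rewrite !inE => /orP[] /eqP[_ ->].
rewrite -c0; apply: Phi_clos => //; rewrite c0; exact: (clos_sub G K true).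
Qed.

Lemma Nsum_ray_clos K (s : R) : (true, x0) \in K -> (false, x0) \in K ->
  NS (clos G K) (ray s) (ray s) = NS D0 (ray s) (ray s).
Proof.
move=> tK fK; pose K0 : {fset (bool * V)} := [fset (true, x0); (false, x0)]%fset.
have s1 x : (true, x) \notin K0 -> ray s x = 0 by apply: ray_supp; rewrite !inE eqxx ?orbT.
have s2 x : (false, x) \notin K0 -> ray s x = 0 by apply: ray_supp; rewrite !inE eqxx ?orbT.
have c0 : clos G K0 = D0.
  apply/eqP; rewrite eqEfsubset; apply/andP; split; last first.
    by apply: (clos_sub G K0 true); rewrite !inE eqxx.
  by apply/bigfcupsP => -[b x]; rewrite !inE => /orP[] /eqP[_ ->].
have sub : (D0 `<=` clos G K)%fset by exact: (clos_sub G K true).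
rewrite /NS /Nsum; congr (_ `^ _ + _ `^ _); apply: msum_supp => // x; rewrite -c0 => xK.
- exact: (dens_clos G mu mugt0 K0 p h1 _ true).
- exact: (dens_clos G mu mugt0 K0 q h2 _ false).
Qed.

Lemma ray_cvg (s : R) x : ray t x @[t --> s] --> ray s x.
Proof. by apply: cvgMr_tmp; exact: cvg_id. Qed.

(** The energy on the ray involves only [x0] and its neighbours, so this bound on the minimax level
    is the same for all [K]. *)
Lemma Phi_ray_bounded (s : R) : 0 <= s ->
  exists L : R, forall t, 0 <= t <= 1 -> PHI D0 (ray (t * s)) (ray (t * s)) <= L.
Proof.
move=> s0; have c : continuous (fun t : R => PHI D0 (ray t) (ray t)).
  by move=> t; apply: Phi_cvg => // x; exact: ray_cvg.
have [m _ hm] := @EVT_max R _ 0 s s0 (continuous_subspaceT c).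
exists (PHI D0 (ray m) (ray m)) => t /andP[t0 t1]; apply: hm.
by rewrite in_itv /= mulr_ge0 // ler_piMl.
Qed.

End Dir.

(** * The energy in coordinates on a fixed finite set *)

Section OnK.
Variable K : {fset (bool * V)}.
Local Notation X := 'rV[R]_(size (enum_fset K)).
Let U (w : X) : V -> R := emb K w true.
Let W (w : X) : V -> R := emb K w false.
Let phiK (w : X) : R := PHI (clos G K) (U w) (W w).
Let DK (w w' : X) : R := DPHI (clos G K) (U w) (W w) (U w') (W w').
Let NK (w : X) : R := NS (clos G K) (U w) (W w).

Lemma coord_rV (w : X) : w = \sum_(i < size (enum_fset K)) w 0 i *: delta_mx 0 i.
Proof. exact: row_sum_delta. Qed.

Let embE (a : R) (w w' : X) b : emb K (a *: w + w') b = fun x => a * emb K w b x + emb K w' b x.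
Proof. by apply/funext => x; rewrite emb_lin. Qed.

Let embE' (s : R) (w w' : X) b : emb K (w + s *: w') b = fun x => emb K w b x + s * emb K w' b x.
Proof. by apply/funext => x; rewrite addrC emb_lin addrC. Qed.

Lemma phiK_cont : continuous phiK.
Proof. by move=> w; apply: Phi_cvg => //; [exact: nbhs_filter|move=> x; exact: emb_cont|move=> x; exact: emb_cont]. Qed.

Lemma DK_lin (u : X) (a : R) (w w' : X) : DK u (a *: w + w') = a * DK u w + DK u w'.
Proof. by rewrite /DK /U /W !embE; exact: dPhi_lin. Qed.

Lemma DK_cont (w' : X) : continuous (DK^~ w').
Proof. by move=> w; apply: dPhi_cvg => //; [exact: nbhs_filter|move=> x; exact: emb_cont|move=> x; exact: emb_cont]. Qed.

Lemma phiK_der (u w : X) (s : R) : is_derive s 1 (fun r : R => phiK (u + r *: w)) (DK (u + s *: w) w).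
Proof.
apply: is_derive_translate.
have -> : (fun h : R => phiK (u + (s + h) *: w)) = (fun h : R => PHI (clos G K)
    (fun x => U (u + s *: w) x + h * U w x) (fun x => W (u + s *: w) x + h * W w x)).
  by apply/funext => h; rewrite /phiK /U /W scalerDl addrA !embE'.
exact: Phi_derive.
Qed.

Lemma NK_cont : continuous NK.
Proof.
have P r h b : 2 <= r -> (forall x, 0 <= h x) ->
    continuous (fun w : X => msum mu (clos G K) (dens G mu r h (emb K w b)) `^ r^-1).
  move=> r2 hh w; apply: cvg_powR.
  - exact: nbhs_filter.
  - by rewrite invr_ge0; lra.
  - by move=> w'; apply: msum_ge0 => // x; apply: dens_ge0.
  - by apply: msum_ge0 => // x; apply: dens_ge0.
  - apply: (@cvg_seq_sum R X (nbhs w)) => x.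
    apply: cvgMr_tmp; apply: dens_cvg => // y; exact: emb_cont.
by move=> w; apply: (@cvgD _ _ _ (nbhs w) (nbhs_filter w)); [exact: (P p h1 true)|exact: (P q h2 false)].
Qed.

Lemma NK0 : NK 0 = 0.
Proof.
have P r h b : 2 <= r -> msum mu (clos G K) (dens G mu r h (emb K 0 b)) `^ r^-1 = 0.
  move=> r2; rewrite msum_supp0 ?powR0 //; first by rewrite invr_eq0; apply/eqP; lra.
  by move=> x _; apply: dens_supp => //; [|move=> y _]; rewrite emb0.
by rewrite /NK /NS /Nsum /U /W !P // addr0.
Qed.

Lemma phiK0 : phiK 0 = 0.
Proof.
have P r h b : 2 <= r -> msum mu (clos G K) (dens G mu r h (emb K 0 b)) = 0.
  move=> r2; apply: msum_supp0 => x _.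
  by apply: dens_supp => //; [|move=> y _]; rewrite emb0.
rewrite /phiK /PHI /Phi /U /W !P // !msum_supp0 ?mulr0 ?subr0 ?addr0 //;
  by move=> x _; rewrite !emb0 ?F00 ?mulr0.
Qed.

Lemma critical_emb (w : X) : (forall w', DK w w' = 0) -> critical K (U w) (W w).
Proof.
move=> h; split; [by move=> x; exact: emb_supp|by move=> x; exact: emb_supp|].
move=> f g fs gs.
have [|w' hw'] := @emb_surj R V K (fun b x => if b then f x else g x).
  by case=> x; [exact: fs|exact: gs].
have -> : f = U w' by apply/funext => x; rewrite /U hw'.
have -> : g = W w' by apply/funext => x; rewrite /W hw'.
exact: h.
Qed.

Lemma ray_emb (x0 : V) : (true, x0) \in K -> (false, x0) \in K ->
  exists e : X, forall (s : R) b, emb K (s *: e) b = (fun x => s * single x0 x).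
Proof.
move=> tK fK; have [|e he] := @emb_surj R V K (fun=> single x0).
  move=> b x; rewrite /single; case: eqP => [->|//].
  by case: b; rewrite ?tK ?fK.
exists e => s b; apply/funext => x.
by have := emb_lin K s e 0 b x; rewrite addr0 emb0 addr0 he.
Qed.

End OnK.

(** * Critical points with bounds independent of the finite set *)

Section Existence.
Variable l0 : R.
Hypothesis l0_gt0 : 0 < l0.
Hypothesis C1 : forall x (s t : R), euclid s t < l0 ->
  `|partial_s F x s t|
    <= h0 / (q + 1) * (`|s| `^ (p - 1) + `|t| `^ ((p * q - q) / p)) /\
  `|partial_t F x s t|
    <= h0 / (q + 1) * (`|s| `^ p + `|t| `^ (q - 1)).
Hypothesis lambda_range : 0 < lambda < lambda0 mu p q h0 mu0 l0 e1 e2.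

Let rho := Lambda0 p q h0 mu0 l0.
Let lambda_gt0 : 0 < lambda. Proof. by have /andP[] := lambda_range. Qed.
Let rho0 : 0 < rho. Proof. exact: rho_gt0. Qed.
Let kp := h0 `^ p^-1 * mu0 `^ p^-1.
Let kq := h0 `^ q^-1 * mu0 `^ q^-1.
Let kp0 : 0 < kp. Proof. by rewrite mulr_gt0 ?powR_gt0. Qed.
Let kq0 : 0 < kq. Proof. by rewrite mulr_gt0 ?powR_gt0. Qed.
Let al := barrier_height mu mu0 p q e1 e2 lambda h0 l0.
Let al0 : 0 < al. Proof. exact: (barrier_gt0 _ _ mu0_gt0 _ _ _ _ _ p2 q2). Qed.

Let msum_du_ge0 D u : 0 <= msum mu D (du u).
Proof. exact: (msum_dens_ge0 G mu mu0 mu0_gt0 mu_ge p h0 h1 h0_gt0 h1_ge). Qed.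

Let msum_dv_ge0 D v : 0 <= msum mu D (dv v).
Proof. exact: (msum_dens_ge0 G mu mu0 mu0_gt0 mu_ge q h0 h2 h0_gt0 h2_ge). Qed.

Let NS_ge D u v x : x \in D -> kp * `|u x| <= NS D u v /\ kq * `|v x| <= NS D u v.
Proof.
move=> xD; split.
  apply: (le_trans (sup_le_root G mu mu0 mu0_gt0 mu_ge p h0 h1 p2 h0_gt0 h1_ge D u x xD)).
  by rewrite /NS /Nsum lerDl powR_ge0.
apply: (le_trans (sup_le_root G mu mu0 mu0_gt0 mu_ge q h0 h2 q2 h0_gt0 h2_ge D v x xD)).
by rewrite /NS /Nsum lerDr powR_ge0.
Qed.

(** Every constant is fixed before [K]: the barrier height bounds the level below, [L0] bounds it
    above, and [AR_coercive] at a critical point of level at most [L0] gives [B]. *)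
Theorem galerkin_mountain_pass (x3 : V) (l1 M nu A : R) :
  0 < l1 -> 0 < e1 x3 + e2 x3 ->
  (forall s : R, l1 < s -> M * (s `^ p + s `^ q) <= F x3 s s) ->
  Num.max ((Dconst G mu p x3 + mu x3 * h1 x3) / (p * mu x3))
          ((Dconst G mu q x3 + mu x3 * h2 x3) / (q * mu x3)) < M ->
  Num.max p q < nu -> 0 <= A -> A < Num.min (nu / p - 1) (nu / q - 1) * h0 ->
  (forall x (s t : R), nu * F x s t - partial_s F x s t * s - partial_t F x s t * t
      <= A * (`|s| `^ p + `|t| `^ q)) ->
  exists (a B : R), 0 < a /\ forall K, (true, x3) \in K -> (false, x3) \in K ->
    exists u v, [/\ critical K u v, a <= PHI (clos G K) u v &
      msum mu (clos G K) (du u) + msum mu (clos G K) (dv v) <= B].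
Proof.
move=> l10 ex3 FM MM nu_gt A0 A_lt C3.
have pp := p2; have qq := q2; have hh := h0_gt0; have mm := mu0_gt0.
have n2 : 2 <= nu by exact: (nu_ge2 p q p2 nu nu_gt).
have k0 : 0 < kappa p q h0 nu A by exact: kappa_gt0.
have AR := AR_coercive G mu mu0 mu0_gt0 mu_ge p q h1 h2 F e1 e2 lambda p2 q2 e1L e2L
  h0 h0_gt0 H1 (ltW lambda_gt0) nu A nu_gt A0 A_lt C3.
move: k0 AR.
set k := kappa _ _ _ _ _; move: (slack _ _ _ _ _ _ _ _ _) => sl k0 AR; clearbody k.
have [B1 [rk0 hB1]] : exists B1 : R, 0 < B1 /\ forall z, B1 < z -> rho < kp * z.
  by exists (rho / kp); split; [exact: divr_gt0|move=> z; rewrite ltr_pdivrMr // mulrC].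
(* Beyond [l1] for (C2), and beyond [B1] so that the far point lies outside the sphere. *)
pose s0 := l1 + 1 + B1.
have s0l : l1 < s0 by rewrite /s0; lra.
have s00 : 0 <= s0 by rewrite /s0; lra.
have [L0 hL0] := Phi_ray_bounded x3 s0 s00.
(* By [peak_le], the threshold for [M] in (C2) makes M mu(x3) s0^p and M mu(x3) s0^q dominate the
   two norm terms; the linear term only lowers the energy since e1(x3) + e2(x3) > 0. *)
have neg : PHI (x3 |` nbr G x3)%fset (fun x => s0 * single x3 x) (fun x => s0 * single x3 x) <= 0.
  rewrite Phi_ray //.
  have pk1 := peak_le x3 p h1 p2 h1_ge0; have pk2 := peak_le x3 q h2 q2 h2_ge0.
  have [M1 M2] : (Dconst G mu p x3 + mu x3 * h1 x3) / (p * mu x3) < M /\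
      (Dconst G mu q x3 + mu x3 * h2 x3) / (q * mu x3) < M.
    by move: MM; rewrite gt_max => /andP.
  have m3 := mugt0 x3.
  have p0 : 0 < p by lra.
  have q0 : 0 < q by lra.
  rewrite ltr_pdivrMr ?mulr_gt0 // in M1.
  rewrite ltr_pdivrMr ?mulr_gt0 // in M2.
  have t1 : p^-1 * (s0 `^ p * peak x3 p h1) <= s0 `^ p * (M * mu x3).
    rewrite mulrCA; apply: ler_wpM2l; first exact: powR_ge0.
    rewrite mulrC ler_pdivrMr //.
    by apply: (le_trans pk1); rewrite -mulrA [mu x3 * p]mulrC; exact: ltW.
  have t2 : q^-1 * (s0 `^ q * peak x3 q h2) <= s0 `^ q * (M * mu x3).
    rewrite mulrCA; apply: ler_wpM2l; first exact: powR_ge0.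
    rewrite mulrC ler_pdivrMr //.
    by apply: (le_trans pk2); rewrite -mulrA [mu x3 * q]mulrC; exact: ltW.
  have t3 := ler_wpM2r (ltW m3) (FM s0 s0l).
  have t4 : 0 <= lambda * (s0 * ((e1 x3 + e2 x3) * mu x3)).
    by apply: mulr_ge0; [exact: ltW|apply: mulr_ge0 => //; apply: mulr_ge0; exact: ltW].
  move: t1 t2 t3 t4; move: (s0 `^ p) (s0 `^ q) => a b t1 t2 t3 t4; lra.
(* The deformation accepts levels up to [L - 2]. The radius [T] is made for [rad]: a coordinate of
   size at least [T >= 1] adds h0 mu0 T or more to the densities, which in [AR_coercive] outweighs
   nu L and the slack. *)
pose L := L0 + 2.
pose T := Num.max 1 ((2 * (nu * L / k + sl)) / (h0 * mu0)).
have T1 : 1 <= T by rewrite le_max lexx.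
have T2 : 2 * (nu * L / k + sl) <= h0 * mu0 * T.
  have hm : 0 < h0 * mu0 by rewrite mulr_gt0.
  have : (2 * (nu * L / k + sl)) / (h0 * mu0) <= T by rewrite le_max lexx orbT.
  by rewrite ler_pdivrMr // [T * _]mulrC.
clearbody T.
exists al; exists (2 * (nu * L0 / k + sl)); split => // K tK fK.
have [e he] := ray_emb K x3 tK fK.
have T0 : 0 < T by lra.
have n1 : 1 <= nu by lra.
have rad : forall w : 'rV[R]_(size (enum_fset K)), T <= `|w| ->
    DPHI (clos G K) (emb K w true) (emb K w false) (emb K w true) (emb K w false)
    <= nu * (PHI (clos G K) (emb K w true) (emb K w false) - L).
  move=> w Tw; have := AR (clos G K) (emb K w true) (emb K w false).
  rewrite -/du -/dv -/PHI -/DPHI.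
  set a := msum _ _ _; set b := msum _ _ _.
  have big : 2 * (nu * L / k + sl) <= a + b.
    apply: (le_trans T2).
    have [b0 [x [bxK Tx]]] : exists b0 x, (b0, x) \in K /\ T <= `|emb K w b0 x|.
      apply: contrapT => nex; suff : `|w| < T by rewrite ltNge Tw.
      apply: emb_norm_lt => // b0 x bx; rewrite ltNge; apply/negP => Tx.
      by apply: nex; exists b0, x.
    have xc := clos_mem G K b0 x bxK.
    have hm : 0 <= h0 * mu0 by apply: mulr_ge0; exact: ltW.
    have le_r (r : R) : 2 <= r -> h0 * mu0 * T <= h0 * mu0 * `|emb K w b0 x| `^ r.
      move=> r2; apply: ler_wpM2l => //; apply: (le_trans Tx).
      by apply: le1r_powR; lra.
    case: b0 Tx bxK le_r => Tx bxK le_r.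
      apply: (le_trans (le_r p p2)).
      apply: (le_trans (dens_sup G mu mu0 mu0_gt0 mu_ge p h0 h1 h0_gt0 h1_ge _ _ _ xc)).
      by rewrite lerDl; exact: msum_dv_ge0.
    apply: (le_trans (le_r q q2)).
    apply: (le_trans (dens_sup G mu mu0 mu0_gt0 mu_ge q h0 h2 h0_gt0 h2_ge _ _ _ xc)).
    by rewrite lerDr; exact: msum_du_ge0.
  move: big; clearbody a b => big.
  have k2 : 0 <= k / 2 by apply: divr_ge0; [exact: ltW|].
  have := ler_wpM2l k2 big.
  have -> : k / 2 * (2 * (nu * L / k + sl)) = nu * L + k * sl by field; rewrite gt_eqF.
  move: (DPHI _ _ _ _ _) (PHI _ _ _) => d f.
  rewrite mulrBr; move: (nu * L) (k * sl) (k / 2 * _) (nu * f) => x y z t; lra.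
have ray1 : emb K (s0 *: e) true = fun x => s0 * single x3 x by exact: he.
have ray2 : emb K (s0 *: e) false = fun x => s0 * single x3 x by exact: he.
have phi00 := phiK0 K; have NK00 := NK0 K.
have [||||||||w [wc wa wL]] := mountain_pass (delta_mx 0) (fun w i => w 0 i) (@coord_rV K)
  (@bounded_closed_compact R _) _ _ (phiK_cont K) (DK_lin K) (DK_cont K) (phiK_der K)
  T L nu T0 n1 rad (fun w => NS (clos G K) (emb K w true) (emb K w false)) (s0 *: e) rho al L0
  (NK_cont K).
- by rewrite NK00.
- rewrite ray1 ray2.
  have xc := clos_mem G K true x3 tK.
  have [+ _] := NS_ge (clos G K) (fun x => s0 * single x3 x) (fun x => s0 * single x3 x) x3 xc.
  rewrite /single eqxx mulr1 (ger0_norm s00); apply: lt_le_trans.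
  by apply: hB1; rewrite /s0; lra.
- by [].
- move=> w Nw; apply: (barrier G mu mu0 mu0_gt0 mu_ge p q h1 h2 F e1 e2 lambda p2 q2 e1L e2L h0 h0_gt0 H1 F_C1 F00 (ltW lambda_gt0) l0 l0_gt0 C1).
  exact: Nw.
- by rewrite phi00.
- by rewrite ray1 ray2 Phi_ray_clos.
- by rewrite /L; lra.
- by move=> t tt; rewrite scalerA !he Phi_ray_clos //; exact: hL0.
exists (emb K w true), (emb K w false); split => //; first exact: critical_emb.
have := AR (clos G K) (emb K w true) (emb K w false).
rewrite -/du -/dv -/PHI -/DPHI wc subr0.
set a := msum _ _ (du _); set b := msum _ _ (dv _); clearbody a b => ab.
have : nu * PHI (clos G K) (emb K w true) (emb K w false) <= nu * L0.
  by apply: ler_wpM2l => //; lra.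
move=> nL; have {}ab : k / 2 * (a + b) <= nu * L0 + k * sl by lra.
have k2 : 0 < k / 2 by apply: divr_gt0.
rewrite -(ler_pM2l k2); apply: (le_trans ab).
rewrite le_eqVlt; apply/orP; left; apply/eqP; field; by rewrite gt_eqF.
Qed.

(** On the ray of [x4] the linear term is of first order, while the norms and the loss allowed by
    (C4) are of higher order. So the energy is negative at some small point of the ball, at a level
    that does not depend on [K]. *)
Theorem galerkin_minimum (x4 : V) (l2 beta3 K3 : R) :
  0 < l2 -> 1 < beta3 -> 0 < e1 x4 + e2 x4 -> 0 < K3 ->
  (forall s : R, 0 < s < l2 -> - K3 * `|s| `^ beta3 <= F x4 s s) ->
  exists (c B : R), c < 0 /\ forall K, (true, x4) \in K -> (false, x4) \in K ->
    exists u v, [/\ critical K u v, PHI (clos G K) u v <= c &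
      msum mu (clos G K) (du u) + msum mu (clos G K) (dv v) <= B].
Proof.
move=> l20 b1 ex4 K30 FK.
have pp := p2; have qq := q2; have hh := h0_gt0; have mm := mu0_gt0; have m4 := mugt0 x4.
have lg := lambda_gt0.
have P1 : 0 <= peak x4 p h1 by apply: msum_du_ge0.
have P2 : 0 <= peak x4 q h2 by apply: msum_dv_ge0.
(* p, q and beta3 are all at least 1 + g, so for s <= 1 each unfavourable power is at most s s^g. *)
pose g := Num.min 1 (beta3 - 1).
have g0 : 0 < g by rewrite lt_min ltr01 subr_gt0.
pose C := p^-1 * peak x4 p h1 + q^-1 * peak x4 q h2 + K3 * mu x4.
have C0 : 0 <= C.
  apply: addr_ge0; last by apply: mulr_ge0; exact: ltW.
  by apply: addr_ge0; apply: mulr_ge0 => //; rewrite invr_ge0; lra.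
pose E := lambda * ((e1 x4 + e2 x4) * mu x4).
have E0 : 0 < E by apply: mulr_gt0 => //; apply: mulr_gt0.
pose N4 := peak x4 p h1 `^ p^-1 + peak x4 q h2 `^ q^-1.
have N40 : 0 <= N4 by apply: addr_ge0; exact: powR_ge0.
pose s1 := (E / (2 * (C + 1))) `^ g^-1.
have Ed : 0 < E / (2 * (C + 1)) by apply: divr_gt0 => //; lra.
have s10 : 0 < s1 by exact: powR_gt0.
(* The four entries give s <= 1, the range of (C4), C s^g < E, and a point inside the ball. *)
pose s := Num.min (Num.min 1 (l2 / 2)) (Num.min s1 (rho / (N4 + 1))).
have rN : 0 < rho / (N4 + 1) by apply: divr_gt0 => //; lra.
have s0 : 0 < s by rewrite !lt_min ltr01 s10 rN !andbT /=; lra.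
have sle1 : s <= 1 by rewrite !ge_min lexx.
have sl2 : s <= l2 / 2 by rewrite !ge_min lexx orbT.
have ss1 : s <= s1 by rewrite !ge_min lexx !orbT.
have srN : s <= rho / (N4 + 1) by rewrite !ge_min lexx !orbT.
clearbody s.
have pw (r : R) : 1 + g <= r -> s `^ r <= s * s `^ g.
  move=> hr; have -> : r = 1 + (r - 1) by ring.
  rewrite powRD ?(gt_eqF s0) ?implybT // powRr1 ?(ltW s0) //.
  apply: ler_wpM2l; first exact: ltW.
  by apply: ger_powR; [rewrite s0 sle1|lra].
have sg : s `^ g <= E / (2 * (C + 1)).
  have -> : E / (2 * (C + 1)) = s1 `^ g.
    by rewrite /s1 -powRrM mulVf ?gt_eqF // powRr1 // ltW.
  by apply: ge0_ler_powR; rewrite ?nnegrE // ltW.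
have gle1 : g <= 1 by rewrite ge_min lexx.
have gleb : g <= beta3 - 1 by rewrite ge_min lexx orbT.
pose c := PHI (x4 |` nbr G x4)%fset (fun x => s * single x4 x) (fun x => s * single x4 x).
have c0 : c < 0.
  rewrite /c Phi_ray; last exact: ltW.
  have Fs : - (F x4 s s) <= K3 * (s * s `^ g).
    have := FK s; rewrite s0 (_ : s < l2); last lra.
    move=> /(_ isT); rewrite (gtr0_norm s0) => h.
    have : K3 * s `^ beta3 <= K3 * (s * s `^ g) by apply: ler_wpM2l; [exact: ltW|apply: pw; lra].
    lra.
  have a1 : p^-1 * (s `^ p * peak x4 p h1) <= s * s `^ g * (p^-1 * peak x4 p h1).
    rewrite mulrCA; apply: ler_wpM2r; first by apply: mulr_ge0 => //; rewrite invr_ge0; lra.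
    by apply: pw; lra.
  have a2 : q^-1 * (s `^ q * peak x4 q h2) <= s * s `^ g * (q^-1 * peak x4 q h2).
    rewrite mulrCA; apply: ler_wpM2r; first by apply: mulr_ge0 => //; rewrite invr_ge0; lra.
    by apply: pw; lra.
  have a3 := ler_wpM2r (ltW m4) Fs.
  have a4 : s * s `^ g * C <= s * (E / (2 * (C + 1))) * C.
    by apply: ler_wpM2r => //; apply: ler_wpM2l => //; exact: ltW.
  have a5 : s * (E / (2 * (C + 1))) * C < s * E.
    rewrite -mulrA ltr_pM2l // mulrAC ltr_pdivrMr; last lra.
    by rewrite ltr_pM2l //; lra.
  have a6 : lambda * (s * ((e1 x4 + e2 x4) * mu x4)) = s * E by rewrite /E mulrCA.
  rewrite a6; move: a1 a2 a3 a4 a5; rewrite {1}/C.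
  move: (s `^ p) (s `^ q) (s `^ g) => x y z a1 a2 a3 a4 a5; lra.
(* In the ball both norms are at most rho <= 1, so each sum of densities is at most 1. *)
exists c, 2; split => // K tK fK.
have [e he] := ray_emb K x4 tK fK.
have e1' : emb K (s *: e) true = fun x => s * single x4 x by exact: he.
have e2' : emb K (s *: e) false = fun x => s * single x4 x by exact: he.
have NK00 := NK0 K.
have bnd (k : R) : 0 < k -> exists B : R, 0 < B /\ forall z, k * z <= rho -> z <= B.
  by move=> k0; exists (rho / k); split; [exact: divr_gt0|move=> z; rewrite ler_pdivlMr // mulrC].
have [B1 [B10 hB1]] := bnd kp kp0.
have [B2 [B20 hB2]] := bnd kq kq0.
have [|||||w [wc wN wP]] := constrained_min (@bounded_closed_compact R _) _ _ (phiK_cont K)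
  (phiK_der K) (fun w => NS (clos G K) (emb K w true) (emb K w false)) (s *: e) rho
  (B1 + B2 + 1) (NK_cont K).
- by rewrite NK00 ltW.
- rewrite e1' e2' Nsum_ray_clos // Nsum_ray; last exact: ltW.
  rewrite -/N4; apply: (@le_trans _ _ (s * (N4 + 1))); first by apply: ler_wpM2l; [exact: ltW|lra].
  by rewrite -ler_pdivlMr //; lra.
- move=> w Nw; apply: ltW; apply: emb_norm_lt; first by rewrite !addr_gt0.
  move=> b x bx; have xc := clos_mem G K b x bx.
  have [A1 A2] := NS_ge (clos G K) (emb K w true) (emb K w false) x xc.
  case: b bx => _.
    by apply: (le_lt_trans (hB1 _ (le_trans A1 Nw))); rewrite -addrA ltrDl addr_gt0.
  by apply: (le_lt_trans (hB2 _ (le_trans A2 Nw))); rewrite addrAC ltrDr addr_gt0.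
- move=> w Nw; apply: (lt_le_trans al0).
  by apply: (barrier G mu mu0 mu0_gt0 mu_ge p q h1 h2 F e1 e2 lambda p2 q2 e1L e2L h0 h0_gt0 H1 F_C1 F00 (ltW lambda_gt0) l0 l0_gt0 C1).
- by rewrite e1' e2' Phi_ray_clos.
exists (emb K w true), (emb K w false); split.
- exact: critical_emb.
- by apply: (le_trans wP); rewrite e1' e2' Phi_ray_clos.
- have r1 := rho_le1 mu0 p q h0 l0.
  have ap := powR_ge0 (msum mu (clos G K) (du (emb K w true))) p^-1.
  have bq := powR_ge0 (msum mu (clos G K) (dv (emb K w false))) q^-1.
  move: wN; rewrite /NS /Nsum -/du -/dv => wN.
  have Y1 : msum mu (clos G K) (du (emb K w true)) <= 1.
    apply: (root_le1 R p _ p2 (msum_du_ge0 _ _)).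
    apply: le_trans r1; apply: le_trans wN; rewrite lerDl; exact: bq.
  have Y2 : msum mu (clos G K) (dv (emb K w false)) <= 1.
    apply: (root_le1 R q _ q2 (msum_dv_ge0 _ _)).
    apply: le_trans r1; apply: le_trans wN; rewrite lerDr; exact: ap.
  exact: (lerD Y1 Y2).
Qed.

End Existence.
End Galerkin.


(** * Passage to the limit *)

(** The limit is the supremum of the eventual lower bounds; for each level an ultrafilter decides on
    which side [f] eventually lies. *)
Lemma ultra_bounded_cvg (R : realType) (I : Type) (U : set_system I) (f : I -> R) (C : R) :
  UltraFilter U -> (\forall i \near U, `|f i| <= C) -> exists l : R, f @ U --> l.
Proof.
move=> UU fC; have PU : ProperFilter U by exact: ultra_proper.
pose S := [set r : R | \forall i \near U, r <= f i].
have S0 : S (- C) by apply: filterS fC => i; rewrite ler_norml => /andP[].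
have SC r : S r -> r <= C.
  move=> Sr; have [i [/= ri fi]] := filter_ex (filterI Sr fC).
  by apply: (le_trans ri); apply: (le_trans (ler_norm _)).
have Ssup : has_sup S by split; [exists (- C)|exists C].
exists (sup S); apply/cvgrPdist_lt => e e0.
have [r Sr hr] := sup_adherent e0 Ssup.
have [Se|nSe] := in_ultra_setVsetC [set i | sup S + e / 2 <= f i] UU.
  have : sup S + e / 2 <= sup S by apply: sup_upper_bound.
  lra.
apply: filterS2 Sr nSe => i /= ri /negP; rewrite -ltNge => fi.
rewrite ltr_norml; apply/andP; split; lra.
Qed.

Lemma cvg_eventually_eq0 (R : realType) (I : Type) (U : set_system I) (f : I -> R) (l : R) :
  ProperFilter U -> f @ U --> l -> (\forall i \near U, f i = 0) -> l = 0.
Proof.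
move=> PU fl f0; apply/eqP; rewrite eq_le; apply/andP; split.
  by apply: (cvg_le_bound _ _ U f l 0 PU fl); apply: filterS f0 => i ->.
rewrite -oppr_le0; apply: (cvg_le_bound _ _ U (fun i => - f i) (- l) 0 PU (cvgN fl)).
by apply: filterS f0 => i ->; rewrite oppr0.
Qed.

Section FinsetFilter.
Context {T : choiceType}.

(** An ultrafilter finer than this one makes all bounded quantities converge at once, without
    extraction of subsequences, and every fixed finite set is eventually included. *)
Definition supersets : set_system {fset T} :=
  [set A | exists K0, forall K : {fset T}, (K0 `<=` K)%fset -> A K].

Lemma supersets_proper : ProperFilter supersets.
Proof.
apply: Build_ProperFilter_ex.
  by move=> A [K0 hA]; exists K0; exact: hA.
split.
- by exists fset0.
- move=> A A' [K hA] [K' hA']; exists (K `|` K')%fset => L; rewrite fsubUset => /andP[? ?].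
  by split; [exact: hA|exact: hA'].
- by move=> A A' AA' [K hA]; exists K => L /hA/AA'.
Qed.

Lemma supersets_ultra : exists U : set_system {fset T},
  UltraFilter U /\ forall K0 : {fset T}, \forall K \near U, (K0 `<=` K)%fset.
Proof.
have [U [UU sU]] := ultraFilterLemma supersets_proper.
by exists U; split => // K0; apply: sU; exists K0.
Qed.

End FinsetFilter.

Section Limit.
Context {R : realType} {V : choiceType}.
Variables (G : weighted_graph R V) (mu : V -> R) (mu0 : R).
Hypotheses (mu0_gt0 : 0 < mu0) (mu_ge : forall x, mu0 <= mu x).
Variables (p q : R) (h1 h2 : V -> R) (F : V -> R -> R -> R) (e1 e2 : V -> R) (lambda : R).
Hypotheses (p2 : 2 <= p) (q2 : 2 <= q).
Hypotheses (e1L : in_Lr mu (p / (p - 1)) e1) (e2L : in_Lr mu (q / (q - 1)) e2).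
Variable h0 : R.
Hypotheses (h0_gt0 : 0 < h0) (H1 : forall x, h0 <= h1 x /\ h0 <= h2 x).
Hypothesis F_C1 : C1_in_st F.
Hypothesis F00 : forall x, F x 0 0 = 0.
Variables (a : R -> R) (b : V -> R).
Hypotheses (a_cont : {within `[0, +oo[%classic, continuous a})
  (a_ge0 : forall r : R, 0 <= r -> 0 <= a r) (b_ge0 : forall x, 0 <= b x) (bL : in_Lr mu 1 b).
Hypothesis Fab : forall x (s t : R),
  [/\ `|partial_s F x s t| <= a (euclid s t) * b x,
      `|partial_t F x s t| <= a (euclid s t) * b x &
      `|F x s t| <= a (euclid s t) * b x].

Let muge0 x : 0 <= mu x. Proof. exact/ltW/(mu_pos mu mu0). Qed.
Let mugt0 x : 0 < mu x. Proof. exact/(mu_pos mu mu0). Qed.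
Let h1_ge x : h0 <= h1 x. Proof. exact: (H1 x).1. Qed.
Let h2_ge x : h0 <= h2 x. Proof. exact: (H1 x).2. Qed.
Let h1_ge0 x : 0 <= h1 x. Proof. exact: le_trans (ltW h0_gt0) (h1_ge x). Qed.
Let h2_ge0 x : 0 <= h2 x. Proof. exact: le_trans (ltW h0_gt0) (h2_ge x). Qed.
Let p0 : 0 < p. Proof. by have := p2; lra. Qed.
Let q0 : 0 < q. Proof. by have := q2; lra. Qed.

Let du := dens G mu p h1.
Let dv := dens G mu q h2.
Let PHI := Phi G mu p q h1 h2 F e1 e2 lambda.
Let crit := critical G mu p q h1 h2 F e1 e2 lambda.
Let II (f : V -> R) : R := fine (vint mu f).

Lemma a_bound (C : R) : 0 <= C -> exists2 Ca : R, 0 <= Ca &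
  forall s t : R, `|s| <= C -> `|t| <= C -> a (euclid s t) <= Ca.
Proof.
move=> C0; have C20 : 0 <= 2 * C by lra.
have ac : {within `[0, 2 * C], continuous a}.
  apply: continuous_subspaceW a_cont => r /=; rewrite !in_itv /= andbT; by case/andP.
have [m mi hm] := EVT_max C20 ac.
exists (a m); first by apply: a_ge0; move: mi; rewrite in_itv /= => /andP[].
move=> s t hs ht; apply: hm; rewrite in_itv /= /euclid sqrtr_ge0 /=.
rewrite -(ger0_norm C20) -sqrtr_sqr ler_wsqrtr //.
have : s ^+ 2 <= C ^+ 2 by rewrite -(real_normK (num_real s)) ler_sqr ?nnegrE.
have : t ^+ 2 <= C ^+ 2 by rewrite -(real_normK (num_real t)) ler_sqr ?nnegrE.
have := sqr_ge0 C; rewrite exprMn; lra.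
Qed.

(* The integrand of the lower-order part of the derivative at [(u, v)] in the
   direction [(w, z)]. *)
Definition lower_order (u v w z : V -> R) (x : V) : R :=
  partial_s F x (u x) (v x) * w x + partial_t F x (u x) (v x) * z x
  + lambda * (e1 x * w x) + lambda * (e2 x * z x).

Lemma b_tail (e : R) : 0 < e -> exists A, small_off mu A b e.
Proof.
move=> e0; have [A hA] := Lr_tail mu muge0 b 1 ltr01 bL e e0.
exists A; apply: small_off_le hA => // x.
by rewrite powRr1 ?normr_ge0 // normr_id.
Qed.

Lemma dual_tail (r : R) (e : V -> R) (M d : R) : 2 <= r -> in_Lr mu (r / (r - 1)) e ->
  0 <= M -> 0 < d -> exists A, forall u : V -> R,
    (forall B, msum mu B (fun x => `|u x| `^ r) <= M) -> small_off mu A (fun x => e x * u x) d.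
Proof.
move=> r2 eL M0 d0.
have r0 : 0 < r by lra.
have r1 : 0 < r / (r - 1) by apply: divr_gt0; lra.
have rr1 : r^-1 + (r / (r - 1))^-1 = 1 by field; lra.
exact: (Lr_tail_mul mu muge0 r (r / (r - 1)) r0 r1 rr1 e eL M d M0 d0).
Qed.

(** One [A] serves all quadruples with these bounds: sup bounds reduce the nonlinear part to a
    multiple of [b], and the pairings with [e1] and [e2] have uniform tails on balls of L^p and
    L^q. *)
Lemma lower_order_tail (C M d : R) : 0 <= C -> 0 <= M -> 0 < d ->
  exists A, forall u v w z : V -> R,
    (forall x, `|u x| <= C) -> (forall x, `|v x| <= C) ->
    (forall x, `|w x| <= C) -> (forall x, `|z x| <= C) ->
    (forall B, msum mu B (fun x => `|w x| `^ p) <= M) ->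
    (forall B, msum mu B (fun x => `|z x| `^ q) <= M) ->
    small_off mu A (lower_order u v w z) d.
Proof.
move=> C0 M0 d0.
have [Ca Ca0 hCa] := a_bound C C0.
have l1 : 0 < `|lambda| + 1 by have := normr_ge0 lambda; lra.
pose cb := 2 * Ca * C + 1.
have cb0 : 0 < cb by rewrite /cb; have := mulr_ge0 Ca0 C0; lra.
have [A1 hA1] := b_tail (d / 3 / cb) ltac:(by rewrite !divr_gt0).
have [A2 hA2] := dual_tail p e1 M (d / 3 / (`|lambda| + 1)) p2 e1L M0 ltac:(by rewrite !divr_gt0).
have [A3 hA3] := dual_tail q e2 M (d / 3 / (`|lambda| + 1)) q2 e2L M0 ltac:(by rewrite !divr_gt0).
exists ((A1 `|` A2) `|` A3)%fset => u v w z uC vC wC zC wM zM.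
have s1 : small_off mu A1 (fun x => partial_s F x (u x) (v x) * w x + partial_t F x (u x) (v x) * z x) (d / 3).
  have := small_offZ mu A1 b _ cb hA1.
  rewrite gtr0_norm // mulrC divfK ?gt_eqF //.
  apply: small_off_le => // x; rewrite normrM (gtr0_norm cb0) (ger0_norm (b_ge0 x)).
  have [f1 f2 _] := Fab x (u x) (v x).
  have ha := hCa _ _ (uC x) (vC x).
  have hb : a (euclid (u x) (v x)) * b x <= Ca * b x by apply: ler_wpM2r.
  apply: (le_trans (ler_normD _ _)); rewrite !normrM.
  have t1 : `|partial_s F x (u x) (v x)| * `|w x| <= Ca * b x * C.
    by apply: ler_pM => //; exact: le_trans f1 hb.
  have t2 : `|partial_t F x (u x) (v x)| * `|z x| <= Ca * b x * C.
    by apply: ler_pM => //; exact: le_trans f2 hb.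
  rewrite /cb mulrDl mul1r; have := b_ge0 x; lra.
have sl A (e w' : V -> R) : small_off mu A (fun x => e x * w' x) (d / 3 / (`|lambda| + 1)) ->
    small_off mu A (fun x => lambda * (e x * w' x)) (d / 3).
  move=> hs; have := small_offZ mu A _ _ (`|lambda| + 1) hs.
  rewrite (gtr0_norm l1) mulrC divfK ?gt_eqF //.
  apply: small_off_le => // x; rewrite !normrM; apply: ler_wpM2r; first by rewrite mulr_ge0.
  by rewrite (gtr0_norm l1) lerDl.
have := small_offD mu muge0 _ _ _ _ _ _ (small_offD mu muge0 _ _ _ _ _ _ s1 (sl _ _ _ (hA2 w wM))) (sl _ _ _ (hA3 z zM)).
by have -> : d / 3 + d / 3 + d / 3 = d by field.
Qed.

Lemma densN (r : R) (h u v : V -> R) x : 2 <= r -> dens G mu r h (fun y => u y - v y) x =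
  dens G mu r h (fun y => v y - u y) x.
Proof.
move=> r2; have e : (fun y => u y - v y) = (fun y => -1 * (v y - u y)).
  by apply/funext => y; ring.
by rewrite e dens_scale // normrN1 powR1 mul1r.
Qed.

Lemma densB_le (r : R) (h u v : V -> R) x : 2 <= r -> (forall x, 0 <= h x) ->
  dens G mu r h (fun y => u y - v y) x <= 2 `^ r * (dens G mu r h u x + dens G mu r h v x).
Proof.
move=> r2 hh.
have := densD_le G mu mugt0 r h r2 hh u (fun y => -1 * v y) x.
rewrite [dens _ _ _ _ (fun y => -1 * v y) x]dens_scale // normrN1 powR1 mul1r.
by under [X in dens _ _ _ _ X _]funext do rewrite mulN1r.
Qed.

Lemma densB_split (r : R) (h u v : V -> R) x : 2 <= r -> (forall x, 0 <= h x) ->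
  dens G mu r h u x <= 2 `^ r * (dens G mu r h (fun y => u y - v y) x + dens G mu r h v x).
Proof.
move=> r2 hh.
have := densD_le G mu mugt0 r h r2 hh (fun y => u y - v y) v x.
by under [X in dens _ _ _ _ X _]funext do rewrite subrK.
Qed.

(** * Strong convergence along the ultrafilter, and its consequences *)

Section Net.
Variables (U : set_system {fset (bool * V)}) (x0 : V) (BB : R).
Hypothesis UU : UltraFilter U.
Hypothesis U_sup : forall K0, \forall K \near U, (K0 `<=` K)%fset.
Variables f g : {fset (bool * V)} -> V -> R.
Let good (K : {fset (bool * V)}) : Prop := (true, x0) \in K /\ (false, x0) \in K.
Hypothesis f_crit : forall K, good K -> crit K (f K) (g K).
Hypothesis f_bound : forall K, good K ->
  msum mu (clos G K) (du (f K)) + msum mu (clos G K) (dv (g K)) <= BB.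

Let PU : ProperFilter U := @ultra_proper _ _ UU.

Lemma near_good : \forall K \near U, good K.
Proof.
apply: filterS (U_sup [fset (true, x0); (false, x0)]%fset) => K /fsubsetP h.
by split; apply: h; rewrite !inE eqxx ?orbT.
Qed.

Let f_supp K x : good K -> (true, x) \notin K -> f K x = 0.
Proof. by move=> /f_crit[h _ _]; exact: h. Qed.
Let g_supp K x : good K -> (false, x) \notin K -> g K x = 0.
Proof. by move=> /f_crit[_ h _]; exact: h. Qed.

Let du0 D w : 0 <= msum mu D (du w).
Proof. exact: (msum_dens_ge0 G mu mu0 mu0_gt0 mu_ge p h0 h1 h0_gt0 h1_ge). Qed.
Let dv0 D w : 0 <= msum mu D (dv w).
Proof. exact: (msum_dens_ge0 G mu mu0 mu0_gt0 mu_ge q h0 h2 h0_gt0 h2_ge). Qed.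

Let BB0 : 0 <= BB.
Proof.
have [K gK] := filter_ex near_good.
by apply: le_trans (f_bound K gK); apply: addr_ge0; [exact: du0|exact: dv0].
Qed.

Let clos_notin b0 K x : x \notin clos G K -> (b0, x) \notin K.
Proof. by apply: contra => /clos_mem. Qed.

Let du_bound K D : good K -> msum mu D (du (f K)) <= BB.
Proof.
move=> gK; apply: le_trans (f_bound K gK).
apply: (@le_trans _ _ (msum mu (D `|` clos G K)%fset (du (f K)))).
  apply: msum_subset => //; [by move=> x; exact: dens_ge0|exact: fsubsetUl].
rewrite (msum_supp mu (clos G K)); last exact: fsubsetUr.
  by rewrite lerDl; exact: dv0.
by move=> x xK; apply: (dens_clos G mu mugt0 K p h1 _ true) => // y; exact: f_supp.
Qed.

Let dv_bound K D : good K -> msum mu D (dv (g K)) <= BB.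
Proof.
move=> gK; apply: le_trans (f_bound K gK).
apply: (@le_trans _ _ (msum mu (D `|` clos G K)%fset (dv (g K)))).
  apply: msum_subset => //; [by move=> x; exact: dens_ge0|exact: fsubsetUl].
rewrite (msum_supp mu (clos G K)); last exact: fsubsetUr.
  by rewrite lerDr; exact: du0.
by move=> x xK; apply: (dens_clos G mu mugt0 K q h2 _ false) => // y; exact: g_supp.
Qed.

Lemma sup_bound_of (r z : R) : 2 <= r -> h0 * mu0 * `|z| `^ r <= BB -> `|z| <= 1 + BB / (h0 * mu0).
Proof.
move=> r2; have hm : 0 < h0 * mu0 by rewrite mulr_gt0.
rewrite mulrC -ler_pdivlMr // => h.
have b0' : 0 <= BB / (h0 * mu0) by apply: divr_ge0 => //; exact: ltW.
have [z1|z1] := leP `|z| 1; first by apply: (le_trans z1); rewrite lerDl.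
apply: (@le_trans _ _ (`|z| `^ r)); first by apply: le1r_powR; [exact: ltW|lra].
by apply: (le_trans h); rewrite lerDr.
Qed.

Let CB : R := 1 + BB / (h0 * mu0).
Let CB0 : 0 <= CB.
Proof.
by apply: addr_ge0 => //; apply: divr_ge0 => //; apply: mulr_ge0; exact: ltW.
Qed.

Let f_sup K x : good K -> `|f K x| <= CB.
Proof.
move=> gK; apply: (sup_bound_of p) => //.
apply: (le_trans (dens_sup G mu mu0 mu0_gt0 mu_ge p h0 h1 h0_gt0 h1_ge [fset x]%fset (f K) x _)).
  by rewrite inE.
exact: du_bound.
Qed.

Let g_sup K x : good K -> `|g K x| <= CB.
Proof.
move=> gK; apply: (sup_bound_of q) => //.
apply: (le_trans (dens_sup G mu mu0 mu0_gt0 mu_ge q h0 h2 h0_gt0 h2_ge [fset x]%fset (g K) x _)).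
  by rewrite inE.
exact: dv_bound.
Qed.

Lemma pointwise_limits : exists u v : V -> R,
  (forall x, (fun K => f K x) @ U --> u x) /\ (forall x, (fun K => g K x) @ U --> v x).
Proof.
have /choice[u hu] : forall x, exists l : R, (fun K => f K x) @ U --> l.
  move=> x; apply: (ultra_bounded_cvg _ _ U _ CB) => //.
  by apply: filterS near_good => K; exact: f_sup.
have /choice[v hv] : forall x, exists l : R, (fun K => g K x) @ U --> l.
  move=> x; apply: (ultra_bounded_cvg _ _ U _ CB) => //.
  by apply: filterS near_good => K; exact: g_sup.
by exists u, v.
Qed.

Variables u v : V -> R.
Hypotheses (fu : forall x, (fun K => f K x) @ U --> u x)
  (gv : forall x, (fun K => g K x) @ U --> v x).

Let u_sup x : `|u x| <= CB.
Proof.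
apply: (cvg_le_bound _ _ U (fun K => `|f K x|) _ _ PU (cvg_norm (fu x))).
by apply: filterS near_good => K; exact: f_sup.
Qed.

Let v_sup x : `|v x| <= CB.
Proof.
apply: (cvg_le_bound _ _ U (fun K => `|g K x|) _ _ PU (cvg_norm (gv x))).
by apply: filterS near_good => K; exact: g_sup.
Qed.

Lemma du_limit_bound D : msum mu D (du u) <= BB.
Proof.
apply: (cvg_le_bound _ _ U (fun K => msum mu D (du (f K))) _ _ PU).
  by apply: (msum_cvg mu U D (fun K => du (f K))) => x; apply: dens_cvg.
by apply: filterS near_good => K; exact: du_bound.
Qed.

Lemma dv_limit_bound D : msum mu D (dv v) <= BB.
Proof.
apply: (cvg_le_bound _ _ U (fun K => msum mu D (dv (g K))) _ _ PU).
  by apply: (msum_cvg mu U D (fun K => dv (g K))) => x; apply: dens_cvg.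
by apply: filterS near_good => K; exact: dv_bound.
Qed.

Let MB : R := (2 `^ p + 2 `^ q) * (2 * BB) / h0.
Let MB0 : 0 <= MB.
Proof.
apply: divr_ge0; last exact: ltW.
by apply: mulr_ge0; [apply: addr_ge0; exact: powR_ge0|exact: mulr_ge0].
Qed.

Let diffp (w w' : V -> R) D : (forall D, msum mu D (du w) <= BB) -> (forall D, msum mu D (du w') <= BB) ->
  msum mu D (fun x => `|w x - w' x| `^ p) <= MB.
Proof.
move=> hw hw'; rewrite /MB ler_pdivlMr // mulrC.
apply: (le_trans (dens_Lr G mu mu0 mu0_gt0 mu_ge p h0 h1 h1_ge D (fun x => w x - w' x))).
apply: (@le_trans _ _ (msum mu D (fun x => 2 `^ p * (du w x + du w' x)))).
  by apply: msum_le => // x; apply: densB_le.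
rewrite msumZ msumD.
have := hw D; have := hw' D; have := du0 D w; have := du0 D w'.
move: (msum _ _ _) (msum _ _ _) => y z y0 z0 yB zB.
have k1 := powR_ge0 2 p; have k2 := powR_ge0 2 q.
apply: ler_pM => //; [exact: addr_ge0|by rewrite lerDl|lra].
Qed.

Let diffq (w w' : V -> R) D : (forall D, msum mu D (dv w) <= BB) -> (forall D, msum mu D (dv w') <= BB) ->
  msum mu D (fun x => `|w x - w' x| `^ q) <= MB.
Proof.
move=> hw hw'; rewrite /MB ler_pdivlMr // mulrC.
apply: (le_trans (dens_Lr G mu mu0 mu0_gt0 mu_ge q h0 h2 h2_ge D (fun x => w x - w' x))).
apply: (@le_trans _ _ (msum mu D (fun x => 2 `^ q * (dv w x + dv w' x)))).
  by apply: msum_le => // x; apply: densB_le.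
rewrite msumZ msumD.
have := hw D; have := hw' D; have := dv0 D w; have := dv0 D w'.
move: (msum _ _ _) (msum _ _ _) => y z y0 z0 yB zB.
have k1 := powR_ge0 2 p; have k2 := powR_ge0 2 q.
apply: ler_pM => //; [exact: addr_ge0|by rewrite lerDr|lra].
Qed.

Let diff_sup (w w' : V -> R) x : `|w x| <= CB -> `|w' x| <= CB -> `|w x - w' x| <= 2 * CB.
Proof. by move=> h h'; apply: (le_trans (ler_normB _ _)); lra. Qed.

Let sup2 (z : R) : `|z| <= CB -> `|z| <= 2 * CB.
Proof. by move=> h; have := CB0; lra. Qed.

Let lo K K' := lower_order (f K') (g K') (fun x => f K x - f K' x) (fun x => g K x - g K' x).
(** The pointwise limit of [lo K K'] as [K'] runs along [U] with [K] fixed. *)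
Let lo_lim K := lower_order u v (fun x => f K x - u x) (fun x => g K x - v x).

Let lo_tail (d : R) : 0 < d -> exists A,
  (forall K K', good K -> good K' -> small_off mu A (lo K K') d) /\
  (forall K, good K -> small_off mu A (lo_lim K) d).
Proof.
move=> d0; have C20 : 0 <= 2 * CB by apply: mulr_ge0.
have [A hA] := lower_order_tail (2 * CB) MB d C20 MB0 d0.
exists A; split => [K K' gK gK'|K gK]; apply: hA => x.
- by apply/sup2/f_sup.
- by apply/sup2/g_sup.
- by apply: (diff_sup (f K) (f K')); apply: f_sup.
- by apply: (diff_sup (g K) (g K')); apply: g_sup.
- by apply: diffp => D; exact: du_bound.
- by apply: diffq => D; exact: dv_bound.
- exact/sup2/u_sup.
- exact/sup2/v_sup.
- by apply: (diff_sup (f K) u); [apply: f_sup|exact: u_sup].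
- by apply: (diff_sup (g K) v); [apply: g_sup|exact: v_sup].
- by apply: diffp => D; [exact: du_bound|exact: du_limit_bound].
- by apply: diffq => D; [exact: dv_bound|exact: dv_limit_bound].
Qed.

Let lower_order_cvg (k1 k2 k3 k4 : {fset (bool * V)} -> V -> R) (l1 l2 l3 l4 : V -> R) x :
  (forall x, (fun i => k1 i x) @ U --> l1 x) -> (forall x, (fun i => k2 i x) @ U --> l2 x) ->
  (forall x, (fun i => k3 i x) @ U --> l3 x) -> (forall x, (fun i => k4 i x) @ U --> l4 x) ->
  (fun i => lower_order (k1 i) (k2 i) (k3 i) (k4 i) x) @ U --> lower_order l1 l2 l3 l4 x.
Proof.
move=> c1 c2 c3 c4.
apply: cvgD; last by do 2 apply: cvgMl_tmp; exact: c4.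
apply: cvgD; last by do 2 apply: cvgMl_tmp; exact: c3.
apply: cvgD; apply: cvgM; [|exact: c3| |exact: c4].
  exact: (partial_s_cvg F F_C1 U _ _ _ _ (c1 x) (c2 x)).
exact: (partial_t_cvg F F_C1 U _ _ _ _ (c1 x) (c2 x)).
Qed.

Let J K : R := p^-1 * msum mu (clos G K) (du (f K)) + q^-1 * msum mu (clos G K) (dv (g K)).

Let J_cvg : exists Jl : R, J @ U --> Jl.
Proof.
apply: (ultra_bounded_cvg _ _ U _ (p^-1 * BB + q^-1 * BB)) => //.
apply: filterS near_good => K gK.
have ip : 0 <= p^-1 by rewrite invr_ge0 ltW.
have iq : 0 <= q^-1 by rewrite invr_ge0 ltW.
rewrite ger0_norm; last by apply: addr_ge0; apply: mulr_ge0.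
by apply: lerD; apply: ler_wpM2l => //; [exact: du_bound|exact: dv_bound].
Qed.

Let half (w w' : V -> R) := fun y : V => (w y - w' y) / 2.

(* The Galerkin spaces are nested, so the critical equation at [K'] may be
   tested with [(f K - f K', g K - g K')]; uniform convexity then bounds the
   distance by the energy gap. *)
Let gap K K' D : good K -> (K `<=` K')%fset ->
  p^-1 * msum mu D (du (half (f K) (f K'))) + q^-1 * msum mu D (dv (half (g K) (g K')))
  <= (J K - J K') / 2 - II (lo K K') / 2.
Proof.
move=> gK KK'.
have gK' : good K' by case: gK => ? ?; split; exact: (fsubsetP KK').
set D' := clos G K'.
have sub x : (true, x) \notin K' -> (true, x) \notin K by apply: contra; exact: (fsubsetP KK').
have sub' x : (false, x) \notin K' -> (false, x) \notin K by apply: contra; exact: (fsubsetP KK').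
have s1 x : (true, x) \notin K' -> f K x - f K' x = 0.
  by move=> xK; rewrite !f_supp ?subrr //; exact: sub.
have s2 x : (false, x) \notin K' -> g K x - g K' x = 0.
  by move=> xK; rewrite !g_supp ?subrr //; exact: sub'.
have ip : 0 <= p^-1 by rewrite invr_ge0 ltW.
have iq : 0 <= q^-1 by rewrite invr_ge0 ltW.
have L1 : msum mu D (du (half (f K) (f K'))) <= msum mu D' (du (half (f K) (f K'))).
  apply: (@le_trans _ _ (msum mu (D `|` D')%fset (du (half (f K) (f K'))))).
    by apply: msum_subset => //; [move=> x; exact: dens_ge0|exact: fsubsetUl].
  rewrite (msum_supp mu D') ?fsubsetUr // => x xK.
  apply: (dens_clos G mu mugt0 K' p h1 _ true) => // y yK; by rewrite /half s1 // mul0r.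
have L2 : msum mu D (dv (half (g K) (g K'))) <= msum mu D' (dv (half (g K) (g K'))).
  apply: (@le_trans _ _ (msum mu (D `|` D')%fset (dv (half (g K) (g K'))))).
    by apply: msum_subset => //; [move=> x; exact: dens_ge0|exact: fsubsetUl].
  rewrite (msum_supp mu D') ?fsubsetUr // => x xK.
  apply: (dens_clos G mu mugt0 K' q h2 _ false) => // y yK; by rewrite /half s2 // mul0r.
have clKK' : (clos G K `<=` D')%fset.
  by apply/bigfcupsP => -[b0 x] xK _; apply: (clos_sub G K' b0); exact: (fsubsetP KK').
have J1 : msum mu D' (du (f K)) = msum mu (clos G K) (du (f K)).
  apply: msum_supp => // x xK; apply: (dens_clos G mu mugt0 K p h1 _ true) => // y; exact: f_supp.
have J2 : msum mu D' (dv (g K)) = msum mu (clos G K) (dv (g K)).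
  apply: msum_supp => // x xK; apply: (dens_clos G mu mugt0 K q h2 _ false) => // y; exact: g_supp.
have C1 : msum mu D' (du (half (f K) (f K'))) <= (msum mu D' (du (f K)) - msum mu D' (du (f K'))) / 2
    - p / 2 * msum mu D' (ddens G mu p h1 (f K') (fun y => f K y - f K' y)).
  rewrite -msumZ -msumB [_ / 2]mulrC -msumZ -msumB; apply: msum_le => // x.
  rewrite [2^-1 * _]mulrC; exact: dens_convex_gap.
have C2 : msum mu D' (dv (half (g K) (g K'))) <= (msum mu D' (dv (g K)) - msum mu D' (dv (g K'))) / 2
    - q / 2 * msum mu D' (ddens G mu q h2 (g K') (fun y => g K y - g K' y)).
  rewrite -msumZ -msumB [_ / 2]mulrC -msumZ -msumB; apply: msum_le => // x.
  rewrite [2^-1 * _]mulrC; exact: dens_convex_gap.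
have [_ _ cr] := f_crit K' gK'.
have := cr _ _ s1 s2; rewrite /dPhi -/D' => cr0.
(* Criticality at [K'] trades the derivative of the convex part, which comes out of the convexity
   gap, for the lower-order part. *)
have loE : II (lo K K') = msum mu D' (ddens G mu p h1 (f K') (fun y => f K y - f K' y))
    + msum mu D' (ddens G mu q h2 (g K') (fun y => g K y - g K' y)).
  rewrite /II (vint_finite mu muge0 D') /=; last first.
    move=> x xK; rewrite /lo /lower_order.
    rewrite s1 ?s2 ?mulr0 ?addr0 //; [exact: (clos_notin false)|exact: (clos_notin true)].
  rewrite /lo /lower_order msumD msumD !msumZ.
  move: cr0; lra.
rewrite loE /J -J1 -J2.
apply: (le_trans (lerD (ler_wpM2l ip (le_trans L1 C1)) (ler_wpM2l iq (le_trans L2 C2)))).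
move: (msum _ _ _) (msum _ _ _) (msum _ _ _) (msum _ _ _) (msum _ _ _) (msum _ _ _) => m1 m2 m3 m4 m5 m6.
rewrite le_eqVlt; apply/orP; left; apply/eqP; field.
by rewrite !gt_eqF.
Qed.

(** Two successive limits in [gap]. First [K'] runs along [U] with [K] fixed, giving [step]. Then
    [K] runs: J K tends to [Jl], and the lower-order integral tends to 0 since its directions do so
    pointwise with uniform tails. The right side does not involve [D], whence uniformity. *)
Lemma strong_convergence (d : R) : 0 < d -> \forall K \near U, forall D,
  msum mu D (du (fun y => f K y - u y)) <= d /\ msum mu D (dv (fun y => g K y - v y)) <= d.
Proof.
move=> d0.
have [Jl hJ] := J_cvg.
have ip : 0 < p^-1 by rewrite invr_gt0.
have iq : 0 < q^-1 by rewrite invr_gt0.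
have step K D : good K ->
    p^-1 * msum mu D (du (half (f K) u)) + q^-1 * msum mu D (dv (half (g K) v))
    <= (J K - Jl) / 2 - II (lo_lim K) / 2.
  move=> gK; rewrite -subr_le0.
  apply: (cvg_le_bound _ _ U (fun K' => p^-1 * msum mu D (du (half (f K) (f K'))) + q^-1 * msum mu D (dv (half (g K) (g K'))) - ((J K - J K') / 2 - II (lo K K') / 2)) _ _ PU).
    apply: cvgB; first (apply: cvgD; apply: cvgMl_tmp).
    - apply: (msum_cvg mu U D (fun K' => du (half (f K) (f K')))) => x; apply: dens_cvg => // y.
      by apply: cvgMr_tmp; apply: cvgB; [exact: cvg_cst|exact: fu].
    - apply: (msum_cvg mu U D (fun K' => dv (half (g K) (g K')))) => x; apply: dens_cvg => // y.
      by apply: cvgMr_tmp; apply: cvgB; [exact: cvg_cst|exact: gv].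
    - apply: cvgB; apply: cvgMr_tmp; first by apply: cvgB; [exact: cvg_cst|exact: hJ].
      apply: vint_cvg => // [x|e e0].
        by apply: lower_order_cvg => // y; apply: cvgB => //; exact: cvg_cst.
      have [A [hA _]] := lo_tail e e0; exists A.
      by apply: filterS near_good => K' gK'; exact: hA.
  apply: filterS (U_sup K) => K' KK'; rewrite subr_le0; exact: gap.
have lim0 : (fun K => (J K - Jl) / 2 - II (lo_lim K) / 2) @ U --> (0 : R).
  have -> : (0 : R) = (Jl - Jl) / 2 - II (fun=> 0) / 2.
    by rewrite /II (vint_finite mu muge0 fset0) //= /msum big_seq_fset0; ring.
  apply: cvgB; apply: cvgMr_tmp; first by apply: cvgB; [exact: hJ|exact: cvg_cst].
  apply: vint_cvg => // [x|e e0].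
    have -> : (0 : R) = lower_order u v (fun=> 0) (fun=> 0) x by rewrite /lower_order; ring.
    apply: (lower_order_cvg (fun=> u) (fun=> v)) => y; try exact: cvg_cst.
      by rewrite -(subrr (u y)); apply: cvgB; [exact: fu|exact: cvg_cst].
    by rewrite -(subrr (v y)); apply: cvgB; [exact: gv|exact: cvg_cst].
  have [A [_ hA]] := lo_tail e e0; exists A.
  by apply: filterS near_good => K gK; exact: hA.
have kp : 0 < 2 `^ p * p by rewrite mulr_gt0 ?powR_gt0.
have kq : 0 < 2 `^ q * q by rewrite mulr_gt0 ?powR_gt0.
(* Undoing the halves costs 2^p or 2^q, undoing the factors 1/p and 1/q costs p or q; the sum of
   both costs serves the two components at once. *)
pose d' := d / (2 `^ p * p + 2 `^ q * q).
have d'0 : 0 < d' by rewrite divr_gt0 // addr_gt0.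
have /cvgrPdist_lt /(_ d' d'0) near_small := lim0.
apply: filterS2 near_good near_small => K gK small D.
have st := step K D gK.
have sm : p^-1 * msum mu D (du (half (f K) u)) + q^-1 * msum mu D (dv (half (g K) v)) <= d'.
  apply: (le_trans st); apply: ltW; move: small; rewrite sub0r normrN.
  by apply: le_lt_trans; exact: ler_norm.
have e1' : msum mu D (du (fun y => f K y - u y)) = 2 `^ p * msum mu D (du (half (f K) u)).
  rewrite -msumZ; apply: msum_eq => x.
  have -> : (fun y => f K y - u y) = (fun y => 2 * half (f K) u y).
    by apply/funext => y; rewrite /half; field.
  by rewrite /du dens_scale // ger0_norm.
have e2' : msum mu D (dv (fun y => g K y - v y)) = 2 `^ q * msum mu D (dv (half (g K) v)).
  rewrite -msumZ; apply: msum_eq => x.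
  have -> : (fun y => g K y - v y) = (fun y => 2 * half (g K) v y).
    by apply/funext => y; rewrite /half; field.
  by rewrite /dv dens_scale // ger0_norm.
have y0 := du0 D (half (f K) u); have z0 := dv0 D (half (g K) v).
have dd : d = (2 `^ p * p + 2 `^ q * q) * d' by rewrite /d'; field; rewrite gt_eqF // addr_gt0.
rewrite e1' e2' dd; move: sm y0 z0; clear -p0 q0 ip iq kp kq d'0.
have k1 := powR_gt0 p (ltr0Sn R 1); have k2 := powR_gt0 q (ltr0Sn R 1).
move: (msum _ _ _) (msum _ _ _) => z y sm y0 z0.
have py : p^-1 * y <= d' by apply: le_trans sm; rewrite lerDl; apply: mulr_ge0 => //; exact: ltW.
have qz : q^-1 * z <= d' by apply: le_trans sm; rewrite lerDr; apply: mulr_ge0 => //; exact: ltW.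
rewrite mulrC ler_pdivrMr // in py; rewrite mulrC ler_pdivrMr // in qz.
split.
- apply: (@le_trans _ _ (2 `^ p * (d' * p))); first by apply: ler_wpM2l => //; exact: ltW.
  have -> : 2 `^ p * (d' * p) = 2 `^ p * p * d' by ring.
  rewrite mulrDl lerDl; apply: mulr_ge0; exact: ltW.
- apply: (@le_trans _ _ (2 `^ q * (d' * q))); first by apply: ler_wpM2l => //; exact: ltW.
  have -> : 2 `^ q * (d' * q) = 2 `^ q * q * d' by ring.
  rewrite mulrDl lerDr; apply: mulr_ge0; exact: ltW.
Qed.

(** Eventually [x] belongs to [K] in both components, so the approximations solve the equations at
    [x] exactly. These involve finitely many vertices, and pointwise convergence suffices. *)
Lemma limit_equations x :
  (- pLaplacian G mu p u x + h1 x * (`|u x| `^ (p - 2) * u x) =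
     partial_s F x (u x) (v x) + lambda * e1 x) /\
  (- pLaplacian G mu q v x + h2 x * (`|v x| `^ (q - 2) * v x) =
     partial_t F x (u x) (v x) + lambda * e2 x).
Proof.
have pp : 0 <= p - 2 by have := p2; lra.
have qq : 0 <= q - 2 by have := q2; lra.
have zero b0 (K : {fset (bool * V)}) y : (b0, x) \in K -> (b0, y) \notin K -> single x y = 0 :> R.
  by move=> xK yK; rewrite /single; case: eqP yK => // ->; rewrite xK.
have near_x := U_sup [fset (true, x); (false, x)]%fset.
split; apply/eqP; rewrite -subr_eq0; apply/eqP.
- apply: (cvg_eventually_eq0 _ _ U (fun K => - pLaplacian G mu p (f K) x + h1 x * (`|f K x| `^ (p - 2) * f K x)
      - (partial_s F x (f K x) (g K x) + lambda * e1 x)) _ PU).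
    apply: cvgB; apply: cvgD.
    + by apply: cvgN; apply: pLaplacian_cvg.
    + apply: cvgMl_tmp; apply: cvgM; last exact: fu.
      by apply: norm_powR_cvg.
    + exact: (partial_s_cvg F F_C1 U _ _ _ _ (fu x) (gv x)).
    + exact: cvg_cst.
  apply: filterS2 near_good near_x => K gK /fsubsetP sK.
  have xK : (true, x) \in K by by apply: sK; rewrite !inE eqxx ?orbT.
  have [_ _ cr] := f_crit K gK.
  have [h _] := dPhi_single G mu p q h1 h2 F e1 e2 lambda mugt0 (clos G K) (f K) (g K) x
    (clos_mem G K true x xK) (clos_nbr G K true x xK).
  rewrite h ?subrr //; apply: cr => // y; exact: (zero true K y xK).
- apply: (cvg_eventually_eq0 _ _ U (fun K => - pLaplacian G mu q (g K) x + h2 x * (`|g K x| `^ (q - 2) * g K x)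
      - (partial_t F x (f K x) (g K x) + lambda * e2 x)) _ PU).
    apply: cvgB; apply: cvgD.
    + by apply: cvgN; apply: pLaplacian_cvg.
    + apply: cvgMl_tmp; apply: cvgM; last exact: gv.
      by apply: norm_powR_cvg.
    + exact: (partial_t_cvg F F_C1 U _ _ _ _ (fu x) (gv x)).
    + exact: cvg_cst.
  apply: filterS2 near_good near_x => K gK /fsubsetP sK.
  have xK : (false, x) \in K by by apply: sK; rewrite !inE eqxx ?orbT.
  have [_ _ cr] := f_crit K gK.
  have [_ h] := dPhi_single G mu p q h1 h2 F e1 e2 lambda mugt0 (clos G K) (f K) (g K) x
    (clos_mem G K false x xK) (clos_nbr G K false x xK).
  rewrite h ?subrr //; apply: cr => // y; exact: (zero false K y xK).
Qed.

(** Membership asks for a sequence in [Cc], so one [K] is picked for each tolerance 1/(m+1). The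
    factor 1 + 1/h0 compares |grad z|^r + |z|^r with [dens]. *)
Lemma in_W1_of_approx (r : R) (h w : V -> R) (k : {fset (bool * V)} -> V -> R) (b0 : bool) :
  2 <= r -> (forall x, h0 <= h x) ->
  (forall K x, good K -> (b0, x) \notin K -> k K x = 0) ->
  (forall d : R, 0 < d -> \forall K \near U, forall D,
     msum mu D (dens G mu r h (fun y => k K y - w y)) <= d) ->
  in_W1 G mu r w.
Proof.
move=> r2 hh ks kw; have r0 : 0 < r by lra.
have hh0 x : 0 <= h x by apply: le_trans (hh x); exact: ltW.
pose ep (m : nat) : R := m.+1%:R^-1.
have ep0 m : 0 < ep m by rewrite invr_gt0.
have c0 : 0 < 1 + h0^-1 by rewrite addr_gt0 // invr_gt0.
have /choice[phi hphi] : forall m, exists K, good K /\ forall D,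
    msum mu D (dens G mu r h (fun y => k K y - w y)) <= ep m `^ r / (1 + h0^-1).
  move=> m.
  have dm : 0 < ep m `^ r / (1 + h0^-1) by rewrite divr_gt0 // powR_gt0.
  exact: (filter_ex (filterI near_good (kw _ dm))).
exists (fun m => k (phi m)) => [m|].
  apply: (@sub_finite_set _ _ [set` clos G (phi m)]); last exact: finite_fset.
  move=> x /= kx; apply: contraNT kx => xK; apply/eqP/ks; first exact: (hphi m).1.
  exact: (clos_notin b0).
have bound m : (0 <= W1_norm G mu r (fun x => w x - k (phi m) x)%R <= (ep m)%:E)%E.
  rewrite /W1_norm poweR_ge0 /=.
  set g0 := (fun x => _ + _).
  have g0_ge x : 0 <= g0 x by rewrite addr_ge0 // powR_ge0.
  have ub : (vint mu g0 <= (ep m `^ r)%:E)%E.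
    rewrite vint_nonneg //; apply: esum_le_msum => B.
    apply: (@le_trans _ _ ((1 + h0^-1) * msum mu B (dens G mu r h (fun y => k (phi m) y - w y)))).
      rewrite -msumZ; apply: msum_le => // x; rewrite densN // /g0.
      set z := fun y => w y - k (phi m) y.
      have A1 := dens_ge G mu r h z x h0 (hh x).
      have A2 : grad_norm G mu z x `^ r <= dens G mu r h z x.
        by rewrite /dens lerDl mulr_ge0 // powR_ge0.
      rewrite mulrDl mul1r; apply: lerD => //.
      by rewrite mulrC ler_pdivlMr // mulrC.
    by rewrite mulrC -ler_pdivlMr //; exact: (hphi m).2.
  have v0 : (0 <= vint mu g0)%E.
    by rewrite vint_nonneg //; apply: esum_ge0 => x _; rewrite lee_fin mulr_ge0.
  have vf : vint mu g0 \is a fin_num.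
    by rewrite ge0_fin_numE //; exact: (le_lt_trans ub (ltry _)).
  rewrite -(fineK vf) poweR_EFin lee_fin.
  have -> : ep m = (ep m `^ r) `^ r^-1.
    by rewrite -powRrM mulfV ?gt_eqF // powRr1 // ltW.
  apply: ge0_ler_powR; rewrite ?invr_ge0 ?nnegrE ?powR_ge0 ?(ltW r0) //.
    exact: fine_ge0.
  by rewrite -lee_fin fineK.
apply: (@squeeze_cvge _ _ _ _ (fun=> 0%E) _ (fun m => (ep m)%:E)).
- by apply: nearW => m; exact: bound.
- exact: cvg_cst.
- by apply: cvg_EFin; [exact: nearW|exact: cvg_harmonic].
Qed.

Lemma limit_in_W1h : in_W1h G mu h1 p u /\ in_W1h G mu h2 q v.
Proof.
have W (r : R) (h w : V -> R) : 2 <= r -> (forall x, 0 <= h x) ->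
    (forall D, msum mu D (dens G mu r h w) <= BB) ->
    (vint mu (fun x => h x * `|w x| `^ r)%R < +oo)%E.
  move=> r2 hh wB; apply: (@le_lt_trans _ _ BB%:E); last exact: ltry.
  rewrite vint_nonneg // => [|x]; last by rewrite mulr_ge0 // powR_ge0.
  apply: esum_le_msum => D; apply: le_trans (wB D); apply: msum_le => // x.
  by rewrite /dens lerDr powR_ge0.
split; split.
- apply: (in_W1_of_approx p h1 u f true) => // d d0.
  by apply: filterS (strong_convergence d d0) => K h D; exact: (h D).1.
- apply: (W p) => // D; exact: du_limit_bound.
- apply: (in_W1_of_approx q h2 v g false) => // d d0.
  by apply: filterS (strong_convergence d d0) => K h D; exact: (h D).2.
- apply: (W q) => // D; exact: dv_limit_bound.
Qed.

(** Uniform tails come from one fixed approximation: the density of [k K] is bounded by those of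
    [k K - w], [k K1 - w] and [k K1], of which the first two have small sums and the last vanishes
    off [clos G K1]. *)
Lemma dens_vint_cvg (r : R) (h w : V -> R) (k : {fset (bool * V)} -> V -> R) (b0 : bool) :
  2 <= r -> (forall x, 0 <= h x) ->
  (forall K x, good K -> (b0, x) \notin K -> k K x = 0) ->
  (forall x, (fun K => k K x) @ U --> w x) ->
  (forall d : R, 0 < d -> \forall K \near U, forall D,
     msum mu D (dens G mu r h (fun y => k K y - w y)) <= d) ->
  (fun K => II (dens G mu r h (k K))) @ U --> II (dens G mu r h w).
Proof.
move=> r2 hh ks kw st; apply: vint_cvg => // [x|d d0]; first by apply: dens_cvg.
have k2 : 0 < 2 `^ r :> R by exact: powR_gt0.
have k22 : 0 < 2 `^ r * (1 + 2 `^ r) :> R by rewrite mulr_gt0 // addr_gt0.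
pose d' := d / (2 `^ r * (1 + 2 `^ r)).
have d'0 : 0 < d' by rewrite divr_gt0.
have [K1 [gK1 hK1]] := filter_ex (filterI near_good (st d' d'0)).
exists (clos G K1); apply: filterS (st d' d'0) => K hK B hB.
apply: (@le_trans _ _ (msum mu B (fun x => 2 `^ r * (dens G mu r h (fun y => k K y - w y) x +
    2 `^ r * (dens G mu r h (fun y => k K1 y - w y) x + dens G mu r h (k K1) x))))).
  apply: msum_le => // x; rewrite ger0_norm; last exact: dens_ge0.
  apply: (le_trans (densB_split r h (k K) w x r2 hh)).
  apply: ler_wpM2l; first exact: ltW.
  apply: lerD => //; rewrite [dens G mu r h (fun y => k K1 y - w y) x]densN //.
  exact: densB_split.
rewrite msumZ msumD msumZ msumD.
rewrite [msum mu B (dens G mu r h (k K1))]msum_supp0 ?addr0; last first.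
  move=> x /hB xK; apply: (dens_clos G mu mugt0 K1 r h _ b0) => // y; exact: ks.
have -> : d = 2 `^ r * (d' + 2 `^ r * d') by rewrite /d'; field; rewrite !gt_eqF // addr_gt0.
apply: ler_wpM2l; first exact: ltW.
by apply: lerD => //; apply: ler_wpM2l => //; exact: ltW.
Qed.

(** The norm integrals converge by strong convergence, the other three by uniform tails; on finitely
    supported pairs these integrals are the finite sums in [PHI]. *)
Lemma energy_cvg : (fun K => PHI (clos G K) (f K) (g K)) @ U -->
  energy G mu p q h1 h2 F e1 e2 lambda u v.
Proof.
have st1 (d : R) : 0 < d -> \forall K \near U, forall D, msum mu D (dens G mu p h1 (fun y => f K y - u y)) <= d.
  by move=> d0; apply: filterS (strong_convergence d d0) => K h D; exact: (h D).1.
have st2 (d : R) : 0 < d -> \forall K \near U, forall D, msum mu D (dens G mu q h2 (fun y => g K y - v y)) <= d.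
  by move=> d0; apply: filterS (strong_convergence d d0) => K h D; exact: (h D).2.
have c1 := dens_vint_cvg p h1 u f true p2 h1_ge0 f_supp fu st1.
have c2 := dens_vint_cvg q h2 v g false q2 h2_ge0 g_supp gv st2.
have [Ca Ca0 hCa] := a_bound CB CB0.
have c3 : (fun K => II (fun x => F x (f K x) (g K x))) @ U --> II (fun x => F x (u x) (v x)).
  apply: vint_cvg => // [x|d d0]; first exact: (F_cvg F F_C1 U _ _ _ _ (fu x) (gv x)).
  have cp : 0 < Ca + 1 by lra.
  have [A hA] := b_tail (d / (Ca + 1)) ltac:(by rewrite divr_gt0).
  exists A; apply: filterS near_good => K gK.
  have := small_offZ mu A b _ (Ca + 1) hA.
  rewrite (gtr0_norm cp) mulrC divfK ?gt_eqF //.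
  apply: small_off_le => // x; rewrite normrM (gtr0_norm cp) (ger0_norm (b_ge0 x)).
  have [_ _ fb] := Fab x (f K x) (g K x).
  apply: (le_trans fb); apply: ler_wpM2r => //.
  by apply: (le_trans (hCa _ _ (f_sup K x gK) (g_sup K x gK))); rewrite lerDl.
have M0 : 0 <= BB / h0 by apply: divr_ge0 => //; exact: ltW.
have c4 : (fun K => II (fun x => e1 x * f K x)) @ U --> II (fun x => e1 x * u x).
  apply: vint_cvg => // [x|d d0]; first by apply: cvgMl_tmp; exact: fu.
  have [A hA] := dual_tail p e1 (BB / h0) d p2 e1L M0 d0.
  exists A; apply: filterS near_good => K gK; apply: hA => D.
  rewrite ler_pdivlMr // mulrC.
  apply: (le_trans (dens_Lr G mu mu0 mu0_gt0 mu_ge p h0 h1 h1_ge D (f K))).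
  exact: du_bound.
have c5 : (fun K => II (fun x => e2 x * g K x)) @ U --> II (fun x => e2 x * v x).
  apply: vint_cvg => // [x|d d0]; first by apply: cvgMl_tmp; exact: gv.
  have [A hA] := dual_tail q e2 (BB / h0) d q2 e2L M0 d0.
  exists A; apply: filterS near_good => K gK; apply: hA => D.
  rewrite ler_pdivlMr // mulrC.
  apply: (le_trans (dens_Lr G mu mu0 mu0_gt0 mu_ge q h0 h2 h2_ge D (g K))).
  exact: dv_bound.
have all5 : (fun K => p^-1 * II (dens G mu p h1 (f K)) + q^-1 * II (dens G mu q h2 (g K))
    - II (fun x => F x (f K x) (g K x)) - lambda * II (fun x => e1 x * f K x)
    - lambda * II (fun x => e2 x * g K x)) @ U --> energy G mu p q h1 h2 F e1 e2 lambda u v.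
  apply: cvgB; last by apply: cvgMl_tmp; exact: c5.
  apply: cvgB; last by apply: cvgMl_tmp; exact: c4.
  apply: cvgB; last exact: c3.
  by apply: cvgD; apply: cvgMl_tmp; [exact: c1|exact: c2].
apply: cvg_trans all5; apply: near_eq_cvg; apply: filterS near_good => K gK.
have fin (k : V -> R) : (forall x, x \notin clos G K -> k x = 0) -> II k = msum mu (clos G K) k.
  by move=> hk; rewrite /II (vint_finite mu muge0 (clos G K)).
rewrite !fin // => x xK.
- by rewrite g_supp ?mulr0 //; exact: (clos_notin false).
- by rewrite f_supp ?mulr0 //; exact: (clos_notin true).
- by rewrite f_supp ?g_supp ?F00 //; [exact: (clos_notin false)|exact: (clos_notin true)].
- by apply: (dens_clos G mu mugt0 K q h2 _ false) => // y; exact: g_supp.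
- by apply: (dens_clos G mu mugt0 K p h1 _ true) => // y; exact: f_supp.
Qed.

Lemma limit_solution : is_solution G mu p q h1 h2 F e1 e2 lambda u v.
Proof.
have [W1 W2] := limit_in_W1h; split => // x; exact: limit_equations.
Qed.

End Net.

Lemma energy0 : energy G mu p q h1 h2 F e1 e2 lambda (cst 0) (cst 0) = 0.
Proof.
have fin (k : V -> R) : (forall x, k x = 0) -> fine (vint mu k) = 0.
  by move=> hk; rewrite (vint_finite mu muge0 fset0) //= /msum big_seq_fset0.
have d0 r h x : 2 <= r -> dens G mu r h (cst 0) x = 0 by move=> r2; apply: dens_supp.
rewrite /energy !fin ?mulr0 ?subr0 ?addr0 // => x.
- by rewrite mulr0.
- by rewrite mulr0.
- exact: (d0 q h2).
- exact: (d0 p h1).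
Qed.

(** Closedness of [P] lets a bound on the level pass to the limit; it serves both for levels at
    least a positive constant and for levels at most a negative one. *)
Theorem galerkin_limit (x0 : V) (BB : R) (P : set R) : closed P ->
  (forall K, (true, x0) \in K -> (false, x0) \in K -> exists u v,
    [/\ crit K u v, P (PHI (clos G K) u v) &
      msum mu (clos G K) (du u) + msum mu (clos G K) (dv v) <= BB]) ->
  exists u v, is_solution G mu p q h1 h2 F e1 e2 lambda u v /\
    P (energy G mu p q h1 h2 F e1 e2 lambda u v).
Proof.
move=> cP hK; have [U [UU Us]] := @supersets_ultra (bool * V)%type.
have PU : ProperFilter U := @ultra_proper _ _ UU.
have /choice[fg hfg] : forall K, exists fg : (V -> R) * (V -> R),
    (true, x0) \in K /\ (false, x0) \in K ->
    [/\ crit K fg.1 fg.2, P (PHI (clos G K) fg.1 fg.2) &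
      msum mu (clos G K) (du fg.1) + msum mu (clos G K) (dv fg.2) <= BB].
  move=> K; have [[tK fK]|ng] := pselect ((true, x0) \in K /\ (false, x0) \in K).
    by have [u [v h]] := hK K tK fK; exists (u, v).
  (* A filler for the finite sets that miss [x0], which are negligible for [U]. *)
  by exists (cst 0, cst 0).
pose f K := (fg K).1; pose g K := (fg K).2.
have cr K : (true, x0) \in K /\ (false, x0) \in K -> crit K (f K) (g K) by case/hfg.
have bd K : (true, x0) \in K /\ (false, x0) \in K ->
  msum mu (clos G K) (du (f K)) + msum mu (clos G K) (dv (g K)) <= BB by case/hfg.
have [u [v [fu gv]]] := pointwise_limits U x0 BB UU Us f g cr bd.
exists u, v; split; first exact: (limit_solution U x0 BB UU Us f g cr bd u v fu gv).
apply: (closed_cvg P cP _ _ (energy_cvg U x0 BB UU Us f g cr bd u v fu gv)).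
have ng := near_good U x0 UU Us.
by apply: filterS ng => K /hfg[].
Qed.

End Limit.


(** * The main theorem *)

Theorem theorem1p3 (R : realType) (V : choiceType) (G : weighted_graph R V)
  (mu : V -> R) (mu0 : R) (mu0_gt0 : 0 < mu0) (mu_ge : forall x, mu0 <= mu x)
  (p q : R) (p_ge2 : 2 <= p) (q_ge2 : 2 <= q)
  (h1 h2 : V -> R) (F : V -> R -> R -> R) (e1 e2 : V -> R)
  (e1_Lp' : in_Lr mu (p / (p - 1)) e1) (e2_Lq' : in_Lr mu (q / (q - 1)) e2)
  (e1_neq0 : e1 <> cst 0) (e2_neq0 : e2 <> cst 0)
  (* (H1) *)
  (h0 : R) (h0_gt0 : 0 < h0)
  (H1 : forall x, h0 <= h1 x /\ h0 <= h2 x)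
  (* (H2') *)
  (H2' : forall B : R, 0 < B ->
     (\esum_(x in [set x | (h1 x <= B)%R]) (mu x)%:E < +oo)%E /\
     (\esum_(x in [set x | (h2 x <= B)%R]) (mu x)%:E < +oo)%E)
  (* (F0) *)
  (F0_C1 : C1_in_st F)
  (F0_bound : exists (a : R -> R) (b : V -> R),
     [/\ {within `[0, +oo[%classic, continuous a},
         forall r : R, 0 <= r -> 0 <= a r,
         forall x, 0 <= b x,
         in_Lr mu 1 b &
         forall x (s t : R),
           [/\ `|partial_s F x s t| <= a (euclid s t) * b x,
               `|partial_t F x s t| <= a (euclid s t) * b x &
               `|F x s t| <= a (euclid s t) * b x]])
  (* (C1) *)
  (C1_F0 : forall x, F x 0 0 = 0)
  (l0 : R) (l0_gt0 : 0 < l0)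
  (C1 : forall x (s t : R), euclid s t < l0 ->
     `|partial_s F x s t|
       <= h0 / (q + 1) * (`|s| `^ (p - 1) + `|t| `^ ((p * q - q) / p)) /\
     `|partial_t F x s t|
       <= h0 / (q + 1) * (`|s| `^ p + `|t| `^ (q - 1)))
  (* (C2) *)
  (C2 : exists (l1 : R) (x3 : V) (M : R),
     [/\ 0 < l1,
         0 < e1 x3 + e2 x3,
         forall s : R, l1 < s -> M * (s `^ p + s `^ q) <= F x3 s s &
         Num.max ((Dconst G mu p x3 + mu x3 * h1 x3) / (p * mu x3))
                 ((Dconst G mu q x3 + mu x3 * h2 x3) / (q * mu x3)) < M])
  (* (C3) *)
  (C3 : exists nu A : R,
     [/\ Num.max p q < nu,
         0 <= A,
         A < Num.min (nu / p - 1) (nu / q - 1) * h0 &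
         forall x (s t : R),
           nu * F x s t - partial_s F x s t * s - partial_t F x s t * t
             <= A * (`|s| `^ p + `|t| `^ q)]) :
  (forall lambda : R, 0 < lambda < lambda0 mu p q h0 mu0 l0 e1 e2 ->
     exists u v : V -> R,
       [/\ is_solution G mu p q h1 h2 F e1 e2 lambda u v,
           nontrivial u v &
           0 < energy G mu p q h1 h2 F e1 e2 lambda u v])
  /\
  ((* (C4) *)
   (exists (l2 beta3 : R) (K3 : V -> R) (x4 : V),
      [/\ 0 < l2,
          1 < beta3,
          0 < e1 x4 + e2 x4,
          0 < K3 x4 &
          forall s : R, 0 < s < l2 -> - K3 x4 * `|s| `^ beta3 <= F x4 s s]) ->
   forall lambda : R, 0 < lambda < lambda0 mu p q h0 mu0 l0 e1 e2 ->
     exists u v : V -> R,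
       [/\ is_solution G mu p q h1 h2 F e1 e2 lambda u v,
           nontrivial u v &
           energy G mu p q h1 h2 F e1 e2 lambda u v < 0]).
Proof.
have [a [b [a_cont a_ge0 b_ge0 bL Fab]]] := F0_bound.
have lim := galerkin_limit G mu mu0 mu0_gt0 mu_ge p q h1 h2 F e1 e2 _ p_ge2 q_ge2
  e1_Lp' e2_Lq' h0 h0_gt0 H1 F0_C1 C1_F0 a b a_cont a_ge0 b_ge0 bL Fab.
(* The zero pair has energy 0, so either sign of the energy yields nontriviality. *)
have nontriv lambda u v : energy G mu p q h1 h2 F e1 e2 lambda u v != 0 -> nontrivial u v.
  move=> + [uE vE]; rewrite uE vE (energy0 G mu mu0 mu0_gt0 mu_ge) //.
  by rewrite eqxx.
split.
- move=> lambda lr.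
  have [l1 [x3 [M [l10 ex3 FM MM]]]] := C2.
  have [nu [A [nu_gt A0 A_lt hC3]]] := C3.
  have [al [B [al0 hK]]] := galerkin_mountain_pass G mu mu0 mu0_gt0 mu_ge p q h1 h2 F e1 e2 lambda
    p_ge2 q_ge2 e1_Lp' e2_Lq' h0 h0_gt0 H1 F0_C1 C1_F0 l0 l0_gt0 C1 lr
    x3 l1 M nu A l10 ex3 FM MM nu_gt A0 A_lt hC3.
  have [u [v [sol en]]] := lim lambda x3 B [set x | al <= x] (@closed_ge R al) hK.
  have en0 := lt_le_trans al0 en.
  by exists u, v; split => //; apply: (nontriv lambda); rewrite gt_eqF.
- move=> [l2 [beta3 [K3 [x4 [l20 b31 ex4 K30 FK]]]]] lambda lr.
  have [c [B [c0 hK]]] := galerkin_minimum G mu mu0 mu0_gt0 mu_ge p q h1 h2 F e1 e2 lambda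
    p_ge2 q_ge2 e1_Lp' e2_Lq' h0 h0_gt0 H1 F0_C1 C1_F0 l0 l0_gt0 C1 lr
    x4 l2 beta3 (K3 x4) l20 b31 ex4 K30 FK.
  have [u [v [sol en]]] := lim lambda x4 B [set x | x <= c] (@closed_le R c) hK.
  have en0 := le_lt_trans en c0.
  by exists u, v; split => //; apply: (nontriv lambda); rewrite lt_eqF.
Qed.
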